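(* Let the integers $a,b$ be given in one of the following ways: a) $a=r_1r_2-(r_1+r_2)^2$, $b=r_1r_2(r_1+r_2)$, where $r_1,r_2$ are integers with $1\le r_1<r_2\le 15$; b) $a=-3r_1^2-dr_2^2$, $b=2r_1(r_1^2-dr_2^2)$, where $r_1,r_2\in\{1,2,3\}$, $d\in\{-163,-67,-43,-19,-11,-7,-3,-2,-1,3,6,7,11,13,14,17,19\}$, and for $d=-3$ one takes $r_1\neq r_2$ and $(r_1,r_2)\neq(1,3)$; c) $(a,b)$ is one of: $(-189,189)$, $(-837,3348)$, $(-5697,74061)$, $(-8289,132624)$, $(-11367,215973)$, $(-46521,1860840)$, $(-1809,9045)$, $(-5373,59103)$, $(-39069,1367415)$, $(-3,-1)$, $(-333,999)$, $(-1647,1647)$, $(-4887,34209)$, $(-10071,130923)$, $(-37287,1155897)$, $(-50247,1859139)$, $(-513,-3591)$, $(-2943,5886)$, $(-9747,107217)$, $(-16713,284121)$, $(-42633,1364256)$, $(-9,-9)$, $(-441,1323)$, $(-999,-10989)$, $(-12339,123390)$, $(-29511,649242)$, $(-35019,875475)$, $(-47493,1472283)$, $(-1323,-17199)$, $(-9099,45495)$, $(-15579,171369)$, $(-2133,-36261)$, $(-8937,8937)$, $(-23193,301509)$; d) $(a,b)$ is one of: $(1,1)$, $(4,4)$, $(8,8)$, $(9,9)$, $(22,44)$, $(36,144)$, $(63,441)$. Let $g(u)=-ab(u^2+1)\bigl(b^2(u^4+u^2+1)^3+a^3u^4(u^2+1)^2\bigr)$ and let $E_g^{a,b}: y^2=x^3+ag(u)^2x+bg(u)^3$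 over $\mathbb{Q}(u)$. Then $E_g^{a,b}$ has rank two over $\mathbb{Q}(u)$, with free generators the two points $P_g^{a,b}=\left(-\frac{b(u^2+u+1)(u^2-u+1)}{a(u^2+1)}g(u),\ \frac{1}{a^2(u^2+1)^2}g(u)^2\right)$ and $Q_g^{a,b}=\left(-\frac{b(u^2+u+1)(u^2-u+1)}{au^2(u^2+1)}g(u),\ \frac{1}{a^2u^3(u^2+1)^2}g(u)^2\right)$.
   Context: $E_g^{a,b}$ is the quadratic twist by $g$ of the elliptic curve $E^{a,b}: y^2=x^3+ax+b$ over $\mathbb{Q}$. ''Free generators'' means that $P_g^{a,b},Q_g^{a,b}$ are independent and every point of $E_g^{a,b}(\mathbb{Q}(u))$ is a $\mathbb{Z}$-linear combination of them and torsion points. *)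

(* Defs.v *)
From HB Require Import structures.
From mathcomp Require Import all_boot all_order all_algebra.
From Stdlib Require Import BinNums PArith.
Set Implicit Arguments. Unset Strict Implicit. Unset Printing Implicit Defensive.
Import Order.TTheory GRing.Theory Num.Theory.
Local Open Scope ring_scope.

(* None is the point at infinity O, Some (x, y) an affine point. *)
Section EC.
Variable K : fieldType.

Definition ecpoint := option (K * K).

Definition on_curve (A B : K) (p : ecpoint) : Prop :=
  match p with
  | None => True
  | Some (x, y) => y ^+ 2 = x ^+ 3 + A * x + B
  end.

Definition ecadd (A : K) (p q : ecpoint) : ecpoint :=
  match p, q with
  | None, _ => q
  | _, None => p
  | Some (x1, y1), Some (x2, y2) =>
    if x1 == x2 then
      if y1 + y2 == 0 then None
      else let l := (3 * x1 ^+ 2 + A) / (2 * y1) in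
           let x3 := l ^+ 2 - 2 * x1 in
           Some (x3, l * (x1 - x3) - y1)
    else let l := (y2 - y1) / (x2 - x1) in
         let x3 := l ^+ 2 - x1 - x2 in
         Some (x3, l * (x1 - x3) - y1)
  end.

Definition ecneg (p : ecpoint) : ecpoint :=
  match p with None => None | Some (x, y) => Some (x, - y) end.

Fixpoint ecmuln (A : K) (n : nat) (p : ecpoint) : ecpoint :=
  match n with 0%N => None | n'.+1 => ecadd A p (ecmuln A n' p) end.

Definition ecmul (A : K) (m : int) (p : ecpoint) : ecpoint :=
  match m with
  | Posz n => ecmuln A n p
  | Negz n => ecneg (ecmuln A n.+1 p)
  end.

Definition ec_torsion (A B : K) (t : ecpoint) : Prop :=
  on_curve A B t /\ exists k : nat, (0 < k)%nat /\ ecmuln A k t = None.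

Definition ec_free_generators2 (A B : K) (P Q : ecpoint) : Prop :=
  [/\ on_curve A B P, on_curve A B Q,
      (forall m n : int, ecadd A (ecmul A m P) (ecmul A n Q) = None ->
          m = 0 /\ n = 0) &
      (forall R, on_curve A B R ->
         exists (m n : int) (T : ecpoint), ec_torsion A B T /\
           R = ecadd A (ecadd A (ecmul A m P) (ecmul A n Q)) T)].
End EC.

Definition Qu : fieldType := {fraction {poly rat}}.
Definition uQ : Qu := FracField.tofrac ('X : {poly rat}).

Definition case_a (a b : int) : Prop :=
  exists r1 r2 : int, [/\ 1 <= r1, r1 < r2, r2 <= 15,
    a = r1 * r2 - (r1 + r2) ^+ 2 & b = r1 * r2 * (r1 + r2)].

Definition dlist : seq int :=
  [:: -163; -67; -43; -19; -11; -7; -3; -2; -1; 3; 6; 7; 11; 13; 14; 17; 19].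

Definition case_b (a b : int) : Prop :=
  exists r1 r2 d : int,
    [/\ r1 \in [:: 1; 2; 3], r2 \in [:: 1; 2; 3], d \in dlist &
        (d = -3 -> r1 <> r2 /\ (r1, r2) <> (1, 3))] /\
    a = - 3 * r1 ^+ 2 - d * r2 ^+ 2 /\
    b = 2 * r1 * (r1 ^+ 2 - d * r2 ^+ 2).

(* integer literals given in binary, to avoid unary nat blow-up *)
Definition pP (p : positive) : int := Posz (nat_of_bin (Npos p)).
Definition nP (p : positive) : int := - pP p.

Definition clist : seq (int * int) := (
  [:: (nP 189%positive, pP 189%positive); (nP 837%positive, pP 3348%positive); (nP 5697%positive, pP 74061%positive); (nP 8289%positive, pP 132624%positive);
      (nP 11367%positive, pP 215973%positive); (nP 46521%positive, pP 1860840%positive); (nP 1809%positive, pP 9045%positive); (nP 5373%positive, pP 59103%positive);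
      (nP 39069%positive, pP 1367415%positive); (nP 3%positive, nP 1%positive); (nP 333%positive, pP 999%positive); (nP 1647%positive, pP 1647%positive);
      (nP 4887%positive, pP 34209%positive); (nP 10071%positive, pP 130923%positive); (nP 37287%positive, pP 1155897%positive); (nP 50247%positive, pP 1859139%positive);
      (nP 513%positive, nP 3591%positive); (nP 2943%positive, pP 5886%positive); (nP 9747%positive, pP 107217%positive); (nP 16713%positive, pP 284121%positive);
      (nP 42633%positive, pP 1364256%positive); (nP 9%positive, nP 9%positive); (nP 441%positive, pP 1323%positive); (nP 999%positive, nP 10989%positive);
      (nP 12339%positive, pP 123390%positive); (nP 29511%positive, pP 649242%positive); (nP 35019%positive, pP 875475%positive); (nP 47493%positive, pP 1472283%positive);
      (nP 1323%positive, nP 17199%positive); (nP 9099%positive, pP 45495%positive); (nP 15579%positive, pP 171369%positive); (nP 2133%positive, nP 36261%positive);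
      (nP 8937%positive, pP 8937%positive); (nP 23193%positive, pP 301509%positive)]).

Definition dlist_pairs : seq (int * int) :=
  [:: (pP 1%positive, pP 1%positive); (pP 4%positive, pP 4%positive); (pP 8%positive, pP 8%positive); (pP 9%positive, pP 9%positive); (pP 22%positive, pP 44%positive); (pP 36%positive, pP 144%positive); (pP 63%positive, pP 441%positive)].

Definition admissible_ab (a b : int) : Prop :=
  [\/ case_a a b, case_b a b, (a, b) \in clist | (a, b) \in dlist_pairs].

Definition gQ (a b : int) : Qu :=
  let u := uQ in let a' : Qu := a%:~R in let b' : Qu := b%:~R in
  - a' * b' * (u ^+ 2 + 1) *
    (b' ^+ 2 * (u ^+ 4 + u ^+ 2 + 1) ^+ 3 + a' ^+ 3 * u ^+ 4 * (u ^+ 2 + 1) ^+ 2).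

Definition EgA (a b : int) : Qu := a%:~R * gQ a b ^+ 2.
Definition EgB (a b : int) : Qu := b%:~R * gQ a b ^+ 3.

Definition Pg (a b : int) : ecpoint Qu :=
  let u := uQ in let a' : Qu := a%:~R in let b' : Qu := b%:~R in
  let g := gQ a b in
  Some (- (b' * (u ^+ 2 + u + 1) * (u ^+ 2 - u + 1)) / (a' * (u ^+ 2 + 1)) * g,
        g ^+ 2 / (a' ^+ 2 * (u ^+ 2 + 1) ^+ 2)).

Definition Qg (a b : int) : ecpoint Qu :=
  let u := uQ in let a' : Qu := a%:~R in let b' : Qu := b%:~R in
  let g := gQ a b in
  Some (- (b' * (u ^+ 2 + u + 1) * (u ^+ 2 - u + 1)) / (a' * u ^+ 2 * (u ^+ 2 + 1)) * g,
        g ^+ 2 / (a' ^+ 2 * u ^+ 3 * (u ^+ 2 + 1) ^+ 2)).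

(* Main.v *)
(* In coordinates with D y^2 = f(x), f = x^3 + a x + b, the map
   lambda(x, y) = x' / y is additive on the twist by D and its kernel is the
   2-torsion.  For D = g the involutions u -> -u and u -> 1/u, followed by
   z -> 1/z on v = z - 1 = u^2, push every point down to the twists of E over
   Q(X) by f(X) and by h = f(X) (a X - 3 b) (a X + b); on the first lambda is
   constant, and the second has no point with y <> 0.  Hence lambda of any
   point of E_g is a rational combination of lambda(P) and lambda(Q).

   That the twist by h has only trivial points is seen modulo a prime p <= 37:
   by the Cartier operator, lambda mod p would be an eigenvector of the
   Hasse-Witt matrix of w^2 = h with the Hasse invariant of E as eigenvalue,
   and a determinant computation excludes this.  The kernel of reduction is
   handled over a valuation ring of the algebraic numbers by halving points.

   The degree of x is a quadratic form modulo 2-torsion, takes the value 4 on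
   the orthogonal points P, Q, and is at least 4 on every non-torsion point
   because g is squarefree of degree 14.  Rounding the rational coordinates of
   a point to integers leaves a point of height at most 2, which is torsion. *)
From Stdlib Require Import BinNums BinInt.
From HB Require Import structures.
From mathcomp Require Import all_boot all_order all_algebra all_field.
From mathcomp Require Import boolp classical_sets.
From mathcomp Require Import ring zify ssrZ.
Require Import Defs.
Set Implicit Arguments. Unset Strict Implicit. Unset Printing Implicit Defensive.
Import Order.TTheory GRing.Theory Num.Theory.
Local Open Scope ring_scope.

(** The abscissa [-b(u^4+u^2+1)/(a(u^2+1))] of P is the solution x of f(x/u^2) = f(x)/u^6, which is
    linear in x because the cubic terms cancel. Hence x and x/u^2 both give points on the twist by
    f(x), and g is f(x) times a square. Lambda is under control because lambda dX/w is the pullback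
    of the invariant differential of E to the curve w^2 = D(X): it is holomorphic, so lambda is a
    polynomial of degree below the genus, which is 1 for f and 2 for h. The factor (a X - 3 b)(a X +
    b) of h is, up to a square, the discriminant of z + 1/z = 1 - a X/b. Reduction modulo p alone
    only shows that a point of the twist by h reduces to a 2-torsion point. Moving it into the
    kernel of reduction requires the roots of f, hence a valuation ring of a large field; its value
    group is not discrete, so the descent there is on degrees of denominators. Associativity of the
    group law is avoided: apart from one cancellation, sums are rearranged only after applying
    lambda, and heights are shown to depend on lambda alone. *)

Section QuarticBezout.
Variables (R : comRingType) (a b A B : R).
Let FA := 3 * A ^+ 2 * B + a * B ^+ 3.
Let FB := A ^+ 3 + 3 * a * A * B ^+ 2 + 4 * b * B ^+ 3.

(** [FA] and [FB] are the partial derivatives of the form [quartic]. Bezout combinations of them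
    reach [B^5] and, in the next lemma, [A^5] up to the constant [4 (4a^3 + 27b^2)]; so they have no
    common factor when [A], [B] are coprime and that constant is invertible. *)
Lemma quartic_bezout_right :
  (- (18 * a * A - 27 * b * B) * A
     + 4 * (6 * a * A ^+ 2 - 9 * b * A * B + 4 * a ^+ 2 * B ^+ 2)) * FA
  + (- (18 * a * A - 27 * b * B) * B) * FB
  = 4 * (4 * a ^+ 3 + 27 * b ^+ 2) * B ^+ 5.
Proof. rewrite /FA /FB; ring. Qed.

Lemma quartic_bezout_left :
  (- (a ^+ 2 * b) * A ^+ 2 - (18 * a ^+ 4 + 120 * a * b ^+ 2) * A * B
     - (24 * a ^+ 3 * b + 144 * b ^+ 3) * B ^+ 2) * FA
  + (4 * (4 * a ^+ 3 + 27 * b ^+ 2) * A ^+ 2 + 3 * a ^+ 2 * b * A * B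
     + (6 * a ^+ 4 + 36 * a * b ^+ 2) * B ^+ 2) * FB
  = 4 * (4 * a ^+ 3 + 27 * b ^+ 2) * A ^+ 5.
Proof. rewrite /FA /FB; ring. Qed.
End QuarticBezout.

(** This is [B^4 f(A/B)]: for [B != 0] the point [(A/B, W/B^2)] lies on [D y^2 = f(x)] exactly when
    it equals [D W^2]. The homogeneous form can be reduced modulo a prime even if [B] reduces to
    zero. *)
Definition quartic (R : comNzRingType) (a b : R) (A B : {poly R}) : {poly R} :=
  A ^+ 3 * B + a%:P * A * B ^+ 3 + b%:P * B ^+ 4.

(** * Points on a quadratic twist and their holomorphic differentials *)

Section PlanePolynomials.
Variable F : fieldType.
Implicit Types (a b c : F) (A B D J L M P Q V W : {poly F}).

Definition cubic a b c : F := c ^+ 3 + a * c + b.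
Definition cubic_disc a b : F := 4 * a ^+ 3 + 27 * b ^+ 2.

(** The numerator of [(A/B)'] over [B^2]; at a point [(A/B, W/B^2)] lambda is
    [wronskian A B / W]. *)
Definition wronskian A B : {poly F} := A^`() * B - A * B^`().

(** After cancelling the gcd of [M] and [V], the square of what is left of [M] divides [D]; so it
    divides [D'] too and is a unit. *)
Lemma squarefree_sqr_dvd D M V :
  coprimep D D^`() -> M ^+ 2 %| D * V ^+ 2 -> M %| V.
Proof.
move=> sfD dvdMV.
have [M0|M0] := eqVneq M 0.
  move: dvdMV; rewrite M0 expr0n /= dvd0p mulf_eq0 sqrf_eq0.
  move=> /orP[/eqP D0|/eqP->]; last by rewrite dvdp0.
  by move: sfD; rewrite D0 linear0 coprimep0 -size_poly_eq1 size_poly0.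
set g := gcdp M V.
have g0 : g != 0 by rewrite gcdp_eq0 negb_and M0.
have /dvdpP[M1 eM] : g %| M by apply: dvdp_gcdl.
have /dvdpP[V1 eV] : g %| V by apply: dvdp_gcdr.
have cMV : coprimep M1 V1.
  have e1 : M1 = M %/ g by rewrite eM mulpK.
  have e2 : V1 = V %/ g by rewrite eV mulpK.
  by rewrite e1 e2 coprimep_div_gcd // M0.
have M12 : M1 ^+ 2 %| D.
  have g20 : g ^+ 2 != 0 by rewrite expf_neq0.
  move: dvdMV; rewrite eM eV !exprMn [D * _]mulrA (dvdp_mul2r _ _ g20).
  by rewrite Gauss_dvdpl // coprimep_expl // coprimep_expr.
have M1D : M1 %| D by apply: dvdp_trans M12; rewrite expr2 dvdp_mulr.
have M1D' : M1 %| D^`().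
  case/dvdpP: M12 => E ->; rewrite derivM deriv_exp /= expr1 -mulr_natl.
  by apply: dvdp_add; rewrite ?expr2 ?mulrA ?dvdp_mull // -mulrA dvdp_mull.
have : M1 %| 1.
  move: sfD; rewrite coprimep_def => /eqP s1.
  have: M1 %| gcdp D D^`() by rewrite dvdp_gcd M1D M1D'.
  by move/eqP: s1; rewrite size_poly_eq1 => /eqp_dvdr ->.
rewrite dvdp1 size_poly_eq1 => /(eqp_mulr g).
by rewrite mul1r -eM => /eqp_dvdl ->; rewrite eV dvdp_mull.
Qed.

Lemma cubic_disc_bezout a b c :
  - (18 * a * c - 27 * b) * cubic a b c
  + (6 * a * c ^+ 2 - 9 * b * c + 4 * a ^+ 2) * (3 * c ^+ 2 + a)
  = cubic_disc a b.
Proof. rewrite /cubic /cubic_disc; ring. Qed.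

Lemma cubic_root_simple a b c :
  cubic_disc a b != 0 -> cubic a b c = 0 -> 3 * c ^+ 2 + a != 0.
Proof.
move=> disc0 fc; apply: contraNneq disc0 => f'c.
by rewrite -(cubic_disc_bezout a b c) fc f'c !mulr0 addr0.
Qed.

Lemma dvdp_of_mul_coprime W P Q J :
  coprimep P Q -> W %| P * J -> W %| Q * J -> W %| J.
Proof.
move=> cPQ dP dQ; have /Bezout_eq1_coprimepP[[u v] /= e] := cPQ.
rewrite -[J]mul1r -e mulrDl -!mulrA; apply: dvdp_add; exact: dvdp_mull.
Qed.

(** Regularity of the differential at finite places. Differentiating the equation shows that [W]
    divides [A' FA + B' FB], and Euler's relation that it divides [A FA + B FB]. Cramer's rule turns
    this into [W] dividing [FA J] and [FB J], and the Bezout identities remove [FA] and [FB]. *)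
Lemma quartic_dvd_wronskian a b A B D W :
  2 != 0 :> F -> cubic_disc a b != 0 -> coprimep A B ->
  quartic a b A B = D * W ^+ 2 -> W %| wronskian A B.
Proof.
move=> two0 disc0 cAB eq; set J := wronskian A B.
have k0 : 4 * cubic_disc a b != 0.
  by rewrite mulf_neq0 // (_ : 4 = 2 * 2 :> F) ?mulf_neq0 //; ring.
have deq := congr1 (fun P => P^`()) eq.
have {}deq : A^`() * (3 * A ^+ 2 * B + a%:P * B ^+ 3) +
   B^`() * (A ^+ 3 + 3 * a%:P * A * B ^+ 2 + 4 * b%:P * B ^+ 3) =
   W * (D^`() * W + 2 * D * W^`()).
  transitivity ((quartic a b A B)^`()).
    rewrite /quartic !(derivD, derivM, deriv_exp, derivC) /=; ring.
  by rewrite eq !(derivM, deriv_exp) /=; ring.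
set FA := 3 * A ^+ 2 * B + a%:P * B ^+ 3 in deq.
set FB := A ^+ 3 + 3 * a%:P * A * B ^+ 2 + 4 * b%:P * B ^+ 3 in deq.
have euler : A * FA + B * FB = 4 * D * W * W.
  by rewrite -[RHS]mulrA -expr2 -[in RHS]mulrA -eq /quartic /FA /FB; ring.
have dFA : W %| FA * J.
  have -> : FA * J = B * (A^`() * FA + B^`() * FB) - B^`() * (A * FA + B * FB).
    by rewrite /J /wronskian; ring.
  rewrite deq euler; apply: dvdp_sub; apply: dvdp_mull;
    by [exact: dvdp_mulr | exact: dvdp_mull].
have dFB : W %| FB * J.
  have -> : FB * J = A^`() * (A * FA + B * FB) - A * (A^`() * FA + B^`() * FB).
    by rewrite /J /wronskian; ring.
  rewrite deq euler; apply: dvdp_sub; apply: dvdp_mull;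
    by [exact: dvdp_mulr | exact: dvdp_mull].
have dvdJ u v : W %| (u * FA + v * FB) * J.
  by rewrite mulrDl -!mulrA dvdp_add // dvdp_mull.
have eK : (4 * cubic_disc a b)%:P = 4 * (4 * a%:P ^+ 3 + 27 * b%:P ^+ 2).
  by rewrite /cubic_disc !(rmorphD, rmorphM, rmorphXn, rmorph_nat).
have dB : W %| B ^+ 5 * J.
  rewrite -(dvdpZr _ _ k0) scalerAl -mul_polyC eK -(quartic_bezout_right _ _ A).
  exact: dvdJ.
have dA : W %| A ^+ 5 * J.
  rewrite -(dvdpZr _ _ k0) scalerAl -mul_polyC eK -(quartic_bezout_left _ _ _ B).
  exact: dvdJ.
by apply: dvdp_of_mul_coprime dA dB; rewrite coprimep_expl // coprimep_expr.
Qed.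

Lemma size_exp_neq0 (P : {poly F}) n : P != 0 -> size (P ^+ n) = ((size P).-1 * n).+1.
Proof. by move=> P0; rewrite -size_exp prednK // size_poly_gt0 expf_neq0. Qed.

Lemma size_mul_leq (P Q : {poly F}) :
  (size (P * Q)%R <= (size P + size Q).-1)%N.
Proof. exact: size_polyMleq. Qed.

Lemma size_mul_neq0 (P Q : {poly F}) :
  P != 0 -> Q != 0 -> size (P * Q)%R = (size P + size Q).-1.
Proof. exact: size_mul. Qed.

Lemma size_scale_le c P : (size (c *: P)%R <= size P)%N.
Proof. exact: size_scale_leq. Qed.

Lemma size_add_lt P Q n : (size P < n)%N -> (size Q < n)%N -> (size (P + Q)%R < n)%N.
Proof. by move=> hP hQ; apply: leq_ltn_trans (size_polyD _ _) _; rewrite gtn_max hP. Qed.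

Lemma size_wronskian A B : B != 0 -> A != 0 ->
  (size (wronskian A B) <= (size A + size B).-2)%N.
Proof.
move=> B0 A0; apply: leq_trans (size_polyD _ _) _; rewrite size_polyN geq_max.
have hA : (0 < size A)%N by rewrite size_poly_gt0.
have hB : (0 < size B)%N by rewrite size_poly_gt0.
have := lt_size_deriv A0; have := lt_size_deriv B0 => ltB ltA.
by apply/andP; split; apply: leq_trans (size_mul_leq _ _) _; lia.
Qed.

(** Regularity at infinity: [D] has odd degree [2g + 1], so a holomorphic [L dX/w] has [deg L < g].
    The proof compares degrees, after moving the value of [A/B] at infinity to 0 when it is
    finite. *)
Lemma size_wronskian_quotient a b A B D W L g :
  cubic_disc a b != 0 -> quartic a b A B = D * W ^+ 2 -> W != 0 ->
  size D = g.*2.+2 -> wronskian A B = L * W -> (size L <= g)%N.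
Proof.
move=> disc0 eq W0 sD eJ.
have D0 : D != 0 by rewrite -size_poly_gt0 sD.
have DW0 : D * W ^+ 2 != 0 by rewrite mulf_neq0 // expf_neq0.
have B0 : B != 0.
  by apply: contraNneq DW0 => B0; rewrite -eq B0 /quartic !expr0n /= !mulr0 !addr0.
have sDW : size (D * W ^+ 2) = (g.*2.+1 + ((size W).-1 * 2)).+1.
  by rewrite size_mul_neq0 ?expf_neq0 // sD size_exp_neq0 //; lia.
have hB : (0 < size B)%N by rewrite size_poly_gt0.
have hW : (0 < size W)%N by rewrite size_poly_gt0.
have key (A1 : {poly F}) : A1 != 0 -> wronskian A1 B = L * W ->
   (size A1 < size B)%N /\ size (D * W ^+ 2) = (3 * (size B).-1 + (size A1).-1).+1 \/
   (size B < size A1)%N /\ size (D * W ^+ 2) = (3 * (size A1).-1 + (size B).-1).+1 ->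
   (size L <= g)%N.
  move=> A10 eJ1 H.
  have [->|L0] := eqVneq L 0; first by rewrite size_poly0.
  have := size_wronskian B0 A10; rewrite eJ1 size_mul_neq0 //.
  have h1 : (0 < size A1)%N by rewrite size_poly_gt0.
  have h2 : (0 < size L)%N by rewrite size_poly_gt0.
  rewrite sDW in H; lia.
have [sAB|sBA] := leqP (size A) (size B); last first.
  have A0 : A != 0 by rewrite -size_poly_gt0; lia.
  apply: (key A) => //; right; split=> //; rewrite -eq /quartic -addrA.
  have sAB : size (A ^+ 3 * B) = (3 * (size A).-1 + (size B).-1).+1.
    by rewrite size_mul_neq0 ?expf_neq0 // size_exp_neq0 //; lia.
  rewrite size_polyDl ?sAB // -mulrA !mul_polyC.
  have := size_scale_le a (A * B ^+ 3); have := size_scale_le b (B ^+ 4).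
  rewrite size_mul_neq0 ?expf_neq0 // !size_exp_neq0 // => h1 h2.
  by apply: size_add_lt; [apply: leq_ltn_trans h2 _ | apply: leq_ltn_trans h1 _]; lia.
(* [c] is the value of [A/B] at infinity. The degree of [D W^2] is odd while that of [B^4] is even,
   so [c] must be a root of the cubic; it is a simple root, which makes the term with [A1 B^3]
   dominate. *)
pose c := A`_(size B).-1 / lead_coef B.
pose A1 : {poly F} := A - c *: B.
have sA1 : (size A1 < size B)%N.
  rewrite -[X in (_ < X)%N](prednK hB) ltnS; apply/leq_sizeP => j.
  rewrite leq_eqVlt => /orP[/eqP<-|ltj].
    by rewrite coefB coefZ /c -[B`__]/(lead_coef B) divfK ?subrr // lead_coef_eq0.
  have hj : (size B <= j)%N by lia.
  by rewrite coefB coefZ !nth_default ?mulr0 ?subrr // (leq_trans sAB).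
have eqA1 : D * W ^+ 2 = cubic a b c *: B ^+ 4 + ((3 * c ^+ 2 + a) *: (A1 * B ^+ 3)
      + ((3 * c) *: (A1 ^+ 2 * B ^+ 2) + A1 ^+ 3 * B)).
  rewrite -eq /quartic /A1 /cubic -!mul_polyC.
  rewrite !(rmorphD, rmorphM, rmorphXn, rmorph_nat); ring.
have [A10|A10] := eqVneq A1 0.
  have eDW : D * W ^+ 2 = cubic a b c *: B ^+ 4.
    by rewrite eqA1 A10 !expr0n /= !(mul0r, scaler0, addr0).
  move: DW0; rewrite eDW scaler_eq0 negb_or => /andP[fc0 _].
  by move: sDW; rewrite eDW size_scale // size_exp_neq0 //; lia.
have h1 : (0 < size A1)%N by rewrite size_poly_gt0.
set T := _ *: _ + A1 ^+ 3 * B in eqA1.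
have sT : (size T < (3 * (size B).-1 + (size A1).-1).+1)%N.
  have := size_scale_le (3 * c) (A1 ^+ 2 * B ^+ 2).
  rewrite size_mul_neq0 ?expf_neq0 // !size_exp_neq0 // => h2.
  apply: size_add_lt; first by apply: leq_ltn_trans h2 _; lia.
  by rewrite size_mul_neq0 ?expf_neq0 // size_exp_neq0 //; lia.
have [fc|fc] := eqVneq (cubic a b c) 0; last first.
  have : size (D * W ^+ 2) = (4 * (size B).-1).+1.
    rewrite eqA1 size_polyDl size_scale ?size_exp_neq0 //; first by lia.
    have := size_scale_le (3 * c ^+ 2 + a) (A1 * B ^+ 3).
    rewrite size_mul_neq0 ?expf_neq0 // size_exp_neq0 // => h2.
    by apply: size_add_lt; [apply: leq_ltn_trans h2 _ | apply: leq_trans sT _]; lia.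
  by rewrite sDW; lia.
have f'c := cubic_root_simple disc0 fc.
apply: (key A1) => //.
  rewrite -eJ /wronskian /A1 !(derivD, derivN, derivZ) -!mul_polyC; ring.
left; split=> //; rewrite eqA1 fc scale0r add0r size_polyDl size_scale //.
  by rewrite size_mul_neq0 ?expf_neq0 // size_exp_neq0 //; lia.
by rewrite size_mul_neq0 ?expf_neq0 // size_exp_neq0 //; lia.
Qed.

Lemma quarticM a b A B P : quartic a b (A * P) (B * P) = quartic a b A B * P ^+ 4.
Proof. by rewrite /quartic; ring. Qed.

Lemma quartic_coprime_reduction a b A B D W :
  coprimep D D^`() -> quartic a b A B = D * W ^+ 2 -> W != 0 ->
  exists P A1 B1 W1, [/\ A = A1 * P, B = B1 * P, coprimep A1 B1, W1 != 0 &
    quartic a b A1 B1 = D * W1 ^+ 2] /\ P %= gcdp A B.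
Proof.
move=> sfD eq W0; set P := gcdp A B.
have D0 : D != 0.
  apply: contraTneq sfD => ->.
  by rewrite linear0 coprimep0 -size_poly_eq1 size_poly0.
have P0 : P != 0.
  apply: contraNneq (mulf_neq0 D0 (expf_neq0 2 W0)) => P0.
  move/eqP: P0; rewrite gcdp_eq0 => /andP[/eqP A0 /eqP B0].
  by rewrite -eq A0 B0 /quartic !expr0n /= !mulr0 !addr0.
have /dvdpP[A1 eA] : P %| A by apply: dvdp_gcdl.
have /dvdpP[B1 eB] : P %| B by apply: dvdp_gcdr.
have cAB : coprimep A1 B1.
  have e1 : A1 = A %/ P by rewrite eA mulpK.
  have e2 : B1 = B %/ P by rewrite eB mulpK.
  rewrite e1 e2 coprimep_div_gcd //.
  by move: P0; rewrite gcdp_eq0 negb_and.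
have /dvdpP[W1 eW] : P ^+ 2 %| W.
  apply: (squarefree_sqr_dvd sfD); rewrite -eq eA eB quarticM -exprM.
  exact: dvdp_mull.
exists P, A1, B1, W1; split; last exact: eqpxx; split=> //.
  by apply: contraNneq W0 => W10; rewrite eW W10 mul0r.
have P40 : P ^+ 4 != 0 by rewrite expf_neq0.
apply: (mulIf P40); rewrite -quarticM -eA -eB eq eW; ring.
Qed.

End PlanePolynomials.

Definition cubicX (R : comNzRingType) (a b : R) : {poly R} := 'X^3 + a *: 'X + b%:P.

Lemma size_cubicX (F : fieldType) (a b : F) : size (cubicX a b) = 4%N.
Proof.
rewrite /cubicX -addrA size_polyDl size_polyXn //.
apply: size_add_lt; first by apply: leq_ltn_trans (size_scale_le _ _) _; rewrite size_polyX.
by apply: leq_ltn_trans (size_polyC_leq1 _) _.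
Qed.

Section Dehomogenization.
Local Notation t := (@FracField.tofrac _).

Lemma quartic_dehom (K : fieldType) (a b A B : K) : B != 0 ->
  A ^+ 3 * B + a * A * B ^+ 3 + b * B ^+ 4 =
  B ^+ 4 * ((A / B) ^+ 3 + a * A / B + b).
Proof. by move=> B0; field. Qed.

Lemma dehom_term (K : fieldType) (c x y z : K) : y != 0 ->
  z * y * (c * (x / y)) = c * (x * z).
Proof. by move=> y0; field. Qed.

(** In the field of fractions this is [B^(4m)] times the expansion of [f(A/B)^m]. The truncated
    subtraction is harmless since [i <= 3m]. *)
Lemma quartic_exp (F : fieldType) (a b : F) (A B : {poly F}) (m : nat) : B != 0 ->
  quartic a b A B ^+ m =
  \sum_(i < (3 * m).+1) (cubicX a b ^+ m)`_i *: (A ^+ i * B ^+ (4 * m - i)).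
Proof.
move=> B0.
have tB0 : t B != 0 by rewrite tofrac_eq0.
have sf : (size (cubicX a b ^+ m) <= (3 * m).+1)%N.
  by rewrite size_exp_neq0 ?size_cubicX // -size_poly_gt0 size_cubicX.
apply/eqP; rewrite -tofrac_eq; apply/eqP.
pose x := t A / t B; pose f := map_poly (@FracField.tofrac _ \o polyC) (cubicX a b).
have ef : f.[x] = x ^+ 3 + t a%:P * x + t b%:P.
  rewrite /f /cubicX !rmorphD /= map_polyZ map_polyXn map_polyX map_polyC /=.
  by rewrite !hornerE ?hornerXn.
have eQ : t (quartic a b A B) = t B ^+ 4 * f.[x].
  rewrite ef /x mulrA -quartic_dehom // -!rmorphXn -!rmorphM -!rmorphD //.
have fm : f ^+ m = map_poly (@FracField.tofrac _ \o polyC) (cubicX a b ^+ m).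
  by rewrite /f rmorphXn.
rewrite rmorphXn /= eQ exprMn -horner_exp fm raddf_sum /=.
rewrite (@horner_coef_wide _ (3 * m).+1); last first.
  by rewrite size_map_poly.
rewrite mulr_sumr; apply: eq_bigr => i _; rewrite coef_map /= -mul_polyC.
rewrite (tofracM _ (A ^+ i * _)) (tofracM (A ^+ i)) !tofracXn /x expr_div_n -exprM.
have -> : (4 * m = (4 * m - i) + i)%N by have := ltn_ord i; lia.
rewrite exprD addnK; apply: dehom_term; exact: expf_neq0.
Qed.

End Dehomogenization.

(** * The Cartier operator on polynomial differentials over F_p *)

Section Cartier.
Variables (p : nat) (p_prime : prime p).
Implicit Types P Q A B D W L : {poly 'F_p}.

Let pcharp : p \in [pchar 'F_p]. Proof. exact: pchar_Fp. Qed.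
Let pcharP : p \in [pchar {poly 'F_p}].
Proof. exact: (rmorph_pchar (@polyC 'F_p)). Qed.
Let p_gt0 : (0 < p)%N. Proof. exact: prime_gt0. Qed.

Lemma Fp_expp (c : 'F_p) : c ^+ p = c.
Proof. by rewrite -{2}(expf_card c) card_Fp. Qed.

Lemma poly_exppD P Q : (P + Q) ^+ p = P ^+ p + Q ^+ p.
Proof. by rewrite exprDn_pchar // pnatE. Qed.

Lemma poly_expp P : P ^+ p = P \Po 'X^p.
Proof.
elim/poly_ind: P => [|P c IH]; first by rewrite comp_poly0 expr0n eqn0Ngt p_gt0.
by rewrite poly_exppD exprMn IH -rmorphXn /= Fp_expp comp_polyD comp_polyM comp_polyX comp_polyC.
Qed.

(** The Cartier operator on [P dX]; over the prime field no [p]-th roots of the coefficients have to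
    be extracted. *)
Definition cartier P : {poly 'F_p} := \poly_(k < size P) P`_(k * p + p.-1).

Lemma coef_cartier P k : (cartier P)`_k = P`_(k * p + p.-1).
Proof.
rewrite coef_poly; case: ltnP => // le; rewrite nth_default //.
by apply: leq_trans le _; apply: leq_trans (leq_addr _ _); rewrite leq_pmulr.
Qed.

Lemma cartierD P Q : cartier (P + Q) = cartier P + cartier Q.
Proof. by apply/polyP => k; rewrite coefD !coef_cartier coefD. Qed.

Lemma cartierN P : cartier (- P) = - cartier P.
Proof. by apply/polyP => k; rewrite coefN !coef_cartier coefN. Qed.

Lemma cartierZ c P : cartier (c *: P) = c *: cartier P.
Proof. by apply/polyP => k; rewrite coefZ !coef_cartier coefZ. Qed.

Lemma cartier_sum (I : Type) (r : seq I) (G : I -> {poly 'F_p}) :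
  cartier (\sum_(i <- r) G i) = \sum_(i <- r) cartier (G i).
Proof.
elim/big_rec2: _ => [|i P Q _ <-]; last by rewrite cartierD.
by apply/polyP => k; rewrite coef_cartier !coef0.
Qed.

Lemma cartier_deriv P : cartier P^`() = 0.
Proof.
apply/polyP => k; rewrite coef0 coef_cartier coef_deriv -addnS prednK // -mulSnr.
by rewrite mulrnA (mulrn_pchar pcharp).
Qed.

Lemma cartier_exppM Q P : cartier (Q ^+ p * P) = Q * cartier P.
Proof.
elim/poly_ind: Q P => [|Q c IH] P.
  by apply/polyP => k; rewrite expr0n eqn0Ngt p_gt0 !mul0r coef_cartier !coef0.
rewrite poly_exppD exprMn -rmorphXn /= Fp_expp mulrDl cartierD -mulrA IH.
rewrite mulrDl !mul_polyC cartierZ -mulrA; congr (_ * _ + _).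
apply/polyP => -[|k]; rewrite coef_cartier coefXnM coefXM /=.
  by rewrite mul0n add0n ltn_predL p_gt0.
by rewrite mulSn -addnA ltnNge leq_addr /= addKn coef_cartier.
Qed.

(* In characteristic 0, [p g^(p-1) g' = (g^p)']; compare coefficients for an
   integral lift of [g] and cancel [p]. *)
Lemma cartier_log_deriv P : cartier (P ^+ p.-1 * P^`()) = P^`().
Proof.
pose r : {poly int} := map_poly (fun x : 'F_p => (x : nat)%:Z) P.
have rP : map_poly intr r = P.
  apply/polyP => i; rewrite coef_map /= coef_map_id0 //= -pmulrn.
  by rewrite natr_Zp.
have key k : (r ^+ p.-1 * r^`())`_(k * p + p.-1) = (r ^+ p)`_(k.+1 * p) *+ k.+1.
  have p0 : p%:R != 0 :> int by rewrite natz eqz_nat -lt0n.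
  apply: (mulfI p0); rewrite !mulr_natl -(coefMn (r ^+ p.-1 * r^`())).
  have -> : r ^+ p.-1 * r^`() *+ p = (r ^+ p)^`() by rewrite deriv_exp mulrC.
  by rewrite coef_deriv -addnS prednK // -mulSnr mulrnA.
apply/polyP => k; rewrite coef_cartier coef_deriv.
have := congr1 (fun z : int => z%:~R : 'F_p) (key k).
rewrite -coef_map rmorphMn /= -coef_map rmorphM /= !rmorphXn /= -deriv_map rP => ->.
by rewrite poly_expp coef_comp_poly_Xn // dvdn_mull // mulnK.
Qed.

(** The differential is exact: with [j = 2p - 2 - i] one has [j + 1 = -(i + 1)] modulo [p], so the
    derivative of [A^(i+1) B^(j+1)] is [(i + 1) A^i B^j] times the Wronskian, and [i + 1] is
    invertible. *)
Lemma cartier_quartic_term A B i :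
  (i <= p.*2.-2)%N -> i != p.-1 -> (i.+1 < p.*2)%N ->
  cartier (A ^+ i * B ^+ (p.*2.-2 - i) * wronskian A B) = 0.
Proof.
move=> le_i ne_i lt_i; set j := (_ - i)%N.
have i1 : (i.+1)%:R != 0 :> 'F_p.
  rewrite -(dvdn_pcharf pcharp); apply/negP => /dvdnP[k ek].
  have k1 : k = 1%N by nia.
  by move/eqP: ne_i; apply; lia.
have ij : (j.+1)%:R = - (i.+1)%:R :> {poly 'F_p}.
  apply/eqP; rewrite -subr_eq0 opprK -natrD.
  have -> : (j.+1 + i.+1 = p * 2)%N by have := prime_gt1 p_prime; rewrite /j; lia.
  by rewrite natrM (pcharf0 pcharP) mul0r.
have <- : (i.+1)%:R^-1 *: cartier ((A ^+ i.+1 * B ^+ j.+1)^`()) = 0.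
  by rewrite cartier_deriv scaler0.
rewrite -cartierZ; congr cartier.
rewrite derivM !deriv_exp /= -(mulr_natl (A^`() * A ^+ i)) -(mulr_natl (B^`() * B ^+ j)) ij.
have -> : i.+1%:R * (A^`() * A ^+ i) * B ^+ j.+1 +
    A ^+ i.+1 * (- i.+1%:R * (B^`() * B ^+ j)) =
    (i.+1)%:R * (A ^+ i * B ^+ j * wronskian A B).
  by rewrite /wronskian !exprS; ring.
by rewrite -polyC_natr mul_polyC scalerA mulVf ?scale1r.
Qed.

(** For the exceptional exponent [i = p - 1] the differential is [B^p] times [A^(p-1) dA] minus
    [A^p] times [B^(p-1) dB]; [p]-th powers come out as their roots, and [A^(p-1) dA] is sent to
    [dA]. *)
Lemma cartier_quartic_mid A B :
  cartier (A ^+ p.-1 * B ^+ p.-1 * wronskian A B) = wronskian A B.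
Proof.
have -> : A ^+ p.-1 * B ^+ p.-1 * wronskian A B =
   B ^+ p * (A ^+ p.-1 * A^`()) - A ^+ p * (B ^+ p.-1 * B^`()).
  have E P : P ^+ p = P * P ^+ p.-1 by rewrite -exprS prednK.
  by rewrite !E /wronskian; ring.
rewrite cartierD cartierN !cartier_exppM !cartier_log_deriv /wronskian; ring.
Qed.

End Cartier.

(** * The Hasse-Witt matrix and twists without points in characteristic p *)

Section HasseWitt.
Variables (p : nat) (p_prime : prime p) (p_odd : odd p).
Variables (a b : 'F_p) (D : {poly 'F_p}).
Implicit Types P Q A B W L : {poly 'F_p}.
Let p_gt0 : (0 < p)%N. Proof. exact: prime_gt0. Qed.
Let p_half : p = p./2.*2.+1. Proof. by rewrite -[LHS]odd_double_half p_odd. Qed.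

(** The Hasse invariant of E: the eigenvalue of the Cartier operator on the invariant
    differential. *)
Definition hasse_inv : 'F_p := (cubicX a b ^+ p./2)`_p.-1.

(** The Cartier operator commutes with pullback from E. Concretely, with [m = (p - 1)/2],
    [W^p D^m L] equals [quartic^m] times the Wronskian; in the expansion of [quartic^m] every term
    except the one with [A^(p-1)] is killed. *)
Lemma cartier_pullback A B W L : W != 0 ->
  quartic a b A B = D * W ^+ 2 -> wronskian A B = L * W ->
  cartier (D ^+ p./2 * L) = hasse_inv *: L.
Proof.
move=> W0 eq eJ; apply: (mulfI W0).
have [B0|B0] := eqVneq B 0.
  have L0 : L = 0.
    apply/eqP; rewrite -(mulIr_eq0 _ (mulIf W0)) -eJ /wronskian B0 deriv0.
    by rewrite !mulr0 subrr.
  rewrite L0 mulr0 scaler0; congr (_ * _).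
  by rewrite /cartier size_poly0 poly_def big_ord0.
rewrite -(cartier_exppM p_prime).
have -> : W ^+ p * (D ^+ p./2 * L) = quartic a b A B ^+ p./2 * wronskian A B.
  have -> : W ^+ p = W * (W ^+ 2) ^+ p./2 by rewrite -exprM mul2n -exprS -p_half.
  rewrite eq eJ (exprMn _ D); move: (D ^+ _) (_ ^+ p./2) => X Y; ring.
rewrite quartic_exp // mulr_suml (cartier_sum p_prime).
have lt1 : (p.-1 < (3 * p./2).+1)%N by have := p_half; lia.
have p2 : (p.-1 = p./2.*2)%N by have := p_half; lia.
have e4 : (4 * p./2 = p.*2.-2)%N by have := p_half; lia.
rewrite (bigD1 (Ordinal lt1)) //= big1 => [|i ne_i].
  have -> : (4 * p./2 - p.-1 = p.-1)%N by have := p_half; lia.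
  rewrite addr0 -scalerAl (cartierZ p_prime).
  by rewrite (cartier_quartic_mid p_prime) eJ -scalerAr mulrC /hasse_inv.
have lt_i := ltn_ord i.
have -> : (4 * p./2 - i = p.*2.-2 - i)%N by have := p_half; lia.
rewrite -scalerAl (cartierZ p_prime) (cartier_quartic_term p_prime) ?scaler0 //.
- by have := p_half; lia.
- by have := p_half; lia.
Qed.

(** The characteristic polynomial, at [hasse_inv], of the Hasse-Witt matrix with entries [H_(ip-j)],
    [i] and [j] in 1, 2, of the genus two curve [w^2 = D]. *)
Definition hasse_witt_det : 'F_p :=
  let H := D ^+ p./2 in
  (H`_p.-1 - hasse_inv) * (H`_(p.*2.-2) - hasse_inv) - H`_(p.-2) * H`_(p.*2.-1).

Lemma hasse_witt_eigen0 L : (size L <= 2)%N -> hasse_witt_det != 0 ->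
  cartier (D ^+ p./2 * L) = hasse_inv *: L -> L = 0.
Proof.
move=> sL det0 eC; set H := D ^+ p./2 in eC.
have eL : L = L`_0 *: 1 + L`_1 *: 'X.
  apply/polyP => -[|[|i]]; rewrite !coefE /= ?mulr1 ?mulr0 ?addr0 ?add0r //.
  by rewrite nth_default // (leq_trans sL).
have p2 : (1 < p)%N by exact: prime_gt1.
have co i : (H * L)`_i.+1 = H`_i.+1 * L`_0 + H`_i * L`_1.
  rewrite {1}eL mulrDr -!scalerAr coefD !coefZ mulr1 coefMX /=.
  by rewrite mulrC [L`_1 * _]mulrC.
have e0 : H`_p.-1 * L`_0 + H`_p.-2 * L`_1 = hasse_inv * L`_0.
  rewrite -(coefZ hasse_inv) -eC (coef_cartier p_prime) mul0n add0n.
  have e : p.-1 = p.-2.+1 by lia.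
  by rewrite e co.
have e1 : H`_(p.*2.-1) * L`_0 + H`_(p.*2.-2) * L`_1 = hasse_inv * L`_1.
  rewrite -(coefZ hasse_inv) -eC (coef_cartier p_prime) mul1n.
  have -> : (p + p.-1 = p.*2.-2.+1)%N by lia.
  by rewrite co; have -> : (p.*2.-1 = p.*2.-2.+1)%N by lia.
have k0 : hasse_witt_det * L`_0 = 0.
  transitivity ((H`_(p.*2.-2) - hasse_inv) * (H`_p.-1 * L`_0 + H`_p.-2 * L`_1 - hasse_inv * L`_0)
     - H`_p.-2 * (H`_(p.*2.-1) * L`_0 + H`_(p.*2.-2) * L`_1 - hasse_inv * L`_1)).
    by rewrite /hasse_witt_det -/H; ring.
  by rewrite e0 e1 !subrr !mulr0 subrr.
have k1 : hasse_witt_det * L`_1 = 0.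
  transitivity ((H`_p.-1 - hasse_inv) * (H`_(p.*2.-1) * L`_0 + H`_(p.*2.-2) * L`_1 - hasse_inv * L`_1)
    - H`_(p.*2.-1) * (H`_p.-1 * L`_0 + H`_p.-2 * L`_1 - hasse_inv * L`_0)).
    by rewrite /hasse_witt_det -/H; ring.
  by rewrite e0 e1 !subrr !mulr0 subrr.
move/eqP: k0; rewrite mulf_eq0 (negPf det0) => /eqP l0.
move/eqP: k1; rewrite mulf_eq0 (negPf det0) => /eqP l1.
by rewrite eL l0 l1 !scale0r addr0.
Qed.

Lemma deriv0_Fp P : P^`() = 0 -> exists Q, P = Q ^+ p.
Proof.
move=> dP; exists (\poly_(i < size P) P`_(i * p)).
rewrite (poly_expp p_prime); apply/polyP => i; rewrite coef_comp_poly_Xn //.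
case: ifP => [/dvdnP[k ->]|ndvd].
  rewrite mulnK // coef_poly; case: ltnP => // le; rewrite nth_default //.
  by rewrite (leq_trans le) // leq_pmulr.
case: i => [|i] in ndvd *; first by rewrite dvdn0 in ndvd.
have := coef_deriv P i; rewrite dP coef0 => /esym/eqP.
rewrite -mulr_natl mulf_eq0 -(dvdn_pcharf (pchar_Fp p_prime)) ndvd.
by move/eqP.
Qed.

Lemma size_expp P : size (P ^+ p) = if P == 0 then 0%N else ((size P).-1 * p).+1.
Proof.
case: eqVneq => [->|P0]; first by rewrite expr0n eqn0Ngt p_gt0 size_poly0.
exact: size_exp_neq0.
Qed.

Lemma size_expp_lt P : (size P <= 1)%N \/ (size P < size (P ^+ p)%R)%N.
Proof.
have [|s1] := leqP (size P) 1; [by left | right]; rewrite size_expp.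
have P0 : P != 0 by rewrite -size_poly_gt0 ltnW.
rewrite (negPf P0); move: s1 (prime_gt1 p_prime); clear; nia.
Qed.

Lemma size_expp_ge P : (size P <= size (P ^+ p)%R)%N.
Proof.
case: (size_expp_lt P) => [s1|/ltnW//].
have [->|P0] := eqVneq P 0; first by rewrite size_poly0.
by apply: leq_trans s1 _; rewrite size_poly_gt0 expf_neq0.
Qed.

Lemma wronskian_eq0_deriv A B : coprimep A B -> wronskian A B = 0 -> A^`() = 0.
Proof.
move=> cAB /eqP; rewrite subr_eq0 => /eqP J0; apply/eqP.
have [->|A0] := eqVneq A 0; first by rewrite deriv0.
have : A %| A^`() by rewrite -(Gauss_dvdpl _ cAB) J0 dvdp_mulr.
apply: contraTT => dA0; apply/negP => /(dvdp_leq dA0).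
by rewrite leqNgt lt_size_deriv.
Qed.

Hypotheses (disc0 : cubic_disc a b != 0) (sD : size D = 6%N).
Hypotheses (sfD : coprimep D D^`()) (det0 : hasse_witt_det != 0).

(** Lambda vanishes by the determinant hypothesis, so [A/B] has zero derivative and [A], [B] are
    [p]-th powers. As [p] is odd, [quartic^p] is [quartic] times a square, so the [p]-th roots give
    a smaller solution for the same [D]. *)
Lemma no_coprime_twist_point_Fp A B W :
  coprimep A B -> quartic a b A B = D * W ^+ 2 -> W = 0.
Proof.
have D0 : D != 0 by rewrite -size_poly_gt0 sD.
have two0 : 2 != 0 :> 'F_p.
  rewrite -(dvdn_pcharf (pchar_Fp p_prime)); apply/negP => /dvdn_leq.
  have := p_half; have := prime_gt1 p_prime; lia.
have [n] := ubnP (size A + size B); elim: n A B W => // n IH A B W ltn cAB eq.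
apply/eqP/negPn/negP => W0.
have /dvdpP[L eJ] := quartic_dvd_wronskian two0 disc0 cAB eq.
have sL : (size L <= 2)%N.
  by apply: (size_wronskian_quotient disc0 eq W0 _ eJ); rewrite sD.
have L0 : L = 0.
  by apply: hasse_witt_eigen0 sL det0 _; apply: cartier_pullback eq eJ.
have J0 : wronskian A B = 0 by rewrite eJ L0 mul0r.
have [A1 eA] := deriv0_Fp (wronskian_eq0_deriv cAB J0).
have J0' : wronskian B A = 0.
  by apply/eqP; rewrite -oppr_eq0 -J0 /wronskian; apply/eqP; ring.
have [B1 eB] : exists B1, B = B1 ^+ p.
  by apply: deriv0_Fp; apply: wronskian_eq0_deriv J0'; rewrite coprimep_sym.
have cAB1 : coprimep A1 B1.
  by move: cAB; rewrite eA eB coprimep_pexpl // coprimep_pexpr.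
have eQ : quartic a b A B = quartic a b A1 B1 ^+ p.
  have cp (c : 'F_p) : c%:P = c%:P ^+ p :> {poly 'F_p} by rewrite -rmorphXn /= Fp_expp.
  rewrite /quartic !(poly_exppD p_prime) !exprMn -!cp eA eB.
  by move: (A1 ^+ p) (B1 ^+ p) => X Y; ring.
set Q := quartic a b A1 B1 in eQ.
have eQ' : Q * (Q ^+ p./2) ^+ 2 = D * W ^+ 2.
  by rewrite -eq eQ -exprM muln2 -exprS -p_half.
have /dvdpP[W2 eW] : Q ^+ p./2 %| W.
  by apply: (squarefree_sqr_dvd sfD); rewrite -eQ' dvdp_mull.
have Qm0 : Q ^+ p./2 != 0.
  by apply: contraNneq W0 => Q0; rewrite eW Q0 mulr0.
have Q0 : Q != 0.
  apply: contraNneq (mulf_neq0 D0 (expf_neq0 2 W0)) => Q0.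
  by rewrite -eQ' Q0 mul0r.
have eq1 : Q = D * W2 ^+ 2.
  apply: (mulIf (expf_neq0 2 Qm0)); rewrite eQ' eW.
  by move: (Q ^+ _) => Z; ring.
have W20 : W2 = 0.
  apply: (IH A1 B1) => //.
  have := size_expp_lt A1; have := size_expp_lt B1.
  have := size_expp_ge A1; have := size_expp_ge B1; rewrite -eA -eB.
  move=> leB leA ltB ltA; clear - sD eq1 Q0 ltn leB leA ltB ltA.
  case: ltB => [sB1|ltB]; last by move: ltn leA ltB; clear; lia.
  case: ltA => [sA1|ltA]; last by move: ltn ltA leB; clear; lia.
  (* Both [A1] and [B1] are constant, the one case in which taking [p]-th roots need not lower the
     total size; a nonzero constant [Q] cannot equal [D W2^2]. *)
  have sQ : (size Q <= 1)%N.
    rewrite /Q (size1_polyC sA1) (size1_polyC sB1) /quartic.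
    by rewrite -!rmorphXn -!rmorphM -!rmorphD size_polyC_leq1.
  have sW2 : W2 ^+ 2 != 0.
    by apply: contraNneq Q0 => W20; rewrite eq1 W20 mulr0.
  have D0 : D != 0 by rewrite -size_poly_gt0 sD.
  have := sQ; rewrite eq1 (size_mul_neq0 D0 sW2) sD.
  have : (0 < size (W2 ^+ 2)%R)%N by rewrite size_poly_gt0.
  by case: (size _).
by move: W0; rewrite eW W20 mul0r eqxx.
Qed.

Lemma no_twist_point_Fp A B W : quartic a b A B = D * W ^+ 2 -> W = 0.
Proof.
move=> eq; apply/eqP/negPn/negP => W0.
have [P [A1 [B1 [W1 [[_ _ cAB W10 eq1] _]]]]] := quartic_coprime_reduction sfD eq W0.
by move: W10; rewrite (no_coprime_twist_point_Fp cAB eq1) eqxx.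
Qed.

End HasseWitt.

(** * Existence of valuation rings, after Chevalley *)

Section ValuationRings.
Variable K : fieldType.
Implicit Types (O : K -> Prop) (x y : K).

Definition is_subring O : Prop :=
  [/\ O 1, forall x y, O x -> O y -> O (x - y) &
      forall x y, O x -> O y -> O (x * y)].

Definition is_valring O : Prop :=
  is_subring O /\ forall x, O x \/ O x^-1.

Section Subring.
Variables (O : K -> Prop) (Osub : is_subring O).
Lemma subring1 : O 1. Proof. by case: Osub. Qed.
Lemma subringB x y : O x -> O y -> O (x - y). Proof. by case: Osub => _ + _; apply. Qed.
Lemma subringM x y : O x -> O y -> O (x * y). Proof. by case: Osub => _ _; apply. Qed.
Lemma subring0 : O 0. Proof. by rewrite -(subrr 1); apply: subringB; apply: subring1. Qed.
Lemma subringN x : O x -> O (- x).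
Proof. by move=> Ox; rewrite -sub0r; apply: subringB => //; apply: subring0. Qed.
Lemma subringD x y : O x -> O y -> O (x + y).
Proof. by move=> Ox Oy; rewrite -[y]opprK; apply: subringB => //; apply: subringN. Qed.
Lemma subringX x n : O x -> O (x ^+ n).
Proof.
move=> Ox; elim: n => [|n IH]; first by rewrite expr0; apply: subring1.
by rewrite exprS; apply: subringM.
Qed.
Lemma subring_sum (I : Type) (r : seq I) (P : pred I) (G : I -> K) :
  (forall i, P i -> O (G i)) -> O (\sum_(i <- r | P i) G i).
Proof. move=> h; elim/big_ind: _ => //; [exact: subring0 | exact: subringD]. Qed.
Lemma subring_nat n : O n%:R.
Proof. by elim: n => [|n IH]; [apply: subring0 | rewrite -natr1; apply: subringD => //; apply: subring1]. Qed.
Lemma subring_int (z : int) : O z%:~R.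
Proof. by case: z => n; rewrite ?NegzE ?mulrNz; [|apply: subringN]; apply: subring_nat. Qed.
End Subring.

Definition adjoin O x y := exists2 q : {poly K}, forall i, O q`_i & y = q.[x].

Lemma adjoin_subring O x : is_subring O -> is_subring (adjoin O x).
Proof.
move=> sO; split.
- exists 1; last by rewrite hornerE.
  by move=> i; rewrite coef1; case: (i == 0%N); [exact: subring1 | exact: subring0].
- move=> y z [q qO ->] [r rO ->]; exists (q - r); last by rewrite !hornerE.
  by move=> i; rewrite coefB; apply: subringB.
- move=> y z [q qO ->] [r rO ->]; exists (q * r); last by rewrite hornerM.
  by move=> i; rewrite coefM; apply: subring_sum => // j _; apply: subringM.
Qed.

Lemma sub_adjoin O x y : is_subring O -> O y -> adjoin O x y.
Proof.
move=> sO Oy; exists y%:P; last by rewrite hornerC.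
by move=> i; rewrite coefC; case: eqP => // _; exact: subring0.
Qed.

Lemma mem_adjoin O x : is_subring O -> adjoin O x x.
Proof.
move=> sO; exists 'X; last by rewrite hornerX.
by move=> i; rewrite coefX; case: (i == 1%N); [exact: subring1 | exact: subring0].
Qed.

Section Chevalley.
Variables (p : K) (O : K -> Prop).
Hypotheses (sO : is_subring O) (Op : O p) (p0 : p != 0) (nOp : ~ O p^-1).
Hypothesis O_max : forall x, ~ O x -> adjoin O x p^-1.

(** [p] lies in the Jacobson radical of [O]. If [u = 1 - p r] had no inverse in [O], maximality
    would give [p^-1] as a polynomial in [u^-1]; clearing powers puts [p^-1 u^k] in [O], and [u^k]
    is 1 modulo [p], so [p^-1] itself would lie in [O]. *)
Lemma chevalley_unit r : O r -> O (1 - p * r)^-1.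
Proof.
move=> Or; set u := 1 - p * r.
have u0 : u != 0.
  apply/eqP => /eqP; rewrite subr_eq0 eq_sym => /eqP pr; apply: nOp.
  suff -> : p^-1 = r by [].
  by apply: (mulfI p0); rewrite pr divff.
apply: contrapT => nOu; have [q qO eq] := O_max nOu.
have [k uk] : exists k, O (p^-1 * u ^+ k).
  exists (size q); rewrite eq horner_coef mulr_suml; apply: subring_sum => // i _.
  rewrite -mulrA exprVn; apply: subringM => //.
  have -> : u ^- i * u ^+ size q = u ^+ (size q - i).
    by rewrite mulrC expfB_cond // (negPf u0) add0n ltnW.
  by apply: subringX => //; apply: subringB => //; [exact: subring1|exact: subringM].
have [w Ow uw] : exists2 w, O w & u ^+ k = 1 + p * w.
  elim: k {uk} => [|k [w Ow IH]].
    by exists 0; [exact: subring0 | rewrite mulr0 addr0].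
  exists (w - r - p * r * w).
    by do 2?[apply: subringB => //]; do 2?[apply: subringM => //].
  by rewrite exprS IH /u; ring.
apply: nOp; have -> : p^-1 = p^-1 * u ^+ k - w by rewrite uw; field.
exact: subringB.
Qed.

(** Take two relations of minimal total size, [q] being the longer one up to exchanging [x] and
    [x^-1]. The relation [r] times [x^d] solves for [x^d], because [1 - p r_0] is a unit;
    substituting this for the leading term shortens [q]. *)
Lemma chevalley_no_relation x (q r : {poly K}) : x != 0 ->
  (forall i, O q`_i) -> (forall i, O r`_i) ->
  p^-1 = q.[x] -> p^-1 = r.[x^-1] -> False.
Proof.
have [n] := ubnP (size q + size r); elim: n x q r => // n IH x q r ltn x0 qO rO eq er.
wlog le_rq : x x0 q r ltn qO rO eq er / (size r <= size q)%N.
  move=> W; have [le|lt] := leqP (size r) (size q); first exact: (W x x0 q r).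
  apply: (W x^-1 _ r q) => //; rewrite ?invr_eq0 ?invrK // 1?addnC //.
  exact: ltnW.
have q0 : (0 < size q)%N.
  rewrite lt0n size_poly_eq0; apply/eqP => q0.
  by move/eqP: eq; rewrite q0 horner0 invr_eq0 (negPf p0).
pose d := (size q).-1; have sq : size q = d.+1 by rewrite prednK.
pose u := 1 - p * r`_0.
have u0 : u != 0.
  apply/eqP => /eqP; rewrite subr_eq0 eq_sym => /eqP pr; apply: nOp.
  suff -> : p^-1 = r`_0 by [].
  by apply: (mulfI p0); rewrite pr divff.
pose q' := \poly_(i < d) (q`_i + p * q`_d * r`_(d - i) * u^-1).
apply: (IH x q' r) => //.
- have : (size q' <= d)%N by apply: size_poly.
  by move: ltn; rewrite sq; lia.
- move=> i; rewrite coef_poly; case: ifP => _; last exact: subring0.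
  apply: subringD => //; apply: subringM => //; last exact: chevalley_unit.
  by apply: subringM => //; apply: subringM.
rewrite eq /q' horner_poly (@horner_coef_wide _ d.+1) ?sq //.
have -> : \sum_(i < d) (q`_i + p * q`_d * r`_(d - i) / u) * x ^+ i =
   \sum_(i < d) q`_i * x ^+ i +
   q`_d / u * (p * \sum_(i < d) r`_(d - i) * x ^+ i).
  rewrite mulrA mulr_sumr -big_split /=; apply: eq_bigr => i _.
  by move: (r`_(d - i)) (q`_d) (q`_i) (x ^+ i) => *; field.
rewrite big_ord_recr /=; congr (_ + _).
suff -> : p * \sum_(i < d) r`_(d - i) * x ^+ i = u * x ^+ d.
  by rewrite [u * _]mulrC mulrCA mulrA mulrA divfK // mulrC.
have srd : (size r <= d.+1)%N by rewrite -sq.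
have := er; rewrite (horner_coef_wide _ srd) big_ord_recl /= mulr1.
move=> er'.
have {er'} e1 : u = p * \sum_(i < d) r`_(lift ord0 i) * x^-1 ^+ (lift ord0 i).
  apply: (mulfI (invr_neq0 p0)); rewrite mulrA mulVf // mul1r.
  by rewrite mulrBr mulr1 mulrA mulVf // mul1r {1}er' addrC addKr.
rewrite e1 -mulrA; congr (_ * _); rewrite mulr_suml.
rewrite (reindex_inj rev_ord_inj) /=; apply: eq_bigr => i _.
rewrite /bump /= add1n subKn // -mulrA; congr (_ * _).
by rewrite exprVn [RHS]mulrC expfB_cond // (negPf x0) add0n ltn_ord.
Qed.

Lemma chevalley_valring : is_valring O.
Proof.
split=> // x; have [->|x0] := eqVneq x 0; first by left; exact: subring0.
apply: contrapT => /not_orP[nx nx'].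
have [q qO eq] := O_max nx; have [r rO er] := O_max nx'.
exact: (chevalley_no_relation x0 qO rO eq er).
Qed.
End Chevalley.

(* A subring maximal among those not containing [p^-1] is a valuation ring. *)
Lemma exists_valring (p : K) :
  (exists z : int, p = z%:~R) -> p != 0 -> (forall z : int, p^-1 <> z%:~R) ->
  exists O, is_valring O /\ ~ O p^-1.
Proof.
move=> pZ p0 pV.
pose good (A : set K) := A = set0 \/ is_subring A /\ ~ A p^-1.
have [|A [gA Amax]] := @Zorn_bigcup K good.
  move=> F Fgood Ftot.
  have [[A [FA A0]]|nA] := pselect (exists A, F A /\ A <> set0); last first.
    left; rewrite eqEsubset; split=> // x [B FB Bx].
    by apply: nA; exists B; split=> // B0; rewrite B0 in Bx.
  have sF B : F B -> B <> set0 -> is_subring B /\ ~ B p^-1.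
    by move=> /Fgood [].
  have sFx B x : F B -> B x -> is_subring B /\ ~ B p^-1.
    by move=> FB Bx; apply: sF => // B0; rewrite B0 in Bx.
  right; split; last by move=> [B FB Bp]; case: (sFx _ _ FB Bp).
  have op (f : K -> K -> K) :
    (forall B, is_subring B -> forall x y, B x -> B y -> B (f x y)) ->
    forall x y, (\bigcup_(X in F) X)%classic x -> (\bigcup_(X in F) X)%classic y ->
      (\bigcup_(X in F) X)%classic (f x y).
    move=> fB x y [X FX Xx] [Y FY Yy].
    have [XY|YX] := Ftot _ _ FX FY.
      by exists Y => //; apply: fB => //; [case: (sFx _ _ FY Yy) | apply: XY].
    by exists X => //; apply: fB => //; [case: (sFx _ _ FX Xx) | apply: YX].
  split.
  - by exists A => //; case: (sF _ FA A0) => sA _; exact: subring1.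
  - by apply: op => B sB x y; exact: subringB.
  - by apply: op => B sB x y; exact: subringM.
have sZ : is_subring (fun x : K => exists z : int, x = z%:~R).
  split; first by exists 1.
    by move=> x y [z ->] [t ->]; exists (z - t); rewrite rmorphB.
  by move=> x y [z ->] [t ->]; exists (z * t); rewrite rmorphM.
have [sA nAp] : is_subring A /\ ~ A p^-1.
  case: gA => // A0; exfalso.
  apply: (Amax (fun x : K => exists z : int, x = z%:~R)).
    rewrite A0 properEneq; split=> //; apply/eqP => e.
    have : (set0 : set K) 1 by rewrite e; exists 1.
    by [].
  by right; split=> // -[z]; exact: pV.
exists A; split=> //; apply: (@chevalley_valring p) => //.
  by case: pZ => z ->; exact: subring_int.
move=> x nAx; apply: contrapT => nadj.
apply: (Amax (adjoin A x)).
  split; first by move=> y; exact: sub_adjoin.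
  by move=> h; apply: nAx; apply: h; exact: mem_adjoin.
by right; split=> //; exact: adjoin_subring.
Qed.

End ValuationRings.

(** * Polynomials over a valuation ring: Gauss's lemma and orders of vanishing *)

Section GaussNorm.
Variables (K : fieldType) (O : K -> Prop) (vO : is_valring O).
Implicit Types (x y : K) (P Q R S : {poly K}).
Let sO : is_subring O. Proof. by case: vO. Qed.

(** The nonunits of [O]. Zero is added by hand, because [0^-1 = 0] lies in [O]. *)
Definition maxideal x : Prop := x = 0 \/ ~ O x^-1.

Lemma maxideal_sub x : maxideal x -> O x.
Proof.
case=> [->|nx]; first exact: subring0.
by case: vO => _ /(_ x) [].
Qed.

Lemma maxideal0 : maxideal 0. Proof. by left. Qed.

Lemma maxideal1 : ~ maxideal 1.
Proof. by case=> [/eqP|]; [rewrite oner_eq0 | rewrite invr1; apply; exact: subring1]. Qed.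

Lemma maxidealM x y : O x -> maxideal y -> maxideal (x * y).
Proof.
move=> Ox [->|ny]; first by rewrite mulr0; left.
have [->|x0] := eqVneq x 0; first by rewrite mul0r; left.
right=> nxy; apply: ny; have -> : y^-1 = x * (x * y)^-1.
  by rewrite invfM mulrA divff // mul1r.
exact: subringM.
Qed.

Lemma maxidealN x : maxideal x -> maxideal (- x).
Proof. by rewrite -mulN1r; apply: maxidealM; apply: subringN => //; exact: subring1. Qed.

Lemma maxidealD x y : maxideal x -> maxideal y -> maxideal (x + y).
Proof.
wlog Oxy : x y / O (x / y).
  move=> W mx my; case: vO => _ /(_ (x / y)) [|]; first by move=> h; apply: W.
  by rewrite invf_div => h; rewrite addrC; apply: W.
move=> mx my; have [y0|y0] := eqVneq y 0; first by rewrite y0 addr0.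
have -> : x + y = (x / y + 1) * y by rewrite mulrDl divfK // mul1r.
by apply: maxidealM => //; apply: subringD => //; exact: subring1.
Qed.

Lemma maxidealB x y : maxideal x -> maxideal y -> maxideal (x - y).
Proof. by move=> mx my; apply: maxidealD => //; exact: maxidealN. Qed.

Lemma maxideal_sum (I : Type) (r : seq I) (p : pred I) (G : I -> K) :
  (forall i, p i -> maxideal (G i)) -> maxideal (\sum_(i <- r | p i) G i).
Proof. move=> h; elim/big_ind: _ => //; [exact: maxideal0 | exact: maxidealD]. Qed.

Lemma valring_inv x : ~ maxideal x -> O x^-1.
Proof. by move=> /not_orP[_ /contrapT]. Qed.

Lemma maxideal_prime x y : O x -> O y -> maxideal (x * y) -> maxideal x \/ maxideal y.
Proof.
move=> Ox Oy mxy; have [|nx] := pselect (maxideal x); first by left.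
right; have x0 : x != 0 by apply/eqP => x0; apply: nx; left.
have -> : y = x^-1 * (x * y) by rewrite mulrA mulVf // mul1r.
by apply: maxidealM => //; exact: valring_inv.
Qed.

Definition polyO P := forall i, O P`_i.
Definition polym P := forall i, maxideal P`_i.

Lemma polymO P : polym P -> polyO P.
Proof. by move=> mP i; apply: maxideal_sub. Qed.
Lemma polyOD P Q : polyO P -> polyO Q -> polyO (P + Q).
Proof. by move=> OP OQ i; rewrite coefD; apply: subringD. Qed.
Lemma polyOB P Q : polyO P -> polyO Q -> polyO (P - Q).
Proof. by move=> OP OQ i; rewrite coefB; apply: subringB. Qed.
Lemma polyON P : polyO P -> polyO (- P).
Proof. by move=> OP i; rewrite coefN; apply: subringN. Qed.
Lemma polyOM P Q : polyO P -> polyO Q -> polyO (P * Q).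
Proof. by move=> OP OQ i; rewrite coefM; apply: subring_sum => // j _; apply: subringM. Qed.
Lemma polyOZ x P : O x -> polyO P -> polyO (x *: P).
Proof. by move=> Ox OP i; rewrite coefZ; apply: subringM. Qed.
Lemma polymD P Q : polym P -> polym Q -> polym (P + Q).
Proof. by move=> OP OQ i; rewrite coefD; apply: maxidealD. Qed.
Lemma polymN P : polym P -> polym (- P).
Proof. by move=> OP i; rewrite coefN; apply: maxidealN. Qed.
Lemma polymB P Q : polym P -> polym Q -> polym (P - Q).
Proof. by move=> OP OQ i; rewrite coefB; apply: maxidealB. Qed.
Lemma polymM P Q : polyO P -> polym Q -> polym (P * Q).
Proof. by move=> OP OQ i; rewrite coefM; apply: maxideal_sum => // j _; apply: maxidealM. Qed.
Lemma polymZ x P : O x -> polym P -> polym (x *: P).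
Proof. by move=> Ox OP i; rewrite coefZ; apply: maxidealM. Qed.

(* [gord P n]: the reduction of [P] vanishes to order exactly [n] at 0. *)
Definition gord P n := ~ maxideal P`_n /\ forall i, (i < n)%N -> maxideal P`_i.

Lemma gord_exists P : ~ polym P -> exists n, gord P n.
Proof.
move=> /existsNP[i ni].
have [n] := ubnP i; elim: n i ni => // n IH i ni ltin.
have [|/existsNP[j /not_implyP[ltj nj]]] := pselect (forall j, (j < i)%N -> maxideal P`_j).
  by exists i.
exact: (IH j nj (leq_trans ltj ltin)).
Qed.

Lemma gord_not_polym P n : gord P n -> ~ polym P.
Proof. by move=> [nP _] mP; apply: nP. Qed.

Lemma gordM P Q n k : polyO P -> polyO Q -> gord P n -> gord Q k -> gord (P * Q) (n + k).
Proof.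
move=> OP OQ [nP mP] [nQ mQ].
have term i (j : 'I_i.+1) : (i <= n + k)%N -> (j : nat) <> n \/ (i < n + k)%N ->
    maxideal (P`_j * Q`_(i - j)).
  move=> le_i ne; have [ltj|gej] := ltnP j n.
    by rewrite mulrC; apply: maxidealM; [exact: OQ | exact: mP].
  by apply: maxidealM; [exact: OP | apply: mQ; have := ltn_ord j; lia].
split=> [|i lti]; rewrite coefM; last first.
  by apply: maxideal_sum => j _; apply: term; [exact: ltnW | right].
have ltn1 : (n < (n + k).+1)%N by rewrite ltnS leq_addr.
rewrite (bigD1 (Ordinal ltn1)) //= addKn.
set S := \sum_(i < _ | _) _; have mS : maxideal S.
  apply: maxideal_sum => j nj; apply: term => //; left=> e.
  by move/eqP: nj; apply; apply: val_inj.
move=> m1; have := maxidealB m1 mS; rewrite addrK.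
by case/(maxideal_prime (OP _) (OQ _)).
Qed.

Lemma gord_unique P n k : gord P n -> gord P k -> n = k.
Proof.
by move=> [n1 m1] [n2 m2]; case: (ltngtP n k) => // lt; [case: n1; exact: m2 | case: n2; exact: m1].
Qed.

Lemma gord_congr P Q n : polym (P - Q) -> gord P n -> gord Q n.
Proof.
move=> mPQ [nP mP]; split=> [mQ|i lti].
  by apply: nP; have := maxidealD (mPQ n) mQ; rewrite coefB subrK.
by have := maxidealB (mP i lti) (mPQ i); rewrite coefB opprB addrCA subrr addr0.
Qed.

(** Gauss's lemma: polynomials with nonzero reduction have finite orders of vanishing at 0, and
    these add under multiplication. *)
Lemma gauss_prime P Q : polyO P -> polyO Q -> polym (P * Q) -> polym P \/ polym Q.
Proof.
move=> OP OQ mPQ; apply: contrapT => /not_orP[/gord_exists[n gP] /gord_exists[k gQ]].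
exact: (gord_not_polym (gordM OP OQ gP gQ)).
Qed.

(** Divisibility in a valuation ring is a total preorder, so some nonzero coefficient divides all
    the others; [c] is its inverse. *)
Lemma poly_normalize P : P != 0 ->
  exists2 c, c != 0 & polyO (c *: P) /\ ~ polym (c *: P).
Proof.
move=> P0.
have [z zP [z0 zmax]] : exists2 z, z \in (P : seq K) & z != 0 /\ forall y, y \in (P : seq K) -> O (y / z).
  have : exists2 z, z \in (P : seq K) & z != 0.
    exists (lead_coef P); last by rewrite lead_coef_eq0.
    by rewrite lead_coefE mem_nth // prednK // size_poly_gt0.
  elim: (P : seq K) => [|x s IH] [z]; first by rewrite in_nil.
  move=> zs z0; have [[t ts t0]|ns] := pselect (exists2 z, z \in s & z != 0); last first.
    have s0 y : y \in s -> y = 0.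
      by move=> ys; apply/eqP/negPn/negP => y0; apply: ns; exists y.
    move: zs; rewrite inE => /orP[/eqP ezx|/s0 ez]; last by rewrite ez eqxx in z0.
    exists x; first by rewrite mem_head.
    rewrite -ezx; split=> // y; rewrite inE => /orP[/eqP->|/s0->].
      by rewrite divff //; exact: subring1.
    by rewrite mul0r; exact: subring0.
  have [w ws [w0 wmax]] := IH (ex_intro2 _ _ t ts t0).
  case: vO => _ /(_ (x / w)) [Oxw|Owx].
    exists w; first by rewrite inE ws orbT.
    by split=> // y; rewrite inE => /orP[/eqP->//|/wmax].
  have [x0|x0] := eqVneq x 0.
    exists w; first by rewrite inE ws orbT.
    split=> // y; rewrite inE => /orP[/eqP->|/wmax//].
    by rewrite x0 mul0r; exact: subring0.
  exists x; first by rewrite mem_head.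
  split=> // y; rewrite inE => /orP[/eqP->|/wmax Oy].
    by rewrite divff //; exact: subring1.
  have -> : y / x = (y / w) * (x / w)^-1 by field; apply/andP.
  exact: subringM.
exists z^-1; first by rewrite invr_eq0.
split=> [i|mP].
  rewrite coefZ mulrC; have [lt|ge] := ltnP i (size P); first by apply: zmax; apply: mem_nth.
  by rewrite nth_default // mul0r; exact: subring0.
have /(nthP 0)[i _ ei] := zP.
by have := mP i; rewrite coefZ ei mulVf //; exact: maxideal1.
Qed.

Lemma polyO_divisor P Q R : polyO P -> P = Q * R -> polyO Q -> ~ polym Q -> polyO R.
Proof.
move=> OP eP OQ nQ; have [->|R0] := eqVneq R 0.
  by move=> i; rewrite coef0; exact: subring0.
have [c c0 [OR nR]] := poly_normalize R0.
have nP : ~ polym (c *: P).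
  by rewrite eP scalerAr => /(gauss_prime OQ OR) [].
suff Oc : O c^-1 by have := polyOZ Oc OR; rewrite scalerA mulVf // scale1r.
move/existsNP: nP => [i]; rewrite coefZ => nm.
have Pi0 : P`_i != 0 by apply/eqP => Pi0; apply: nm; left; rewrite Pi0 mulr0.
have -> : c^-1 = P`_i * (c * P`_i)^-1 by field; apply/andP.
by apply: subringM; [| exact: OP | exact: valring_inv].
Qed.

Lemma polyO_sqrt P Q R : polyO P -> P = Q * R ^+ 2 -> polyO Q -> ~ polym Q -> polyO R.
Proof.
move=> OP eP OQ nQ; have [->|R0] := eqVneq R 0.
  by move=> i; rewrite coef0; exact: subring0.
have [c c0 [OR nR]] := poly_normalize R0.
have nP : ~ polym (c ^+ 2 *: P).
  have -> : c ^+ 2 *: P = Q * ((c *: R) * (c *: R)).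
    by rewrite eP -!mul_polyC rmorphXn /=; ring.
  move=> /(gauss_prime OQ (polyOM OR OR)) [//|].
  by case/(gauss_prime OR OR).
suff Oc : O c^-1 by have := polyOZ Oc OR; rewrite scalerA mulVf // scale1r.
move/existsNP: nP => [i]; rewrite coefZ => nm.
have Pi0 : P`_i != 0 by apply/eqP => Pi0; apply: nm; left; rewrite Pi0 mulr0.
case: vO => _ /(_ c) [Oc|//].
have -> : c^-1 = c * (P`_i * (c ^+ 2 * P`_i)^-1) by field; apply/andP.
apply: subringM => //; apply: subringM => //; exact: valring_inv.
Qed.

(** Moves the point [x] to 0, so that [gord] of the shifted polynomial is the order of vanishing at
    [x]. *)
Definition shiftp (x : K) P := P \Po ('X + x%:P).

Lemma shiftpM x P Q : shiftp x (P * Q) = shiftp x P * shiftp x Q.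
Proof. exact: comp_polyM. Qed.
Lemma shiftpB x P Q : shiftp x (P - Q) = shiftp x P - shiftp x Q.
Proof. exact: comp_polyB. Qed.
Lemma shiftpK x P : shiftp (- x) (shiftp x P) = P.
Proof.
rewrite /shiftp -comp_polyA comp_polyD comp_polyX comp_polyC rmorphN /=.
by rewrite subrK comp_polyXr.
Qed.

Lemma polyO_linear x : O x -> polyO ('X + x%:P).
Proof.
move=> Ox i; rewrite coefD coefX coefC; apply: subringD => //.
  by case: (i == 1%N); [exact: subring1 | exact: subring0].
by case: eqP => // _; exact: subring0.
Qed.

Lemma polyO1 : polyO 1.
Proof. by move=> i; rewrite coef1; case: (i == 0%N); [exact: subring1 | exact: subring0]. Qed.

Lemma polyOX P n : polyO P -> polyO (P ^+ n).
Proof.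
move=> OP; elim: n => [|n IH]; first by rewrite expr0; exact: polyO1.
by rewrite exprS; apply: polyOM.
Qed.

Lemma polyO_shift x P : O x -> polyO P -> polyO (shiftp x P).
Proof.
move=> Ox OP; rewrite /shiftp comp_polyE; elim/big_ind: _ => [|Q R|i _].
- by move=> i; rewrite coef0; exact: subring0.
- exact: polyOD.
- by apply: polyOZ => //; apply: polyOX; exact: polyO_linear.
Qed.

Lemma polym_shift x P : O x -> polym P -> polym (shiftp x P).
Proof.
move=> Ox mP; rewrite /shiftp comp_polyE; elim/big_ind: _ => [|Q R|i _].
- by move=> i; rewrite coef0; exact: maxideal0.
- exact: polymD.
- move=> j; rewrite coefZ mulrC; apply: maxidealM => //.
  by apply: polyOX; exact: polyO_linear.
Qed.

Lemma polym_unshift x P : O x -> polym (shiftp x P) -> polym P.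
Proof.
by move=> Ox /(polym_shift (subringN sO Ox)); rewrite shiftpK.
Qed.

Lemma gord_linear x y : O x -> O y -> ~ maxideal (x - y) ->
  gord (shiftp x ('X - y%:P)) 0.
Proof.
move=> Ox Oy nxy; split=> //.
by rewrite /shiftp comp_polyB comp_polyX comp_polyC -addrA coefD coefX add0r -rmorphB coefC eqxx.
Qed.

Lemma gord_linear_self x : gord (shiftp x ('X - x%:P)) 1.
Proof.
rewrite /shiftp comp_polyB comp_polyX comp_polyC addrK; split=> [|[|//] _]; rewrite coefX.
  exact: maxideal1.
exact: maxideal0.
Qed.

Lemma gord1 : gord 1 0.
Proof. by split=> //; rewrite coef1; exact: maxideal1. Qed.

(** Distinct elements of [rs] stay distinct in the residue field, so the squarefree polynomial with
    these roots has squarefree reduction. *)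
Definition separated (rs : seq K) : Prop :=
  (forall x, x \in rs -> O x) /\
  (forall x y, x \in rs -> y \in rs -> x != y -> ~ maxideal (x - y)).

Lemma polyO_prod rs : (forall x, x \in rs -> O x) -> polyO (\prod_(x <- rs) ('X - x%:P)).
Proof.
move=> Ors; rewrite big_seq; elim/big_ind: _ => [||x xrs]; [exact: polyO1 | exact: polyOM |].
by rewrite -rmorphN; apply: polyO_linear; apply: subringN => //; apply: Ors.
Qed.

Lemma gord_prod_notin rs x : separated (x :: rs) -> x \notin rs ->
  gord (shiftp x (\prod_(y <- rs) ('X - y%:P))) 0.
Proof.
move=> [Ors Srs] nx.
have : {subset rs <= rs} by [].
elim: {1 3}rs => [|y s IH] sub; first by rewrite big_nil /shiftp comp_polyC; exact: gord1.
have yrs : y \in rs by apply: sub; rewrite mem_head.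
have Ox : O x by apply: Ors; rewrite mem_head.
have Oy : O y by apply: Ors; rewrite inE yrs orbT.
rewrite big_cons shiftpM; apply: (@gordM _ _ 0 0).
- by apply: polyO_shift => //; rewrite -rmorphN; apply: polyO_linear; exact: subringN.
- apply: polyO_shift => //; apply: polyO_prod => z zs; apply: Ors.
  by rewrite inE sub ?orbT // inE zs orbT.
- apply: gord_linear => //; apply: Srs; rewrite ?mem_head ?inE ?yrs ?orbT //.
  by apply: contraNneq nx => ->.
- by apply: IH => z zs; apply: sub; rewrite inE zs orbT.
Qed.

Lemma gord_prod_in rs x : separated rs -> uniq rs -> x \in rs ->
  gord (shiftp x (\prod_(y <- rs) ('X - y%:P))) 1.
Proof.
move=> [Ors Srs] urs xrs; rewrite (big_rem x) //= shiftpM.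
have Ox := Ors _ xrs.
have rs' z : z \in x :: rem x rs -> z \in rs.
  by rewrite inE => /orP[/eqP->//|/mem_rem].
apply: (@gordM _ _ 1 0).
- by apply: polyO_shift => //; rewrite -rmorphN; apply: polyO_linear; exact: subringN.
- by apply: polyO_shift => //; apply: polyO_prod => z /mem_rem /Ors.
- exact: gord_linear_self.
- apply: gord_prod_notin; last by rewrite mem_rem_uniq // inE eqxx.
  by split=> [z /rs' /Ors//|y z /rs' yrs /rs' zrs]; exact: Srs.
Qed.

End GaussNorm.

(** * Points that reduce to infinity are infinitely divisible by two *)

Lemma closed_field_sqrt (K : closedFieldType) (c : K) : exists d, d ^+ 2 = c.
Proof.
have /closed_rootP[d] : size ('X^2 - c%:P) != 1%N by rewrite size_XnsubC.
by rewrite rootE !hornerE ?hornerXn subr_eq0 => /eqP; exists d.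
Qed.

(** Induction over the roots of [W]: by coprimality a linear factor of [W] divides at most one of
    [P] and [Q], so its square divides the other one and can be stripped off. When [W] is constant,
    [P] itself divides [D]. *)
Lemma coprime_square_part (K : closedFieldType) (D W P Q : {poly K}) :
  D != 0 -> W != 0 -> coprimep P Q -> P * Q = D * W ^+ 2 ->
  exists E S, E %| D /\ P = E * S ^+ 2.
Proof.
move=> D0; have [n] := ubnP (size W); elim: n W P Q => // n IH W P Q ltn W0 cPQ eq.
have [s1|/closed_rootP[x]] := eqVneq (size W) 1%N.
  exists P, 1; split; last by rewrite expr1n mulr1.
  have /size_poly1P[w w0 eW] : size W == 1%N by rewrite s1.
  have : P %| D * W ^+ 2 by rewrite -eq dvdp_mulr.
  by rewrite eW -rmorphXn mulrC mul_polyC dvdpZr // expf_neq0.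
rewrite root_factor_theorem => /dvdpP[W' eW].
set L := 'X - x%:P in eW.
have L0 : L != 0 by rewrite polyXsubC_eq0.
have L20 : L ^+ 2 != 0 by rewrite expf_neq0.
have W'0 : W' != 0 by apply: contraNneq W0 => W'0; rewrite eW W'0 mul0r.
have ltW : (size W' < n)%N.
  by move: ltn; rewrite eW size_mul_neq0 // size_XsubC addn2.
have LPQ : L ^+ 2 %| P * Q by rewrite eq eW exprMn mulrA dvdp_mull.
have irrL R : ~~ (L %| R) -> coprimep L R.
  by rewrite dvdp_XsubCl coprimep_sym coprimep_XsubC.
have [LQ|nLQ] := boolP (L %| Q).
  have nLP : ~~ (L %| P).
    apply/negP => LP; have : L %| gcdp P Q by rewrite dvdp_gcd LP.
    by move: cPQ; rewrite coprimep_def => /eqP g1 /dvdp_leq; rewrite g1 -size_poly_gt0 g1 /L size_XsubC => /(_ isT).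
  have : L ^+ 2 %| Q by rewrite -(Gauss_dvdpr _ (coprimep_expl 2 (irrL _ nLP))).
  case/dvdpP=> Q' eQ; apply: (IH W' P Q') => //.
    by apply: coprimep_dvdl cPQ; rewrite eQ dvdp_mulr.
  by apply: (mulIf L20); rewrite -mulrA -eQ eq eW; ring.
have : L ^+ 2 %| P by rewrite -(Gauss_dvdpl _ (coprimep_expl 2 (irrL _ nLQ))).
case/dvdpP=> P' eP.
have cP'Q : coprimep P' Q by apply: coprimep_dvdr cPQ; rewrite eP dvdp_mulr.
have eq' : P' * Q = D * W' ^+ 2.
  by apply: (mulIf L20); rewrite mulrAC -eP eq eW; ring.
have [E [S [ED eP']]] := IH W' P' Q ltW W'0 cP'Q eq'.
by exists E, (S * L); split=> //; rewrite eP eP'; ring.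
Qed.

Section KernelOfReduction.
Variables (K : closedFieldType) (O : K -> Prop) (vO : is_valring O).
Variables (a b e1 e2 e3 c : K) (rs : seq K).
Implicit Types (A B P Q R S W : {poly K}).
Let sO : is_subring O. Proof. by case: vO. Qed.
Let D := c *: \prod_(x <- rs) ('X - x%:P).

Hypothesis quarticE : forall A B,
  quartic a b A B = B * ((A - e1 *: B) * (A - e2 *: B) * (A - e3 *: B)).
Hypotheses (Oe1 : O e1) (Oe2 : O e2) (Oe3 : O e3).
Hypotheses (e12 : e1 != e2) (e13 : e1 != e3) (e23 : e2 != e3).
Hypotheses (c0 : c != 0) (sep_rs : separated O rs) (uniq_rs : uniq rs).
Hypotheses (rs0 : (0 < size rs)%N) (unit2 : ~ maxideal O 2).
Hypothesis sfD : coprimep D D^`().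

Let D0 : D != 0.
Proof.
by rewrite scaler_eq0 negb_or c0 /= monic_neq0 // monic_prod_XsubC.
Qed.

Lemma odd_part P Q W : W != 0 -> coprimep P Q -> P * Q = D * W ^+ 2 ->
  exists2 s, subseq s rs & exists S, P = \prod_(x <- s) ('X - x%:P) * S ^+ 2.
Proof.
move=> W0 cPQ eq; have [E [S [ED eP]]] := coprime_square_part D0 W0 cPQ eq.
move: ED; rewrite dvdpZr // => /dvdp_prod_XsubC[m /eqpP[[u v] /= /andP[u0 v0] uv]].
exists (mask m rs); first exact: mask_subseq.
(* [K] is algebraically closed, so the constant is a square and can be absorbed into [S]. *)
have [d ed] := closed_field_sqrt (v / u).
exists (d *: S); rewrite eP.
set M := \prod_(i <- _) _ in uv *.
have -> : E = (v / u) *: M.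
  by rewrite mulrC -scalerA -uv scalerA mulVf // scale1r.
by rewrite -ed -!mul_polyC rmorphXn; ring.
Qed.

(** Suppose [x] occurs in [s]. Coprimality keeps it out of [t]; as the roots stay distinct modulo
    the maximal ideal, the reduction of [P] vanishes at [x] to odd order and that of [Q] to even
    order, although the two reductions agree. *)
Lemma reduction_square P Q s t S T :
  subseq s rs -> subseq t rs -> coprimep P Q ->
  polyO O P -> polyO O Q -> ~ polym O P -> polym O (P - Q) ->
  P = \prod_(x <- s) ('X - x%:P) * S ^+ 2 ->
  Q = \prod_(x <- t) ('X - x%:P) * T ^+ 2 -> P = S ^+ 2.
Proof.
move=> ss st cPQ OP OQ nP mPQ eP eQ.
case: s ss eP => [|x s] ss eP; first by rewrite eP big_nil mul1r.
exfalso.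
have subs z : z \in x :: s -> z \in rs by exact: (mem_subseq ss).
have subt z : z \in t -> z \in rs by exact: (mem_subseq st).
have [Ors Srs] := sep_rs.
have Ox : O x by apply/Ors/subs; rewrite mem_head.
have xt : x \notin t.
  apply/negP => xt.
  have LP : 'X - x%:P %| P by rewrite eP big_cons -!mulrA dvdp_mulr.
  have LQ : 'X - x%:P %| Q by rewrite eQ (big_rem x) //= -!mulrA dvdp_mulr.
  have : 'X - x%:P %| gcdp P Q by rewrite dvdp_gcd LP.
  by move: cPQ; rewrite coprimep_def => /eqP g1 /dvdp_leq; rewrite g1 -size_poly_gt0 g1 size_XsubC => /(_ isT).
have g1 : gord O (shiftp x (\prod_(x <- x :: s) ('X - x%:P))) 1.
  apply: gord_prod_in; rewrite ?mem_head //; last exact: subseq_uniq uniq_rs.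
  by split=> [z /subs /Ors//|y z /subs yrs /subs zrs]; exact: Srs.
have sub' z : z \in x :: t -> z \in rs.
  by rewrite inE => /orP[/eqP->|/subt//]; apply: subs; rewrite mem_head.
have g2 : gord O (shiftp x (\prod_(x <- t) ('X - x%:P))) 0.
  apply: gord_prod_notin => //.
  by split=> [z /sub' /Ors//|y z /sub' yrs /sub' zrs]; exact: Srs.
have nQ : ~ polym O Q.
  by move=> mQ; apply: nP; have := polymD vO mPQ mQ; rewrite subrK.
have OM1 : polyO O (\prod_(x <- x :: s) ('X - x%:P)).
  by apply: polyO_prod => // z /subs /Ors.
have OM2 : polyO O (\prod_(x <- t) ('X - x%:P)).
  by apply: polyO_prod => // z /subt /Ors.
have nM1 := contra_not (@polym_shift _ _ vO x _ Ox) (gord_not_polym g1).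
have nM2 := contra_not (@polym_shift _ _ vO x _ Ox) (gord_not_polym g2).
have OS := polyO_sqrt vO OP eP OM1 nM1.
have OT := polyO_sqrt vO OQ eQ OM2 nM2.
have nS : ~ polym O S.
  by move=> mS; apply: nP; rewrite eP expr2 mulrA; apply: polymM => //; apply: polyOM.
have nT : ~ polym O T.
  by move=> mT; apply: nQ; rewrite eQ expr2 mulrA; apply: polymM => //; apply: polyOM.
have [n gS] := gord_exists (contra_not (@polym_unshift _ _ vO x _ Ox) nS).
have [k gT] := gord_exists (contra_not (@polym_unshift _ _ vO x _ Ox) nT).
have sh R : polyO O R -> polyO O (shiftp x R) by exact: polyO_shift.
have gP : gord O (shiftp x P) (1 + (n + n)).
  rewrite eP expr2 !shiftpM; apply: gordM => //; [exact: sh | | exact: (gordM vO (sh _ OS) (sh _ OS) gS gS)].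
  by apply: polyOM => //; exact: sh.
have gQ : gord O (shiftp x Q) (0 + (k + k)).
  rewrite eQ expr2 !shiftpM; apply: gordM => //; [exact: sh | | exact: (gordM vO (sh _ OT) (sh _ OT) gT gT)].
  by apply: polyOM => //; exact: sh.
have : gord O (shiftp x Q) (1 + (n + n)).
  by apply: gord_congr gP => //; rewrite -shiftpB; exact: polym_shift.
by move/(gord_unique gQ); lia.
Qed.

Lemma sign_choice S T : polyO O S -> polyO O T -> polym O (S ^+ 2 - T ^+ 2) ->
  exists T', [/\ polyO O T', T' ^+ 2 = T ^+ 2 & polym O (S - T')].
Proof.
move=> OS OT; rewrite subr_sqr => /(gauss_prime vO (polyOB vO OS OT) (polyOD vO OS OT)).
case=> m; first by exists T.
by exists (- T); split; [exact: polyON | rewrite sqrrN | rewrite opprK].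
Qed.

(* Since [A - e_i B] is a square [S_i^2] for each [i], the point is divisible
   by 2, and choosing the signs so that the [S_i] agree modulo the maximal ideal
   keeps the half in the kernel of reduction; its denominator has smaller degree. *)
Theorem reduction_kernel_trivial A B W : polyO O A -> ~ polym O A -> polym O B ->
  coprimep A B -> quartic a b A B = D * W ^+ 2 -> W = 0.
Proof.
have [n] := ubnP (size B); elim: n A B W => // n IH A B W ltn OA nA mB cAB eq.
apply/eqP/negPn/negP => W0; have OB := polymO vO mB.
have DW0 : D * W ^+ 2 != 0 by rewrite mulf_neq0 // expf_neq0.
have B0 : B != 0.
  by apply: contraNneq DW0 => B0; rewrite -eq B0 quarticE mul0r.
set P1 := A - e1 *: B; set P2 := A - e2 *: B; set P3 := A - e3 *: B.
have OP e : O e -> polyO O (A - e *: B).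
  by move=> Oe; apply: polyOB => //; apply: polyOZ.
have mP e : O e -> polym O (A - (A - e *: B)).
  by move=> Oe; rewrite subKr; apply: polymZ.
have mPP e e' : O e -> O e' -> polym O ((A - e *: B) - (A - e' *: B)).
  move=> Oe Oe'; have := polymB vO (mP e' Oe') (mP e Oe).
  by rewrite !subKr opprB [in X in _ -> X]addrC addrA subrK.
have nP e : O e -> ~ polym O (A - e *: B).
  by move=> Oe mAe; apply: nA; have := polymD vO (mP e Oe) mAe; rewrite subrK.
have cPB e : coprimep (A - e *: B) B.
  by rewrite coprimep_sym -scaleNr -mul_polyC addrC coprimep_addl_mul coprimep_sym.
have cPP e e' : e != e' -> coprimep (A - e *: B) (A - e' *: B).
  move=> ne; have -> : A - e' *: B = (e - e')%:P * B + 1 * (A - e *: B).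
    by rewrite mul1r mul_polyC scalerBl [RHS]addrC addrA subrK.
  rewrite [X in coprimep _ X]addrC coprimep_addl_mul mul_polyC coprimepZr ?subr_eq0 //.
have eqP' : B * (P1 * P2 * P3) = D * W ^+ 2 by rewrite -eq quarticE.
(* [A - e B] is compared with a second factor [A - e' B]: they are coprime, yet congruent modulo the
   maximal ideal because [B] reduces to zero. *)
have sq e e' Q : O e -> O e' -> e != e' -> coprimep (A - e *: B) Q ->
    (A - e *: B) * Q = D * W ^+ 2 ->
    forall Q', coprimep (A - e' *: B) Q' -> (A - e' *: B) * Q' = D * W ^+ 2 ->
    exists2 S, polyO O S & A - e *: B = S ^+ 2.
  move=> Oe Oe' ne cQ eQ Q' cQ' eQ'.
  have [s ss [S eS]] := odd_part W0 cQ eQ.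
  have [t st [T eT]] := odd_part W0 cQ' eQ'.
  have eS2 := reduction_square ss st (cPP _ _ ne) (OP _ Oe) (OP _ Oe') (nP _ Oe) (mPP _ _ Oe Oe') eS eT.
  exists S => //; apply: (polyO_sqrt vO (OP _ Oe) (Q := 1)); rewrite ?mul1r //.
    exact: polyO1.
  exact: gord_not_polym (gord1 vO).
have c1 : coprimep P1 (B * (P2 * P3)) by rewrite !coprimepMr cPB !cPP.
have c2 : coprimep P2 (B * (P1 * P3)) by rewrite !coprimepMr cPB !cPP // eq_sym.
have c3 : coprimep P3 (B * (P1 * P2)) by rewrite !coprimepMr cPB !cPP // eq_sym.
have E1 : P1 * (B * (P2 * P3)) = D * W ^+ 2 by rewrite -eqP'; ring.
have E2 : P2 * (B * (P1 * P3)) = D * W ^+ 2 by rewrite -eqP'; ring.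
have E3 : P3 * (B * (P1 * P2)) = D * W ^+ 2 by rewrite -eqP'; ring.
have [S1 OS1 eS1] := sq e1 e2 _ Oe1 Oe2 e12 c1 E1 _ c2 E2.
have [T2 OT2 eT2] := sq e2 e3 _ Oe2 Oe3 e23 c2 E2 _ c3 E3.
have ne31 : e3 != e1 by rewrite eq_sym.
have [T3 OT3 eT3] := sq e3 e1 _ Oe3 Oe1 ne31 c3 E3 _ c1 E1.
have [S2 [OS2 eS2 mS2]] : exists T', [/\ polyO O T', T' ^+ 2 = T2 ^+ 2 & polym O (S1 - T')].
  by apply: sign_choice => //; rewrite -eS1 -eT2; exact: mPP.
have [S3 [OS3 eS3 mS3]] : exists T', [/\ polyO O T', T' ^+ 2 = T3 ^+ 2 & polym O (S1 - T')].
  by apply: sign_choice => //; rewrite -eS1 -eT3; exact: mPP.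
rewrite -{}eT2 in eS2; rewrite -{}eT3 in eS3.
have nS1 : ~ polym O S1.
  move=> mS1; apply: (nP _ Oe1); rewrite eS1 expr2; exact: polymM.
have [S0 eW] : exists S0, W = S0 * (S1 * S2 * S3).
  apply/dvdpP; apply: (squarefree_sqr_dvd sfD); rewrite -eqP' /P1 /P2 /P3.
  by rewrite eS1 -eS2 -eS3 !exprMn dvdp_mull.
have eB : B = D * S0 ^+ 2.
  have S0' : (S1 * S2 * S3) ^+ 2 != 0.
    rewrite expf_neq0 //; apply: contraNneq W0 => h; by rewrite eW h mulr0.
  apply: (mulIf S0'); transitivity (B * (P1 * P2 * P3)).
    by rewrite /P1 /P2 /P3 eS1 -eS2 -eS3; ring.
  by rewrite eqP' eW; ring.
have S00 : S0 != 0 by apply: contraNneq B0 => h; rewrite eB h expr0n mulr0.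
(* Halving formula: if [x - e_i = r_i^2], a half of the point has abscissa
   [x0 = x + r1 r2 + r1 r3 + r2 r3], since then [x0 - e_i = (r_i + r_j)(r_i + r_k)]. Here
   [S_i^2 = A - e_i B]. *)
set A' := A + (S1 * S2 + S1 * S3 + S2 * S3).
have sum12 : A' - e1 *: B = (S1 + S2) * (S1 + S3).
  by rewrite /A' addrAC -/P1 /P1 eS1; ring.
have sum23 : A' - e2 *: B = (S1 + S2) * (S2 + S3).
  by rewrite /A' addrAC -eS2; ring.
have sum13 : A' - e3 *: B = (S1 + S3) * (S2 + S3).
  by rewrite /A' addrAC -eS3; ring.
have OA' : polyO O A'.
  by do ![apply: polyOD => //]; apply: polyOM.
(* With the signs chosen, all [S_i] reduce to [S1] and [B] to zero, so [A'] reduces to [4 S1^2]. As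
   2 is a unit this is nonzero, and the half again reduces to infinity. *)
have m2 : polym O ((4%:R : K) *: S1 ^+ 2 - A').
  have -> : (4%:R : K) *: S1 ^+ 2 - A' =
    (S1 ^+ 2 - A) + (S1 * (S1 - S2) + S1 * (S1 - S3) + (S1 * (S1 - S3) + S3 * (S1 - S2))).
    by rewrite /A' scaler_nat; ring.
  apply: polymD => //; first by rewrite -eS1 -opprB; apply: polymN => //; exact: mP.
  by do ![apply: polymD => //]; apply: polymM.
have nA' : ~ polym O A'.
  move=> mA'; have := polymD vO m2 mA'; rewrite subrK -mul_polyC => m4.
  have O4 : polyO O (4%:R : K)%:P.
    move=> i; rewrite coefC; case: eqP => _; [exact: subring_nat | exact: subring0].
  have [/(_ 0%N)|] := gauss_prime vO O4 (polyOX vO 2 OS1) m4.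
    have e4 : 4%:R = 2%:R * 2%:R :> K by rewrite -natrM.
    rewrite coefC eqxx e4.
    by move=> /(maxideal_prime vO (subring_nat sO 2) (subring_nat sO 2)) [].
  by rewrite expr2 => /(gauss_prime vO OS1 OS1) [].
set W' := S0 * ((S1 + S2) * (S1 + S3) * (S2 + S3)).
have eq' : quartic a b A' B = D * W' ^+ 2.
  by rewrite quarticE sum12 sum23 sum13 eB /W'; ring.
have nsum S T : polyO O S -> ~ polym O S -> polym O (S - T) -> ~ polym O (S + T).
  move=> OS nS mST mS; have := polymD vO mST mS.
  have -> : S - T + (S + T) = (2%:R : K)%:P * S by rewrite polyC_natr; ring.
  have O2 : polyO O (2%:R : K)%:P.
    move=> i; rewrite coefC; case: eqP => _; [exact: subring_nat | exact: subring0].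
  by move/(gauss_prime vO O2 OS) => [/(_ 0%N)|//]; rewrite coefC eqxx.
have nm0 S : ~ polym O S -> S != 0.
  by move=> nS; apply/eqP => S0z; apply: nS => i; rewrite S0z coef0; exact: maxideal0.
have nS2 : ~ polym O S2.
  by move=> mS; apply: nS1; have := polymD vO mS2 mS; rewrite subrK.
have mS23 : polym O (S2 - S3).
  by have := polymB vO mS3 mS2; rewrite opprB addrC addrA subrK.
have n12 := nm0 _ (nsum _ _ OS1 nS1 mS2).
have n13 := nm0 _ (nsum _ _ OS1 nS1 mS3).
have n23 := nm0 _ (nsum _ _ OS2 nS2 mS23).
have W'0 : W' != 0 by rewrite !mulf_neq0.
have [G [A1 [B1 [W1 [[eA1 eB1 cAB1 W10 eq1] eG]]]]] := quartic_coprime_reduction sfD eq' W'0.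
have G0 : G != 0 by apply: contraNneq B0 => h; rewrite eB1 h mulr0.
have B10 : B1 != 0 by apply: contraNneq B0 => h; rewrite eB1 h mul0r.
(* Each sum [S_i + S_j] divides both [B] and [A'], so it divides their gcd [G]; cancelling [G] is
   what lowers the size of the denominator. *)
have dvdB e e' S T : e != e' -> A - e *: B = S ^+ 2 -> A - e' *: B = T ^+ 2 -> S + T %| B.
  move=> ne eS eT; have : S + T %| (e' - e) *: B.
    have -> : (e' - e) *: B = (S - T) * (S + T).
      by rewrite -subr_sqr -eS -eT opprB [RHS]addrC addrA subrK scalerBl.
    exact: dvdp_mull.
  by rewrite dvdpZr // subr_eq0 eq_sym.
have dvdG S R e : A' - e *: B = S * R -> S %| B -> S %| G.
  move=> eS SB; rewrite (eqp_dvdr _ eG) dvdp_gcd SB andbT.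
  rewrite -[A'](subrK (e *: B)) eS dvdp_add // ?dvdp_mulr //.
  by rewrite -mul_polyC dvdp_mull.
have G12 : S1 + S2 %| G by apply: (dvdG _ _ e1 sum12); apply: (dvdB e1 e2).
have G13 : S1 + S3 %| G.
  by apply: (dvdG _ (S1 + S2) e1); [rewrite sum12 mulrC | apply: (dvdB e1 e3)].
have G23 : S2 + S3 %| G.
  by apply: (dvdG _ (S1 + S2) e2); [rewrite sum23 mulrC | apply: (dvdB e2 e3)].
(* If [G] were constant, so would be the sums [S_i + S_j], hence [S1], [S2] and [B]; but
   [B = D S0^2] is not constant. *)
have sG : (1 < size G)%N.
  rewrite ltnNge; apply/negP => sG.
  have sz S T : S + T %| G -> (size (S + T)%R <= 1)%N.
    by move=> /(dvdp_leq G0) le; apply: leq_trans le sG.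
  have eS1' : S1 = 2%:R^-1 *: ((S1 + S2) + (S1 + S3) - (S2 + S3)).
    rewrite (_ : _ - _ = (2%:R : K)%:P * S1); last by rewrite polyC_natr; ring.
    rewrite mul_polyC scalerA mulVf ?scale1r //.
    by apply/eqP => h; apply: unit2; left.
  have size1 S : (size S <= 1)%N -> exists s, S = s%:P.
    by move=> h; exists S`_0; exact: size1_polyC.
  have [s es] := size1 _ (sz _ _ G12).
  have [t et] := size1 _ (sz _ _ G13).
  have [r er] := size1 _ (sz _ _ G23).
  have [w ew] : exists w, S1 = w%:P.
    exists (2%:R^-1 * (s + t - r)).
    by rewrite eS1' es et er -!rmorphD -rmorphB /= -mul_polyC -rmorphM.
  have eP1 : exists x, P1 = x%:P by exists (w ^+ 2); rewrite /P1 eS1 ew -rmorphXn.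
  have eP2 : exists x, P2 = x%:P.
    exists ((s - w) ^+ 2); rewrite /P2 -eS2 rmorphXn rmorphB /= -es -ew.
    by rewrite [S1 + S2]addrC addrK.
  have sB : (size B <= 1)%N.
    have [x ex] := eP1; have [y ey] := eP2.
    have : (e2 - e1) *: B = (x - y)%:P.
      by rewrite rmorphB /= -ex -ey /P1 /P2 opprB [RHS]addrC addrA subrK scalerBl.
    move/(congr1 (fun Q : {poly K} => size Q)).
    by rewrite size_scale ?subr_eq0 1?eq_sym // => ->; exact: size_polyC_leq1.
  move: sB; rewrite eB size_mul_neq0 // ?expf_neq0 //.
  have sD : (1 < size D)%N by rewrite size_scale // size_prod_XsubC ltnS.
  have sS : (0 < size (S0 ^+ 2)%R)%N by rewrite size_poly_gt0 expf_neq0.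
  move=> le1; have le2 : (size D + size (S0 ^+ 2)%R <= 2)%N.
    by move: le1; rewrite -ltnS; exact: leq_trans (leqSpred _).
  by have := leq_trans (leq_add sD sS) le2.
(* [G] is rescaled to have nonzero reduction, so that by Gauss's lemma the cofactors remain over
   [O]. *)
have [g g0 [OG nG]] := poly_normalize vO G0.
have eA1' : A' = (g *: G) * (g^-1 *: A1).
  by rewrite -scalerAr -scalerAl scalerA mulVf // scale1r mulrC.
have eB1' : B = (g *: G) * (g^-1 *: B1).
  by rewrite -scalerAr -scalerAl scalerA mulVf // scale1r mulrC.
have OA1 := polyO_divisor vO OA' eA1' OG nG.
have OB1 := polyO_divisor vO OB eB1' OG nG.
have : g ^- 2 *: W1 = 0.
  apply: (IH (g^-1 *: A1) (g^-1 *: B1)) => //.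
  - rewrite size_scale ?invr_eq0 //; rewrite -ltnS; apply: leq_trans ltn; rewrite ltnS.
    have sB1 : (0 < size B1)%N by rewrite size_poly_gt0.
    rewrite eB1 size_mul_neq0 //; case: (size G) sG => [|[|k]] // _.
    by rewrite !addnS /= ltnS leq_addr.
  - by move=> mA1; apply: nA'; rewrite eA1'; exact: polymM.
  - have := mB; rewrite {1}eB1' => /(gauss_prime vO OG OB1) [//|//].
  - by rewrite coprimepZl ?coprimepZr ?invr_eq0.
  - rewrite -!mul_polyC ![g^-1%:P * _]mulrC quarticM eq1.
    by rewrite -!rmorphXn -exprVn !rmorphXn /=; ring.
move/eqP; rewrite scaler_eq0 invr_eq0 expf_eq0 (negPf g0) /=.
by rewrite (negPf W10).
Qed.

End KernelOfReduction.

(** With [s = 1 - aX/b], the factor added to [f] is [b^2 (s^2 - 4)]; adjoining [z] with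
    [z + 1/z = s] amounts to adjoining its square root. *)
Definition twistX (R : comNzRingType) (a b : R) : {poly R} :=
  cubicX a b * ((a *: 'X - (3 * b)%:P) * (a *: 'X + b%:P)).

(** * Separability of the twisting polynomial and base change *)

Section TwistPolynomial.
Variable F : fieldType.
Implicit Types a b : F.

Lemma cubicX_horner a b c : (cubicX a b).[c] = cubic a b c.
Proof. by rewrite /cubicX /cubic !hornerE ?hornerXn. Qed.

Lemma deriv_cubicX a b : (cubicX a b)^`() = 3 *: 'X^2 + a%:P.
Proof.
rewrite /cubicX !derivD derivXn derivZ derivX derivC addr0 alg_polyC /=.
by rewrite scaler_nat.
Qed.

Lemma cubicX_separable a b : cubic_disc a b != 0 ->
  coprimep (cubicX a b) (cubicX a b)^`().
Proof.
move=> disc0; apply/Bezout_eq1_coprimepP.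
exists ((cubic_disc a b)^-1 *: - ((18 * a) *: 'X - (27 * b)%:P),
        (cubic_disc a b)^-1 *: ((6 * a) *: 'X^2 - (9 * b) *: 'X + (4 * a ^+ 2)%:P)) => /=.
rewrite deriv_cubicX -!scalerAl -scalerDr.
have -> : - ((18 * a) *: 'X - (27 * b)%:P) * cubicX a b +
   ((6 * a) *: 'X^2 - (9 * b) *: 'X + (4 * a ^+ 2)%:P) * (3 *: 'X^2 + a%:P)
   = (cubic_disc a b)%:P.
  rewrite /cubicX /cubic_disc -!mul_polyC.
  by rewrite !(rmorphD, rmorphM, rmorphXn, rmorph_nat) /=; ring.
by rewrite -mul_polyC -rmorphM /= mulVf.
Qed.

Lemma affine_scale a c : a != 0 -> a *: 'X - c%:P = a *: ('X - (c / a)%:P).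
Proof. by move=> a0; rewrite scalerBr -[a *: (c / a)%:P]mul_polyC -rmorphM /= mulrC divfK. Qed.

Lemma coprimep_affine a c (P : {poly F}) : a != 0 ->
  coprimep P (a *: 'X - c%:P) = (P.[c / a] != 0).
Proof. by move=> a0; rewrite affine_scale // coprimepZr // coprimep_XsubC. Qed.

Lemma separableM (P Q : {poly F}) : coprimep P P^`() -> coprimep Q Q^`() ->
  coprimep P Q -> coprimep (P * Q) (P * Q)^`().
Proof.
move=> sP sQ cPQ; have := separable_mul P Q.
by rewrite !unlock sP sQ cPQ.
Qed.

Lemma cubic_at_3ba a b : a != 0 -> cubic a b (3 * b / a) = b * cubic_disc a b / a ^+ 3.
Proof. by move=> a0; rewrite /cubic /cubic_disc; field. Qed.

Lemma cubic_at_Nba a b : a != 0 -> cubic a b (- b / a) = - b ^+ 3 / a ^+ 3.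
Proof. by move=> a0; rewrite /cubic; field. Qed.

(** The two extra roots [3b/a] and [-b/a] differ by [4b/a], and [f] takes there the nonzero values
    [b disc/a^3] and [-b^3/a^3]; so the five roots are distinct. *)
Lemma twistX_separable a b : 2 != 0 :> F -> a != 0 -> b != 0 -> cubic_disc a b != 0 ->
  coprimep (twistX a b) (twistX a b)^`().
Proof.
move=> two0 a0 b0 disc0.
have addN : a *: 'X + b%:P = a *: 'X - (- b)%:P by rewrite rmorphN opprK.
have linsep c : coprimep (a *: 'X - c%:P) (a *: 'X - c%:P)^`().
  by rewrite derivB derivZ derivX derivC subr0 coprimepZr // coprimep1.
apply: separableM; first exact: cubicX_separable.
  rewrite addN; apply: separableM => //.
  rewrite coprimep_affine //.
  have -> : (a *: 'X - (3 * b)%:P).[- b / a] = - (2 * 2 * b).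
    by rewrite hornerD hornerN hornerZ hornerX hornerC; field.
  by rewrite oppr_eq0 !mulf_neq0.
rewrite coprimepMr coprimep_affine // addN coprimep_affine // !cubicX_horner.
rewrite cubic_at_3ba // cubic_at_Nba // !mulf_neq0 ?invr_eq0 ?expf_neq0 //.
by rewrite oppr_eq0 expf_neq0.
Qed.

Lemma size_twistX a b : a != 0 -> size (twistX a b) = 6%N.
Proof.
move=> a0.
have addN : a *: 'X + b%:P = a *: 'X - (- b)%:P by rewrite rmorphN opprK.
rewrite /twistX addN !affine_scale //.
rewrite size_mul_neq0 ?size_cubicX -?size_poly_gt0 ?size_cubicX //.
  rewrite size_mul_neq0 ?size_scale ?size_XsubC // scaler_eq0 negb_or a0.
    by rewrite polyXsubC_eq0.
  by rewrite polyXsubC_eq0.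
rewrite size_mul_neq0 ?size_scale ?size_XsubC // scaler_eq0 negb_or a0.
  by rewrite polyXsubC_eq0.
by rewrite polyXsubC_eq0.
Qed.

End TwistPolynomial.

Section MapPolynomials.
Variables (R S : comNzRingType) (f : {rmorphism R -> S}).
Implicit Types a b : R.

Lemma map_cubicX a b : map_poly f (cubicX a b) = cubicX (f a) (f b).
Proof. by rewrite /cubicX !rmorphD /= map_polyZ /= map_polyXn map_polyX map_polyC. Qed.

Lemma map_twistX a b : map_poly f (twistX a b) = twistX (f a) (f b).
Proof.
rewrite /twistX (rmorphM (map_poly f)) (rmorphM (map_poly f)) /= map_cubicX.
rewrite rmorphB rmorphD /= !map_polyZ /= !map_polyX !map_polyC /=.
by rewrite rmorphM rmorph_nat.
Qed.

Lemma map_quartic a b A B :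
  map_poly f (quartic a b A B) = quartic (f a) (f b) (map_poly f A) (map_poly f B).
Proof.
by rewrite /quartic -!(map_polyC f) -!rmorphXn -!rmorphM -!rmorphD.
Qed.
End MapPolynomials.

(** * Integral models of rational points *)

Section IntegralForms.
Variables (p : nat) (p_prime : prime p).

Lemma intr_Fp_eq0 (z : int) : (z%:~R == 0 :> 'F_p) = (p %| z)%Z.
Proof.
have natE n : (n%:R == 0 :> 'F_p) = (p %| n)%N by rewrite -(dvdn_pcharf (pchar_Fp p_prime)).
by case: z => n; rewrite ?NegzE ?mulrNz ?oppr_eq0 natE // dvdzE abszN.
Qed.

Lemma rat_poly_prim (C : {poly rat}) : C != 0 ->
  exists r (q : {poly int}), [/\ r != 0, map_poly intr q = r *: C &
    map_poly intr q != 0 :> {poly 'F_p}].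
Proof.
move=> C0; have [q [d d0 eC]] := rat_poly_scale C.
have q0 : q != 0 by apply: contraNneq C0 => q0; rewrite eC q0 rmorph0 scaler0.
have c0 : zcontents q != 0 by rewrite zcontents_eq0.
exists (d%:~R / (zcontents q)%:~R), (zprimitive q); split.
- by rewrite mulf_neq0 // ?invr_eq0 intr_eq0.
- have eq : map_poly intr q = (zcontents q)%:~R *: map_poly intr (zprimitive q) :> {poly rat}.
    by rewrite {1}(zpolyEprim q) map_polyZ.
  rewrite eC eq !scalerA -[LHS]scale1r; congr (_ *: _); field.
  by rewrite !intr_eq0 d0.
apply/eqP => m0.
have : (p %| zcontents (zprimitive q))%Z.
  rewrite dvdz_contents; apply/polyOverP => i.
  by rewrite -[_ \in _]/(p %| _)%Z -intr_Fp_eq0 -coef_map /= m0 coef0.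
rewrite zcontents_primitive q0 /= dvdzE /= dvdn1 => /eqP p1.
by move: p_prime; rewrite p1.
Qed.

(** Packing [A] and [B] into the single polynomial [A + B X^(size A)] clears denominators and common
    content of both with one scalar. *)
Lemma rat_poly_pair_prim (A B : {poly rat}) : (A != 0) || (B != 0) ->
  exists r (A0 B0 : {poly int}),
    [/\ r != 0, map_poly intr A0 = r *: A, map_poly intr B0 = r *: B &
      (map_poly intr A0 != 0 :> {poly 'F_p}) || (map_poly intr B0 != 0 :> {poly 'F_p})].
Proof.
move=> AB0; pose C := A + B * 'X^(size A).
have eA : take_poly (size A) C = A by rewrite take_polyDMXn.
have eB : drop_poly (size A) C = B by rewrite drop_polyDMXn.
have C0 : C != 0.
  apply: contraTneq AB0 => C0.
  by rewrite -{1}eA -{1}eB C0 take_poly0r drop_poly0r eqxx.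
have [r [q [r0 eq nq]]] := rat_poly_prim C0.
exists r, (take_poly (size A) q), (drop_poly (size A) q); split=> //.
- apply/polyP => i; have := congr1 (fun Q : {poly rat} => Q`_i) eq.
  rewrite coef_map coefZ /= => ei; rewrite coef_map coefZ /= coef_take_poly.
  have -> : A`_i = if (i < size A)%N then C`_i else 0 by rewrite -{1}eA coef_take_poly.
  by case: ifP => // _; rewrite rmorph0 mulr0.
- apply/polyP => i; have := congr1 (fun Q : {poly rat} => Q`_(i + size A)) eq.
  rewrite coef_map coefZ /= => ei; rewrite coef_map coefZ /= coef_drop_poly.
  by have -> : B`_i = C`_(i + size A) by rewrite -{1}eB coef_drop_poly.
rewrite -negb_and; apply: contraNN nq => /andP[/eqP mA /eqP mB].
by rewrite -(poly_take_drop (size A) q) rmorphD rmorphM /= mA mB mul0r addr0.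
Qed.

End IntegralForms.

Lemma cubic_split (K : closedFieldType) (a b : K) :
  exists e1 e2 e3, [/\ e1 + e2 + e3 = 0, e1 * e2 + e1 * e3 + e2 * e3 = a &
    e1 * e2 * e3 = - b].
Proof.
have [r er] := closed_field_poly_normal (cubicX a b).
have lc : lead_coef (cubicX a b) = 1.
  by rewrite lead_coefE size_cubicX /cubicX !coefE /= mulr0 !addr0.
have sr : size r = 3%N.
  have := size_cubicX a b; rewrite er lc scale1r size_prod_XsubC.
  by case.
case: r sr er => [//|e1 [//|e2 [//|e3 [|//]]]] _; rewrite lc scale1r !big_cons big_nil mulr1.
have -> : ('X - e1%:P) * (('X - e2%:P) * ('X - e3%:P)) =
   'X^3 - (e1 + e2 + e3) *: 'X^2 + (e1 * e2 + e1 * e3 + e2 * e3) *: 'X - (e1 * e2 * e3)%:P.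
  by rewrite -!mul_polyC !(rmorphD, rmorphM) /=; ring.
move=> er; exists e1, e2, e3.
have e0 := congr1 (fun P : {poly K} => P`_0) er.
have ee1 := congr1 (fun P : {poly K} => P`_1) er.
have ee2 := congr1 (fun P : {poly K} => P`_2) er.
move: e0 ee1 ee2; rewrite /cubicX !coefE /= !(mulr0, mulr1, addr0, add0r, subr0, oppr0).
move=> -> -> /eqP; rewrite eq_sym oppr_eq0 => /eqP ->.
by split; rewrite ?opprK.
Qed.

Lemma intr_cubic_disc (F : fieldType) (a b : int) :
  (4 * a ^+ 3 + 27 * b ^+ 2)%:~R = cubic_disc a%:~R b%:~R :> F.
Proof. by rewrite rmorphD (rmorphM _ 4) (rmorphM _ 27) !rmorphXn. Qed.

(** * From characteristic p to the rationals *)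

Section Reduction.
Variables (p : nat) (p_prime : prime p) (p_odd : odd p) (a b : int).
Let ap : 'F_p := a%:~R.
Let bp : 'F_p := b%:~R.
Hypotheses (ap0 : ap != 0) (bp0 : bp != 0) (disc0 : cubic_disc ap bp != 0).
Hypothesis det0 : hasse_witt_det ap bp (twistX ap bp) != 0.

Let two0 : 2 != 0 :> 'F_p.
Proof.
rewrite -(dvdn_pcharf (pchar_Fp p_prime)); apply/negP => /dvdn_leq le.
by move: p_odd (prime_gt1 p_prime) (le isT); case: p => [|[|[|]]].
Qed.

Let inj_rat : injective (map_poly (intr : int -> rat)).
Proof. by apply: map_inj_poly => //; exact: intr_inj. Qed.

(** Once [W] is seen to be integral at [p], the whole equation reduces and [no_twist_point_Fp]
    applies. The reductions of [A] and [B] may have a common factor, which that lemma allows. *)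
Lemma quartic_mod_p_eq0 (A B : {poly int}) (W : {poly rat}) :
  map_poly intr (quartic a b A B) = twistX a%:~R b%:~R * W ^+ 2 ->
  map_poly intr (quartic a b A B) = 0 :> {poly 'F_p}.
Proof.
move=> eq; have [W0|W0] := eqVneq W 0.
  have -> : quartic a b A B = 0; last by rewrite rmorph0.
  by apply: inj_rat; rewrite rmorph0 eq W0 expr0n mulr0.
have [s [V [s0 eV nV]]] := rat_poly_prim p_prime W0.
pose k := s^-1; pose n := numq k; pose d := denq k.
have ek : s^-1 = n%:~R / d%:~R by rewrite divq_num_den.
have dQ0 : d%:~R != 0 :> rat by rewrite intr_eq0 denq_neq0.
have eW : W = (n%:~R / d%:~R) *: map_poly intr V by rewrite eV -ek scalerA mulVf // scale1r.
have eqZ : d ^+ 2 *: quartic a b A B = n ^+ 2 *: (twistX a b * V ^+ 2).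
  apply: inj_rat; rewrite !map_polyZ /= eq eW (rmorphM (map_poly intr)) /= map_twistX !rmorphXn /=.
  rewrite exprZn -scalerAr !scalerA; congr (_ *: _).
  by rewrite -exprMn mulrC divfK.
have eFp := congr1 (map_poly (intr : int -> 'F_p)) eqZ.
move: eFp; rewrite !map_polyZ /= (rmorphM (map_poly intr)) /= map_twistX -/ap -/bp !rmorphXn /=.
set Qp := map_poly _ _; set Vp := map_poly _ V; set np : 'F_p := n%:~R; set dp : 'F_p := d%:~R.
move=> eFp.
have h0 : twistX ap bp != 0 by rewrite -size_poly_gt0 size_twistX.
(* If [p] divided the denominator [d], then [n^2 h V^2] would vanish modulo [p] with [h] and [V]
   nonzero there, so [p] would divide [n] as well. *)
have dp0 : dp != 0.
  apply/eqP => dp0; move: eFp; rewrite dp0 expr0n scale0r => /esym/eqP.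
  rewrite scaler_eq0 expf_eq0 /= => /orP[/eqP np0|]; last first.
    by rewrite mulf_eq0 (negPf h0) expf_eq0 (negPf nV).
  have pn : (p %| `|n|)%N by have := intr_Fp_eq0 p_prime n; rewrite -/np np0 eqxx dvdzE.
  have pd : (p %| `|d|)%N by have := intr_Fp_eq0 p_prime d; rewrite -/dp dp0 eqxx dvdzE.
  have := coprime_num_den k; rewrite /coprime => /eqP g1.
  have : (p %| gcdn `|n| `|d|)%N by rewrite dvdn_gcd pn pd.
  by rewrite g1 dvdn1 => /eqP p1; move: p_prime; rewrite p1.
have eqF : Qp = twistX ap bp * ((np / dp) *: Vp) ^+ 2.
  apply: (scalerI (expf_neq0 2 dp0)); rewrite eFp exprZn -scalerAr !scalerA.
  congr (_ *: _); by rewrite -exprMn mulrC divfK.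
have sD := size_twistX bp ap0.
have sfD := twistX_separable two0 ap0 bp0 disc0.
have eQp : Qp = quartic ap bp (map_poly intr A) (map_poly intr B) by rewrite -map_quartic.
have := no_twist_point_Fp p_prime p_odd disc0 sD sfD det0 (etrans (esym eQp) eqF).
by move=> k0; rewrite eqF k0 expr0n mulr0.
Qed.

(** The form [quartic] vanishes modulo [p], so by Gauss's lemma the point reduces to infinity or to
    some [(e, 0)]. The roots [e] may be irrational, whence the valuation ring of [algC] above [p].
    In the second case translation by [(e, 0)] moves the point into the kernel of reduction. *)
Lemma no_twist_point_rat (A B W : {poly rat}) : coprimep A B ->
  quartic a%:~R b%:~R A B = twistX a%:~R b%:~R * W ^+ 2 -> W = 0.
Proof.
move=> cAB eq.
have AB0 : (A != 0) || (B != 0).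
  rewrite -negb_and; apply: contraTN cAB => /andP[/eqP-> /eqP->].
  by rewrite coprimep0 -size_poly_eq1 size_poly0.
have [r [A0 [B0 [r0 eA eB nAB]]]] := rat_poly_pair_prim p_prime AB0.
have eqZ : map_poly intr (quartic a b A0 B0) = twistX a%:~R b%:~R * (r ^+ 2 *: W) ^+ 2.
  rewrite map_quartic eA eB exprZn -scalerAr -eq -exprM.
  by rewrite -!mul_polyC ![r%:P * _]mulrC quarticM -rmorphXn mulrC.
have mod0 := quartic_mod_p_eq0 eqZ.
pose pC : algC := p%:R.
have p0 : pC != 0 by rewrite pnatr_eq0 -lt0n prime_gt0.
have [||O [vO nOp]] := @exists_valring algC pC _ p0.
- by exists p.
- move=> z ez; have : (z * p%:Z)%:~R = 1 :> algC by rewrite rmorphM /= -ez mulVf.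
  move/eqP; rewrite (_ : 1 = 1%:~R) // eqr_int => /eqP zp.
  have : (p %| z * p)%Z by rewrite dvdz_mull.
  by rewrite zp dvdzE /= dvdn1 => /eqP p1; move: p_prime; rewrite p1.
have sO : is_subring O by case: vO.
have mp : maxideal O pC by right.
have Oint (z : int) : O z%:~R by exact: subring_int.
have mint (z : int) : (z%:~R == 0 :> 'F_p) -> maxideal O z%:~R.
  rewrite (intr_Fp_eq0 p_prime) => /dvdzP[q ->]; rewrite rmorphM /=.
  exact: maxidealM.
have nint (z : int) : z%:~R != 0 :> 'F_p -> ~ maxideal O z%:~R.
  rewrite (intr_Fp_eq0 p_prime) => nz mz.
  have cz : coprimez z p.
    by rewrite coprimezE /= coprime_sym prime_coprime // -[p]/`|p%:Z|%N -dvdzE.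
  have [[u v] /= uv] := coprimezP _ _ cz.
  apply: (maxideal1 vO); have -> : 1 = u%:~R * z%:~R + v%:~R * pC :> algC.
    by rewrite -[pC]/(p%:Z%:~R) -!rmorphM -rmorphD /= uv.
  by apply: maxidealD => //; apply: maxidealM.
pose aC : algC := a%:~R; pose bC : algC := b%:~R.
have OaC : O aC := Oint a; have ObC : O bC := Oint b.
have na : ~ maxideal O aC by exact: nint.
have nb : ~ maxideal O bC by exact: nint.
have ndisc : ~ maxideal O (cubic_disc aC bC).
  by rewrite /aC /bC -intr_cubic_disc; apply: nint; rewrite intr_cubic_disc.
have n2 : ~ maxideal O 2 by apply: (nint 2).
have nz x : ~ maxideal O x -> x != 0 by move=> nx; apply/eqP => x0; apply: nx; left.
have OaV : O aC^-1 by exact: valring_inv.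
have nM x y : O x -> O y -> ~ maxideal O x -> ~ maxideal O y -> ~ maxideal O (x * y).
  by move=> Ox Oy nx ny /(maxideal_prime vO Ox Oy) [].
have nMl x y : O y -> ~ maxideal O (x * y) -> ~ maxideal O x.
  by move=> Oy nxy mx; apply: nxy; rewrite mulrC; exact: maxidealM.
have naV : ~ maxideal O aC^-1.
  by apply: (nMl _ aC (Oint _)); rewrite mulVf ?nz //; exact: maxideal1.
have [e1 [e2 [e3 [s1 s2 s3]]]] := cubic_split aC bC.
have rootE x : (x - e1) * (x - e2) * (x - e3) = cubic aC bC x.
  rewrite /cubic -s2 (_ : bC = - (e1 * e2 * e3)); last by rewrite s3 opprK.
  have -> : e3 = - e1 - e2 by rewrite -[e3](addKr (e1 + e2)) s1 addr0 opprD.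
  by ring.
(* Valuation rings are integrally closed: if [e^-1] is in [O], dividing the cubic relation by [e^2]
   writes [e] in terms of [e^-1]. *)
have Oroot e : cubic aC bC e = 0 -> O e.
  move=> fe; case: vO => _ /(_ e) [//|Oe].
  have [->|e0] := eqVneq e 0; first exact: subring0.
  have -> : e = - (aC * e^-1 + bC * e^-1 ^+ 2).
    have -> : aC * e^-1 + bC * e^-1 ^+ 2 = (cubic aC bC e - e ^+ 3) / e ^+ 2.
      by rewrite /cubic; field.
    by rewrite fe; field.
  apply: subringN => //; apply: subringD => //; apply: subringM => //; exact: (subringX sO).
have Oe1 : O e1 by apply: Oroot; rewrite -rootE subrr !mul0r.
have Oe2 : O e2 by apply: Oroot; rewrite -rootE subrr mulr0 mul0r.
have Oe3 : O e3 by apply: Oroot; rewrite -rootE subrr mulr0.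
have OB x y : O x -> O y -> O (x - y) by exact: subringB.
(* [cubic_disc] is minus the usual discriminant; being a unit, it forces all differences of roots to
   be units. *)
have discE : cubic_disc aC bC = - ((e1 - e2) * (e1 - e3) * (e2 - e3)) ^+ 2.
  rewrite /cubic_disc -s2 (_ : bC = - (e1 * e2 * e3)); last by rewrite s3 opprK.
  have -> : e3 = - e1 - e2 by rewrite -[e3](addKr (e1 + e2)) s1 addr0 opprD.
  by ring.
have n12 : ~ maxideal O (e1 - e2).
  apply: (nMl _ (- ((e1 - e2) * ((e1 - e3) * (e2 - e3)) ^+ 2))).
    by apply: subringN => //; do ![apply: subringM => //]; exact: (OB _ _).
  by move: ndisc; rewrite discE; congr (~ maxideal O _); ring.
have n13 : ~ maxideal O (e1 - e3).
  apply: (nMl _ (- ((e1 - e3) * ((e1 - e2) * (e2 - e3)) ^+ 2))).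
    by apply: subringN => //; do ![apply: subringM => //]; exact: (OB _ _).
  by move: ndisc; rewrite discE; congr (~ maxideal O _); ring.
have n23 : ~ maxideal O (e2 - e3).
  apply: (nMl _ (- ((e2 - e3) * ((e1 - e2) * (e1 - e3)) ^+ 2))).
    by apply: subringN => //; do ![apply: subringM => //]; exact: (OB _ _).
  by move: ndisc; rewrite discE; congr (~ maxideal O _); ring.
pose x4 := 3 * bC / aC; pose x5 := - bC / aC.
have aC0 : aC != 0 by exact: (nz _).
have O3 : O 3 by exact: (subring_nat sO 3).
have Ox4 : O x4 by do ![apply: subringM => //].
have Ox5 : O x5 by apply: subringM => //; exact: subringN.
have naV3 : ~ maxideal O (aC^-1 ^+ 3).
  by rewrite !exprS expr0 mulr1; apply: (nM _ _) => //; [exact: subringM | exact: (nM _ _)].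
(* [f] takes unit values at [x4] and [x5], so their differences from the roots of [f], being factors
   of these values, are units too. *)
have n4 : ~ maxideal O ((x4 - e1) * (x4 - e2) * (x4 - e3)).
  rewrite rootE cubic_at_3ba // -exprVn; apply: (nM _ _) => //.
  - by apply: subringM => //; rewrite /aC /bC -intr_cubic_disc.
  - exact: (subringX sO).
  - by apply: (nM _ _) => //; rewrite /aC /bC -intr_cubic_disc.
have n5 : ~ maxideal O ((x5 - e1) * (x5 - e2) * (x5 - e3)).
  rewrite rootE cubic_at_Nba // mulNr -mulrN -exprVn.
  have nb3 : ~ maxideal O (bC ^+ 3).
    by rewrite !exprS expr0 mulr1; apply: (nM _ _) => //; [exact: subringM | exact: (nM _ _)].
  apply: (nM _ _) => //; [exact: (subringX sO) | | ].
    by apply: subringN => //; exact: (subringX sO).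
  by move=> /(maxidealN vO); rewrite opprK.
have [n41 n42 n43] : [/\ ~ maxideal O (x4 - e1), ~ maxideal O (x4 - e2) & ~ maxideal O (x4 - e3)].
  split; [apply: (nMl _ ((x4 - e2) * (x4 - e3))) | apply: (nMl _ ((x4 - e1) * (x4 - e3)))
    | apply: (nMl _ ((x4 - e1) * (x4 - e2)))]; try (by apply: subringM => //; exact: (OB _ _));
  by move: n4; congr (~ maxideal O _); ring.
have [n51 n52 n53] : [/\ ~ maxideal O (x5 - e1), ~ maxideal O (x5 - e2) & ~ maxideal O (x5 - e3)].
  split; [apply: (nMl _ ((x5 - e2) * (x5 - e3))) | apply: (nMl _ ((x5 - e1) * (x5 - e3)))
    | apply: (nMl _ ((x5 - e1) * (x5 - e2)))]; try (by apply: subringM => //; exact: (OB _ _));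
  by move: n5; congr (~ maxideal O _); ring.
have n45 : ~ maxideal O (x4 - x5).
  have -> : x4 - x5 = 2 * 2 * (bC * aC^-1) by rewrite /x4 /x5; ring.
  have O2 : O 2 by exact: (subring_nat sO 2).
  apply: (nM _ _); [exact: subringM | exact: subringM | exact: (nM _ _) | exact: (nM _ _)].
have nsym x y : ~ maxideal O (x - y) -> ~ maxideal O (y - x).
  by move=> nxy /(maxidealN vO); rewrite opprB.
have ne x y : ~ maxideal O (x - y) -> x != y.
  by move=> nxy; rewrite -subr_eq0; exact: (nz _).
pose rs := [:: e1; e2; e3; x4; x5].
have sep : separated O rs.
  split=> [x|x y].
    by rewrite !inE => /orP[/eqP->|/orP[/eqP->|/orP[/eqP->|/orP[/eqP->|/eqP->]]]].
  rewrite !inE.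
  move=> /orP[/eqP->|/orP[/eqP->|/orP[/eqP->|/orP[/eqP->|/eqP->]]]];
  move=> /orP[/eqP->|/orP[/eqP->|/orP[/eqP->|/orP[/eqP->|/eqP->]]]];
  rewrite ?eqxx // => _; by [| apply: (nsym _ _)].
have urs : uniq rs.
  rewrite /= !inE !negb_or !andbT; do ![apply/andP; split]; by [apply: (ne _ _) | apply: (ne _ _); apply: (nsym _ _)].
have cubicE : cubicX aC bC = ('X - e1%:P) * ('X - e2%:P) * ('X - e3%:P).
  rewrite /cubicX -s2 (_ : bC = - (e1 * e2 * e3)); last by rewrite s3 opprK.
  have -> : e3 = - e1 - e2 by rewrite -[e3](addKr (e1 + e2)) s1 addr0 opprD.
  by rewrite -mul_polyC !(rmorphD, rmorphN, rmorphM) /=; ring.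
have DE : aC ^+ 2 *: \prod_(x <- rs) ('X - x%:P) = twistX aC bC.
  have addN : aC *: 'X + bC%:P = aC *: 'X - (- bC)%:P by rewrite rmorphN opprK.
  rewrite /twistX addN !affine_scale // cubicE -/x4 -/x5 !big_cons big_nil.
  by rewrite -!mul_polyC rmorphXn /=; ring.
have quarticE' A' B' : quartic aC bC A' B' =
    B' * ((A' - e1 *: B') * (A' - e2 *: B') * (A' - e3 *: B')).
  rewrite /quartic -s2 (_ : bC = - (e1 * e2 * e3)); last by rewrite s3 opprK.
  have -> : e3 = - e1 - e2 by rewrite -[e3](addKr (e1 + e2)) s1 addr0 opprD.
  by rewrite -!mul_polyC !(rmorphD, rmorphN, rmorphM) /=; ring.
have discC0 : cubic_disc aC bC != 0 by exact: (nz _).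
have sfD : coprimep (twistX aC bC) (twistX aC bC)^`().
  by apply: twistX_separable => //; exact: (nz _).
rewrite -DE in sfD.
have ker := reduction_kernel_trivial vO quarticE' Oe1 Oe2 Oe3 (ne _ _ n12) (ne _ _ n13)
  (ne _ _ n23) (expf_neq0 2 aC0) sep urs isT n2 sfD.
rewrite DE in ker.
pose toC (P : {poly int}) : {poly algC} := map_poly intr P.
have ratrE P : map_poly ratr (map_poly intr P : {poly rat}) = toC P.
  by rewrite /toC -map_poly_comp; apply: eq_map_poly => z /=; rewrite ratr_int.
pose A1 := toC A0; pose B1 := toC B0; pose W1 : {poly algC} := map_poly ratr (r ^+ 2 *: W).
have OZ P : polyO O (toC P) by move=> i; rewrite coef_map; exact: Oint.
have mZ P : map_poly intr P = 0 :> {poly 'F_p} -> polym O (toC P).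
  move=> P0 i; rewrite coef_map /=; apply: (mint _).
  by rewrite -(coef_map (intr : {rmorphism int -> 'F_p})) /= P0 coef0.
have nZ P : map_poly intr P != 0 :> {poly 'F_p} -> ~ polym O (toC P).
  move=> P0 mP; move/eqP: P0; apply; apply/polyP => i; rewrite coef_map coef0 /=.
  apply/eqP/negPn/negP => nz0; apply: (nint _ nz0).
  by have := mP i; rewrite coef_map.
have eqC : quartic aC bC A1 B1 = twistX aC bC * W1 ^+ 2.
  have := congr1 (map_poly (ratr : rat -> algC)) eqZ.
  rewrite ratrE /toC map_quartic (rmorphM (map_poly ratr)) /= map_twistX /= !ratr_int.
  by rewrite rmorphXn.
have cAB1 : coprimep A1 B1.
  rewrite /A1 /B1 -!ratrE eA eB coprimep_map coprimepZl // coprimepZr //.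
have W10 : W1 = 0 -> W = 0.
  move/eqP; rewrite map_poly_eq0 scaler_eq0 expf_eq0 (negPf r0) /=.
  by move/eqP.
have mQ : polym O (quartic aC bC A1 B1).
  by have := mZ _ mod0; rewrite /toC map_quartic.
have OA1 : polyO O A1 by exact: OZ.
have OB1 : polyO O B1 by exact: OZ.
have nAB1 : ~ (polym O A1 /\ polym O B1).
  by case=> mA mB; case/orP: nAB => /nZ.
have OPe e : O e -> polyO O (A1 - e *: B1).
  by move=> Oe; apply: polyOB => //; exact: polyOZ.
apply: W10; have [mB|nB] := pselect (polym O B1).
  by apply: (ker A1 B1) => // mA; apply: nAB1.
(* Translation by the 2-torsion point [(e, 0)] sends [x] to [e + f'(e)/(x - e)]. In homogeneous form
   the new point is [A2 / (A1 - e B1)], whose denominator reduces to zero. *)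
have trans e : O e -> cubic aC bC e = 0 -> ~ maxideal O (3 * e ^+ 2 + aC) ->
    polym O (A1 - e *: B1) -> W1 = 0.
  move=> Oe fe nk mPe; set k := 3 * e ^+ 2 + aC in nk.
  have k0 : k != 0 by exact: (nz _).
  have Ok : O k by apply: subringD => //; apply: subringM => //; exact: (subringX sO).
  have bE : bC = - e ^+ 3 - aC * e.
    by apply/eqP; rewrite -subr_eq0 -fe /cubic; apply/eqP; ring.
  pose A2 := e *: (A1 - e *: B1) + k *: B1.
  have : k *: W1 = 0.
    apply: (ker A2 (A1 - e *: B1)).
    - by apply: polyOD => //; apply: polyOZ => //; exact: (OPe _).
    - move=> mA2; have : polym O (k *: B1).
        have := polymB vO mA2 (polymZ vO Oe mPe).
        by rewrite /A2 addrC addKr.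
      move=> mkB; apply: nB => i; have := mkB i; rewrite coefZ.
      by case/(maxideal_prime vO Ok (OB1 i)).
    - exact: mPe.
    - rewrite coprimep_sym /A2 -[e *: (A1 - _)]mul_polyC coprimep_addl_mul coprimepZr //.
      by rewrite coprimep_sym -scaleNr -mul_polyC addrC coprimep_addl_mul coprimep_sym.
    - rewrite exprZn -scalerAr -eqC /A2 /quartic bE /k -!mul_polyC.
      by rewrite !(rmorphD, rmorphB, rmorphN, rmorphM, rmorphXn, rmorph_nat) /=; ring.
  by move/eqP; rewrite scaler_eq0 (negPf k0) => /eqP.
have kE : [/\ 3 * e1 ^+ 2 + aC = (e1 - e2) * (e1 - e3),
    3 * e2 ^+ 2 + aC = (e2 - e1) * (e2 - e3) & 3 * e3 ^+ 2 + aC = (e3 - e1) * (e3 - e2)].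
  rewrite -s2; have -> : e3 = - e1 - e2 by rewrite -[e3](addKr (e1 + e2)) s1 addr0 opprD.
  by split; ring.
case: kE => k1 k2 k3.
have t1 : polym O (A1 - e1 *: B1) -> W1 = 0.
  apply: (trans _) => //; first by rewrite -rootE subrr !mul0r.
  by rewrite k1; apply: (nM _ _) => //; exact: (OB _ _).
have t2 : polym O (A1 - e2 *: B1) -> W1 = 0.
  apply: (trans _) => //; first by rewrite -rootE subrr mulr0 mul0r.
  by rewrite k2; apply: (nM _ _); [exact: (OB _ _) | exact: (OB _ _) | exact: (nsym _ _) |].
have t3 : polym O (A1 - e3 *: B1) -> W1 = 0.
  apply: (trans _) => //; first by rewrite -rootE subrr mulr0.
  by rewrite k3; apply: (nM _ _); [exact: (OB _ _) | exact: (OB _ _) | exact: (nsym _ _) | exact: (nsym _ _)].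
have OP12 := polyOM vO (OPe _ Oe1) (OPe _ Oe2).
move: mQ; rewrite quarticE' => /(gauss_prime vO OB1 (polyOM vO OP12 (OPe _ Oe3))) [//|].
move/(gauss_prime vO OP12 (OPe _ Oe3)) => [|//].
by move/(gauss_prime vO (OPe _ Oe1) (OPe _ Oe2)) => [].
Qed.

End Reduction.

(** * The group law on a twist and the additive map lambda *)

Section TwistedCurve.
Variables (K : fieldType) (a b D : K).
Hypotheses (two0 : 2 != 0 :> K) (D0 : D != 0) (disc0 : cubic_disc a b != 0).
Implicit Types (p q t : ecpoint K) (x y l : K).

Definition ton p : Prop :=
  if p is Some (x, y) then D * y ^+ 2 = cubic a b x else True.

(** The chord and tangent law on [D y^2 = x^3 + a x + b]; [scalept] carries it to [ecadd] on the
    Weierstrass model used in the statement. *)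
Definition tadd p q : ecpoint K :=
  match p, q with
  | None, _ => q
  | _, None => p
  | Some (x1, y1), Some (x2, y2) =>
    if x1 == x2 then
      if y1 + y2 == 0 then None
      else let m := (3 * x1 ^+ 2 + a) / (2 * D * y1) in
           let x3 := D * m ^+ 2 - 2 * x1 in Some (x3, m * (x1 - x3) - y1)
    else let m := (y2 - y1) / (x2 - x1) in
         let x3 := D * m ^+ 2 - x1 - x2 in Some (x3, m * (x1 - x3) - y1)
  end.

Definition scalept p : ecpoint K :=
  if p is Some (x, y) then Some (D * x, D ^+ 2 * y) else None.

Lemma ecadd_scale p q :
  ecadd (a * D ^+ 2) (scalept p) (scalept q) = scalept (tadd p q).
Proof.
case: p q => [[x1 y1]|] [[x2 y2]|] //=.
rewrite (inj_eq (mulfI D0)) -mulrDr mulf_eq0 expf_eq0 (negPf D0) /=.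
case: eqVneq => [e|x12].
  case: eqVneq => //= y12.
  (* The points need not lie on the curve, so [y1 = 0] is possible here; both slopes are then 0
     because [0^-1 = 0]. *)
  have [y10|y10] := eqVneq y1 0.
    by rewrite y10 !(mulr0, invr0, mul0r, expr0n) /=; congr (Some (_, _)); ring.
  by congr (Some (_, _)); field; rewrite ?D0 ?y10 ?two0.
have x21 : x2 - x1 != 0 by rewrite subr_eq0 eq_sym.
have Dx : D * x2 - D * x1 != 0 by rewrite -mulrBr mulf_neq0.
by rewrite /=; congr (Some (_, _)); field; rewrite ?Dx ?x21.
Qed.

Lemma scalept_surj p : exists q, p = scalept q.
Proof.
case: p => [[x y]|]; last by exists None.
exists (Some (x / D, y / D ^+ 2)) => /=; congr (Some (_, _)); by field.
Qed.

Lemma scalept_inj : injective scalept.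
Proof.
move=> [[x1 y1]|] [[x2 y2]|] //= [/(mulfI D0) -> h].
by have /(mulfI (expf_neq0 2 D0)) -> : D ^+ 2 * y1 = D ^+ 2 * y2.
Qed.

Lemma on_curve_scale p : on_curve (a * D ^+ 2) (b * D ^+ 3) (scalept p) <-> ton p.
Proof.
case: p => [[x y]|] //=; rewrite /cubic; split=> h.
  apply: (mulfI (expf_neq0 3 D0)); transitivity ((D ^+ 2 * y) ^+ 2); first by ring.
  by rewrite h; ring.
transitivity (D ^+ 3 * (D * y ^+ 2)); first by ring.
by rewrite h; ring.
Qed.

Lemma ecneg_scale p : ecneg (scalept p) = scalept (ecneg p).
Proof. by case: p => [[x y]|] //=; rewrite mulrN. Qed.

Lemma same_x x y1 y2 : D * y1 ^+ 2 = cubic a b x -> D * y2 ^+ 2 = cubic a b x ->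
  y1 + y2 != 0 -> y2 = y1.
Proof.
move=> h1 h2 y12; move: h2; rewrite -h1 => /(mulfI D0) /eqP.
rewrite eqf_sqr => /orP[/eqP//|/eqP h].
by rewrite h subrr eqxx in y12.
Qed.

Lemma taddC p q : ton p -> ton q -> tadd p q = tadd q p.
Proof.
case: p q => [[x1 y1]|] [[x2 y2]|] //= h1 h2.
rewrite [x2 == x1]eq_sym [y2 + y1]addrC; case: eqVneq => [e|x12].
  case: eqVneq => // y12; rewrite -e in h2.
  by rewrite (same_x h1 h2 y12) e.
have x21 : x2 - x1 != 0 by rewrite subr_eq0 eq_sym.
have x12' : x1 - x2 != 0 by rewrite subr_eq0.
congr (Some (_, _)); by field; rewrite ?x21 ?x12'.
Qed.

Lemma tadd_neg p q : tadd (ecneg p) (ecneg q) = ecneg (tadd p q).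
Proof.
case: p q => [[x1 y1]|] [[x2 y2]|] //=.
case: eqVneq => [e|x12].
  rewrite -opprD oppr_eq0; case: eqVneq => //= y12.
  by rewrite mulrN invrN; congr (Some (_, _)); ring.
by congr (Some (_, _)); rewrite -opprD mulNr; ring.
Qed.

Lemma curve_b x y : D * y ^+ 2 = cubic a b x -> b = D * y ^+ 2 - x ^+ 3 - a * x.
Proof. by move=> ->; rewrite /cubic; ring. Qed.

(** Together with [curve_b] this eliminates both coefficients, so that claims about two points
    become identities of rational functions within reach of [field]. *)
Lemma curve_a x1 y1 x2 y2 : x1 != x2 ->
  D * y1 ^+ 2 = cubic a b x1 -> D * y2 ^+ 2 = cubic a b x2 ->
  a = (D * (y2 ^+ 2 - y1 ^+ 2) - (x2 ^+ 3 - x1 ^+ 3)) / (x2 - x1).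
Proof.
move=> x12 h1 h2; have x21 : x2 - x1 != 0 by rewrite subr_eq0 eq_sym.
rewrite mulrBr h1 h2 /cubic; by field.
Qed.

Lemma tadd_on p q : ton p -> ton q -> ton (tadd p q).
Proof.
case: p q => [[x1 y1]|] [[x2 y2]|] //= h1 h2.
case: eqVneq => [e|x12].
  case: eqVneq => //= y12; rewrite -e in h2; have e2 := same_x h1 h2 y12.
  rewrite e2 in y12.
  have y10 : y1 != 0 by apply: contraNneq y12 => ->; rewrite addr0.
  rewrite /cubic (curve_b h1); field.
  by rewrite y10 D0.
have x21 : x2 - x1 != 0 by rewrite subr_eq0 eq_sym.
rewrite /= /cubic (curve_b h1) (curve_a x12 h1 h2).
by field.
Qed.

Lemma tneg_on p : ton p -> ton (ecneg p).
Proof. by case: p => [[x y]|] //=; rewrite sqrrN. Qed.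

(* The only instance of associativity of the group law that is needed. *)
Lemma tadd_cancel p q t : ton p -> ton q -> tadd (ecneg p) q = t ->
  (if t is Some (_, y) then y = 0 else True) -> q = tadd p t.
Proof.
case: t => [[e y]|] hp hq.
  move=> + y0; rewrite {}y0 {y}; case: p hp => [[x1 y1]|] /= h1; last by [].
  case: q hq => [[x2 y2]|] /= h2; last first.
    by case=> -> /eqP; rewrite oppr_eq0 => /eqP->; rewrite eqxx addr0 eqxx.
  case: eqVneq => [e12|x12].
    case: eqVneq => // y12; rewrite -e12 in h2 *.
    have e2 : y2 = - y1 by apply: (same_x _ h2 y12); rewrite sqrrN.
    have y10 : y1 != 0.
      apply: contraNneq y12 => y10.
      by rewrite e2 y10 oppr0 addr0.
    set m := _ / _; case=> ex; rewrite ex opprK => ey.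
    have x1e : x1 != e.
      apply: contraNneq y10 => x1e; move: ey; rewrite x1e subrr mulr0.
      by rewrite add0r => ->.
    rewrite (negPf x1e); have ex1 : e - x1 != 0 by rewrite subr_eq0 eq_sym.
    have em : (0 - y1) / (e - x1) = - m.
      apply: (mulIf ex1); rewrite divfK // sub0r.
      have -> : y1 = - (m * (x1 - e)) by apply/eqP; rewrite -addr_eq0 addrC ey.
      ring.
    rewrite em e2; congr (Some (_, _)); rewrite -ex /=; ring.
  set m := _ / _; case=> ex; rewrite ex opprK => ey.
  have x21 : x2 - x1 != 0 by rewrite subr_eq0 eq_sym.
  have mE : m * (x2 - x1) = y2 + y1 by rewrite /m divfK // opprK.
  have x1e : x1 != e.
    apply/eqP => x1e.
    have y10 : y1 = 0 by move: ey; rewrite x1e subrr mulr0 add0r.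
    have fx1 : cubic a b x1 = 0 by rewrite -h1 y10 expr0n mulr0.
    have /eqP := cubic_root_simple disc0 fx1; apply.
    apply: (mulIf x21); rewrite mul0r.
    have e1 : D * y2 ^+ 2 = (x1 + x1 + x2) * (x2 - x1) ^+ 2.
      rewrite {1}x1e -{1}ex -[in LHS](addr0 y2) -y10 -mE; ring.
    apply/eqP; rewrite -oppr_eq0; apply/eqP.
    transitivity ((x1 + x1 + x2) * (x2 - x1) ^+ 2 - (cubic a b x2 - cubic a b x1)).
      by rewrite /cubic; ring.
    by rewrite fx1 subr0 -h2 e1 subrr.
  rewrite (negPf x1e); have ex1 : e - x1 != 0 by rewrite subr_eq0 eq_sym.
  have em : (0 - y1) / (e - x1) = - m.
    apply: (mulIf ex1); rewrite divfK // sub0r.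
    have -> : y1 = - (m * (x1 - e)) by apply/eqP; rewrite -addr_eq0 addrC ey.
    ring.
  have x3 : D * (- m) ^+ 2 - x1 - e = x2 by rewrite -ex; ring.
  rewrite em x3; congr (Some (_, _)).
  have -> : - m * (x1 - x2) - y1 = m * (x2 - x1) - y1 by ring.
  by rewrite mE addrK.
move=> + _; case: p hp => [[x1 y1]|] /= h1; last by [].
case: q hq => [[x2 y2]|] //= h2.
by case: eqVneq => // <-; case: eqVneq => // /eqP; rewrite addrC subr_eq0 => /eqP->.
Qed.

Section Derivation.
Variable der : K -> K.
Hypotheses (derD : forall x y, der (x + y) = der x + der y).
Hypotheses (derM : forall x y, der (x * y) = der x * y + x * der y).
Hypotheses (da : der a = 0) (db : der b = 0).

Lemma der0 : der 0 = 0.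
Proof. by apply: (addrI (der 0)); rewrite -derD !addr0. Qed.
Lemma der1 : der 1 = 0.
Proof. by apply: (addrI (der 1)); rewrite addr0 -{3}[1]mulr1 derM mulr1 mul1r. Qed.
Lemma derN x : der (- x) = - der x.
Proof. by apply: (addrI (der x)); rewrite -derD !subrr der0. Qed.
Lemma derB x y : der (x - y) = der x - der y.
Proof. by rewrite derD derN. Qed.
Lemma der_nat n : der n%:R = 0.
Proof. by elim: n => [|n IH]; rewrite ?der0 // -natr1 derD IH der1 addr0. Qed.
Lemma derX2 x : der (x ^+ 2) = 2 * x * der x.
Proof. by rewrite expr2 derM; ring. Qed.
Lemma derX3 x : der (x ^+ 3) = 3 * x ^+ 2 * der x.
Proof. by rewrite exprS derM derX2; ring. Qed.
Lemma derV x : x != 0 -> der x^-1 = - der x / x ^+ 2.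
Proof.
move=> x0; apply: (mulfI x0).
have := derM x x^-1; rewrite divff // der1 => /esym/eqP.
by rewrite addrC addr_eq0 => /eqP->; field.
Qed.
Lemma der_div x y : y != 0 -> der (x / y) = (der x - x / y * der y) / y.
Proof. by move=> y0; rewrite derM derV //; field. Qed.

Lemma der_cubic x : der (cubic a b x) = (3 * x ^+ 2 + a) * der x.
Proof. by rewrite /cubic !derD derX3 derM da db; ring. Qed.

(* A division-free form of [l = lam p], which determines [l] even when [y = 0]:
   the second equation is the derivative of the curve equation divided by [y]. *)
Definition isl p l : Prop :=
  if p is Some (x, y) then
    der x = l * y /\ 2 * D * der y + der D * y = (3 * x ^+ 2 + a) * l
  else l = 0.

(** At [y = 0] the default [0^-1 = 0] gives the value 0. It is the right one: [x] is then a simple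
    root of the cubic, and [isl] forces it. *)
Definition lam p : K := if p is Some (x, y) then der x / y else 0.

Lemma isl_lam p : ton p -> isl p (lam p).
Proof.
case: p => [[x y]|] //= h; have := congr1 der h.
rewrite der_cubic derM derX2 => dh.
have [y0|y0] := eqVneq y 0.
  move: dh; rewrite y0 der0 expr0n /= !(mulr0, mul0r, addr0) => /esym/eqP.
  have fx : cubic a b x = 0 by rewrite -h y0 expr0n mulr0.
  rewrite mulf_eq0 (negPf (cubic_root_simple disc0 fx)) /= => /eqP->.
  by rewrite invr0 !(mulr0, addr0).
split; first by rewrite divfK.
by apply: (mulIf y0); rewrite -[RHS]mulrA divfK // -dh; ring.
Qed.

Lemma isl_unique p l l' : ton p -> isl p l -> isl p l' -> l = l'.
Proof.
case: p => [[x y]|] /= h; last by move=> -> ->.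
move=> [e1 e2] [e1' e2']; have [y0|y0] := eqVneq y 0.
  have fx : cubic a b x = 0 by rewrite -h y0 expr0n mulr0.
  by apply: (mulfI (cubic_root_simple disc0 fx)); rewrite -e2.
by apply: (mulIf y0); rewrite -e1.
Qed.

Lemma isl_neg p l : isl p l -> isl (ecneg p) (- l).
Proof.
case: p => [[x y]|] /=; last by move=> ->; rewrite oppr0.
move=> [-> e2]; split; first by rewrite mulrNN.
by rewrite derN [RHS]mulrN -e2; ring.
Qed.

(** The conceptual reason is that the invariant differential is translation invariant, so its
    pullbacks add. The proof differentiates the chord and tangent formulas, the derivatives of the
    ordinates being eliminated by the second equation of [isl]. *)
Lemma isl_add p q l1 l2 : ton p -> ton q -> isl p l1 -> isl q l2 ->
  isl (tadd p q) (l1 + l2).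
Proof.
move=> hp hq i1 i2.
case: p q hp hq i1 i2 => [[x1 y1]|] [[x2 y2]|] //=; last 3 first.
- by move=> _ _ i1 ->; rewrite addr0.
- by move=> _ _ -> i2; rewrite add0r.
- by move=> _ _ -> ->; rewrite addr0.
move=> h1 h2 i1 i2.
case: eqVneq => [e12|x12].
  rewrite -e12 in h2 i2 *; case: eqVneq => [y12|y12].
    have ey : y2 = - y1 by apply/eqP; rewrite -addr_eq0 addrC y12.
    have := @isl_neg (Some (x1, y1)) l1 i1; rewrite /= -ey => i1'.
    by have -> := @isl_unique (Some (x1, y2)) l2 (- l1) h2 i2 i1'; rewrite subrr.
  have e2 := same_x h1 h2 y12; rewrite e2 in i2 y12.
  have y10 : y1 != 0 by apply: contraNneq y12 => ->; rewrite addr0.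
  have -> := @isl_unique (Some (x1, y1)) l2 l1 h1 i2 i1.
  case: i1 => dx dy.
  have D2 : 2 * D * y1 != 0 by rewrite !mulf_neq0.
  have dy' : der y1 = ((3 * x1 ^+ 2 + a) * l1 - der D * y1) / (2 * D).
    rewrite -dy; by field; rewrite ?D0 ?two0.
  have d3 : der 3 = 0 by exact: der_nat.
  have d2 : der 2 = 0 by exact: der_nat.
  set m := _ / _; set x3 := _ - _.
  have dm : der m = (6 * x1 * (l1 * y1) - m * (2 * der D * y1 + 2 * D * der y1)) / (2 * D * y1).
    rewrite /m der_div // derD (derM 3) derX2 d3 da dx; congr (_ / _).
    by rewrite (derM (2 * D)) (derM 2) d2; ring.
  have dx3 : der x3 = der D * m ^+ 2 + D * (2 * m * der m) - 2 * (l1 * y1).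
    by rewrite /x3 derB (derM D) derX2 (derM 2) d2 dx; ring.
  have dy3 : der (m * (x1 - x3) - y1) = der m * (x1 - x3) + m * (l1 * y1 - der x3) - der y1.
    by rewrite derB (derM m) derB dx.
  split; [rewrite dx3 | rewrite dy3 dx3]; rewrite dm dy' /x3 /m;
    by field; rewrite ?y10 ?D0 ?two0.
case: i1 i2 => dx1 dy1 [dx2 dy2].
have x21 : x2 - x1 != 0 by rewrite subr_eq0 eq_sym.
have dy1' : der y1 = ((3 * x1 ^+ 2 + a) * l1 - der D * y1) / (2 * D).
  rewrite -dy1; by field; rewrite ?D0 ?two0.
have dy2' : der y2 = ((3 * x2 ^+ 2 + a) * l2 - der D * y2) / (2 * D).
  rewrite -dy2; by field; rewrite ?D0 ?two0.
set m := _ / _; set x3 := _ - x2.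
have dm : der m = (der y2 - der y1 - m * (l2 * y2 - l1 * y1)) / (x2 - x1).
  by rewrite /m der_div // !derB dx1 dx2.
have dx3 : der x3 = der D * m ^+ 2 + D * (2 * m * der m) - l1 * y1 - l2 * y2.
  by rewrite /x3 !derB (derM D) derX2 dx1 dx2; ring.
have dy3 : der (m * (x1 - x3) - y1) = der m * (x1 - x3) + m * (l1 * y1 - der x3) - der y1.
  by rewrite derB (derM m) derB dx1.
split; [rewrite dx3 | rewrite dy3 dx3]; rewrite dm dy1' dy2' /x3 /m (curve_a x12 h1 h2);
  by field; rewrite ?x21 ?D0 ?two0.
Qed.

Lemma lamD p q : ton p -> ton q -> lam (tadd p q) = lam p + lam q.
Proof.
move=> hp hq; apply: (isl_unique (tadd_on hp hq)).
  exact: isl_lam (tadd_on hp hq).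
by apply: isl_add => //; exact: isl_lam.
Qed.

Lemma lamN p : lam (ecneg p) = - lam p.
Proof. by case: p => [[x y]|] /=; rewrite ?oppr0 // invrN mulrN. Qed.

End Derivation.

End TwistedCurve.

(** * The derivation and the substitutions of Q(u) *)

Local Notation tf := (@FracField.tofrac {poly rat} : {poly rat} -> Qu).

Section FractionField.
Implicit Types (x y : Qu) (n d A B P : {poly rat}).

Lemma tf_eq0 P : (tf P == 0) = (P == 0).
Proof. exact: tofrac_eq0. Qed.

Lemma tf_inj : injective tf.
Proof. by move=> P Q /eqP; rewrite tofrac_eq => /eqP. Qed.

Lemma frac_numden x : tf \n_(repr x) / tf \d_(repr x) = x.
Proof.
pose n := \n_(repr x); pose d := \d_(repr x).
have d0 : d != 0 by exact: denom_ratioP.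
rewrite -[RHS]reprK -/n -/d; unlock FracField.tofrac.
rewrite -[X in _ * X = _]FracField.pi_inv -[LHS]FracField.pi_mul; congr (\pi _)%qT.
rewrite /FracField.mulf /FracField.invf !numden_Ratio ?oner_neq0 // mulr1 mul1r.
by rewrite FracField.Ratio_numden.
Qed.

Lemma frac_repr x : exists n d, d != 0 /\ x = tf n / tf d.
Proof. by exists \n_(repr x), \d_(repr x); rewrite frac_numden denom_ratioP. Qed.

Lemma frac_repr_coprime x : exists A B, [/\ coprimep A B, B != 0 & x = tf A / tf B].
Proof.
have [n [d [d0 ->]]] := frac_repr x.
set g := gcdp n d; have g0 : g != 0 by rewrite gcdp_eq0 negb_and d0 orbT.
have /dvdpP[A eA] : g %| n by apply: dvdp_gcdl.
have /dvdpP[B eB] : g %| d by apply: dvdp_gcdr.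
exists A, B; split.
- have -> : A = n %/ g by rewrite eA mulpK.
  have -> : B = d %/ g by rewrite eB mulpK.
  by rewrite coprimep_div_gcd // d0 orbT.
- by apply: contraNneq d0 => B0; rewrite eB B0 mul0r.
by rewrite eA eB !tofracM -mulf_div divff ?mulr1 // tf_eq0.
Qed.

Lemma frac_eq n d A B : d != 0 -> B != 0 ->
  (tf n / tf d = tf A / tf B) <-> n * B = A * d.
Proof.
move=> d0 B0; split=> [/eqP|e].
  by rewrite eqr_div ?tf_eq0 // -!tofracM => /eqP/tf_inj.
by apply/eqP; rewrite eqr_div ?tf_eq0 // -!tofracM e.
Qed.

Definition derQ x : Qu :=
  let n := \n_(repr x) in let d := \d_(repr x) in
  tf (wronskian n d) / tf (d ^+ 2).

Lemma derQ_frac n d : d != 0 -> derQ (tf n / tf d) = tf (wronskian n d) / tf (d ^+ 2).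
Proof.
move=> d0; rewrite /derQ; set x := tf n / tf d.
set A := \n_(repr x); set B := \d_(repr x).
have B0 : B != 0 by exact: denom_ratioP.
have ex : tf A / tf B = tf n / tf d := frac_numden x.
have /frac_eq e := ex; have {}e := e B0 d0.
apply/frac_eq; rewrite ?expf_neq0 //.
have de := congr1 (fun P => P^`()) e; rewrite !derivM in de.
apply/eqP; rewrite -subr_eq0; apply/eqP; rewrite /wronskian.
transitivity (d * B * ((A^`() * d + A * d^`()) - (n^`() * B + n * B^`()))
  - (d * B^`() + d^`() * B) * (A * d - n * B)); first by ring.
by rewrite de e !subrr !mulr0 subrr.
Qed.

Lemma derQ_tf P : derQ (tf P) = tf P^`().
Proof.
have := @derQ_frac P 1 (oner_neq0 _).
by rewrite tofrac1 divr1 => ->; rewrite expr1n tofrac1 divr1 /wronskian derivC mulr1 mulr0 subr0.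
Qed.

Lemma derQD x y : derQ (x + y) = derQ x + derQ y.
Proof.
have [n [d [d0 ->]]] := frac_repr x; have [A [B [B0 ->]]] := frac_repr y.
have td0 : tf d != 0 by rewrite tf_eq0.
have tB0 : tf B != 0 by rewrite tf_eq0.
rewrite addf_div // -!tofracM -tofracD !derQ_frac ?mulf_neq0 //.
rewrite addf_div ?tf_eq0 ?expf_neq0 // -!tofracM -tofracD.
apply/frac_eq; rewrite ?mulf_neq0 ?expf_neq0 ?mulf_neq0 //.
by rewrite /wronskian !(derivD, derivM); ring.
Qed.

Lemma derQM x y : derQ (x * y) = derQ x * y + x * derQ y.
Proof.
have [n [d [d0 ->]]] := frac_repr x; have [A [B [B0 ->]]] := frac_repr y.
rewrite mulf_div -!tofracM !derQ_frac ?mulf_neq0 // !mulf_div -!tofracM.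
rewrite addf_div ?tf_eq0 ?mulf_neq0 ?expf_neq0 // -!tofracM -tofracD.
apply/frac_eq; rewrite ?mulf_neq0 ?expf_neq0 ?mulf_neq0 //.
by rewrite /wronskian !(derivD, derivM); ring.
Qed.

Definition cst (c : rat) : Qu := tf c%:P.

Lemma derQ_cst c : derQ (cst c) = 0.
Proof. by rewrite /cst derQ_tf derivC tofrac0. Qed.

Lemma derQ_u : derQ uQ = 1.
Proof. by rewrite /uQ derQ_tf derivX tofrac1. Qed.

Lemma cst_int (z : int) : cst z%:~R = z%:~R.
Proof. by rewrite /cst !rmorph_int. Qed.

Lemma derQ_eq0 x : derQ x = 0 -> exists c, x = cst c.
Proof.
have [A [B [cAB B0 ->]]] := frac_repr_coprime x.
rewrite derQ_frac // => /eqP; rewrite mulf_eq0 invr_eq0 !tf_eq0 expf_eq0 (negPf B0) andbF orbF.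
rewrite subr_eq0 => /eqP J0.
have B'0 : B^`() = 0.
  have cBA : coprimep B A by rewrite coprimep_sym.
  apply/eqP; have : B %| B^`() by rewrite -(Gauss_dvdpr _ cBA) -J0 dvdp_mull.
  apply: contraTT => dB0; apply/negP => /(dvdp_leq dB0).
  by rewrite leqNgt lt_size_deriv.
have c0 P : P^`() = 0 -> exists c, P = c%:P.
  move=> dP; exists P`_0; apply/size1_polyC/leq_sizeP => -[//|i] _.
  have := coef_deriv P i; rewrite dP coef0 => /esym/eqP.
  by rewrite mulrn_eq0 => /orP[//|/eqP].
have A'0 : A^`() = 0.
  by move/eqP: J0; rewrite B'0 mulr0 mulf_eq0 (negPf B0) orbF => /eqP.
have [c ->] := c0 _ A'0; have [d ed] := c0 _ B'0.
have d0 : d != 0 by rewrite -polyC_eq0 -ed.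
exists (c / d); rewrite ed /cst; apply: (mulIf (_ : tf d%:P != 0)); first by rewrite tf_eq0 polyC_eq0.
by rewrite divfK ?tf_eq0 ?polyC_eq0 // -tofracM -rmorphM /= divfK.
Qed.

End FractionField.

Section FieldIdentities.
Variable K : fieldType.

Lemma chain_identity (n d n' d' t : K) : d != 0 ->
  (n' * t - n / d * (d' * t)) / d = (n' * d - n * d') / (d * d) * t.
Proof. by move=> d0; field. Qed.

Lemma quad_mul (w P Q P' Q' : K) :
  (P + w * Q) * (P' + w * Q') = P * P' + w ^+ 2 * (Q * Q') + w * (P * Q' + Q * P').
Proof. ring. Qed.

Lemma quad_norm (w P Q : K) :
  (P + w * Q) * (P - w * Q) = P ^+ 2 - w ^+ 2 * Q ^+ 2.
Proof. ring. Qed.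

Lemma quad_diff (w P Q : K) : P + - w * Q - (P + w * Q) = - (2 * w * Q).
Proof. ring. Qed.

Lemma mulrNN_inv (x w : K) : - x / - w = x / w.
Proof. by rewrite invrN mulrNN. Qed.

End FieldIdentities.

Lemma pnatr_eq0_Qu n : (n%:R == 0 :> Qu) = (n == 0%N).
Proof. by rewrite -(rmorph_nat (@FracField.tofrac {poly rat})) tofrac_eq0 -polyC_natr polyC_eq0 pnatr_eq0. Qed.

Section Substitution.
Variables (theta : Qu) (dtheta : derQ theta != 0).
Implicit Types (x y : Qu) (P Q n d : {poly rat}).

Definition evalQ P : Qu := (map_poly cst P).[theta].

Lemma cst_is_zmod : zmod_morphism cst.
Proof. by move=> x y; rewrite /cst rmorphB tofracB. Qed.
Lemma cst_is_monoid : monoid_morphism cst.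
Proof. by split=> [|x y]; rewrite /cst ?tofrac1 // rmorphM tofracM. Qed.

End Substitution.
HB.instance Definition _ := GRing.isZmodMorphism.Build rat Qu cst cst_is_zmod.
HB.instance Definition _ := GRing.isMonoidMorphism.Build rat Qu cst cst_is_monoid.

Section Substitution.
Variables (theta : Qu) (dtheta : derQ theta != 0).
Implicit Types (x y : Qu) (P Q n d : {poly rat}).

Lemma evalQD P Q : evalQ theta (P + Q) = evalQ theta P + evalQ theta Q.
Proof. by rewrite /evalQ rmorphD hornerD. Qed.
Lemma evalQB P Q : evalQ theta (P - Q) = evalQ theta P - evalQ theta Q.
Proof. by rewrite /evalQ rmorphB hornerD hornerN. Qed.
Lemma evalQM P Q : evalQ theta (P * Q) = evalQ theta P * evalQ theta Q.
Proof. by rewrite /evalQ rmorphM hornerM. Qed.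
Lemma evalQC c : evalQ theta c%:P = cst c.
Proof. by rewrite /evalQ map_polyC hornerC. Qed.
Lemma evalQX : evalQ theta 'X = theta.
Proof. by rewrite /evalQ map_polyX hornerX. Qed.

Lemma derQ_eval P : derQ (evalQ theta P) = evalQ theta P^`() * derQ theta.
Proof.
elim/poly_ind: P => [|P c IH].
  by rewrite deriv0 /evalQ rmorph0 horner0 mul0r -(rmorph0 cst) derQ_cst.
rewrite evalQD evalQM evalQX evalQC derQD derQ_cst addr0 derQM IH.
rewrite derivD derivM derivX derivC addr0 mulr1 evalQD evalQM evalQX.
by ring.
Qed.

(* In characteristic 0, differentiating an algebraic relation of minimal
   degree shows that an element with nonzero derivative is transcendental. *)
Lemma evalQ_eq0 P : (evalQ theta P == 0) = (P == 0).
Proof.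
apply/idP/idP => [|/eqP->]; last by rewrite -[0]/(0%:P) evalQC rmorph0.
have [n] := ubnP (size P); elim: n P => // n IH P ltn /eqP e0.
have [//|P0] := eqVneq P 0.
have /eqP dP : P^`() == 0.
  apply: IH; first exact: leq_trans (lt_size_deriv P0) _.
  have := derQ_eval P; rewrite e0 -(rmorph0 cst) derQ_cst => /esym/eqP.
  by rewrite mulf_eq0 (negPf dtheta) orbF rmorph0.
have eP : P = (P`_0)%:P.
  apply/size1_polyC/leq_sizeP => -[//|i] _.
  have := coef_deriv P i; rewrite dP coef0 => /esym/eqP.
  by rewrite mulrn_eq0 => /orP[//|/eqP].
by move: e0 P0; rewrite eP evalQC => /eqP; rewrite fmorph_eq0 polyC_eq0 => ->.
Qed.

(** The definition carries the proof that [theta] is not constant, so that the structure of field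
    morphism can be attached to [substQ dtheta]. *)
Definition substQ of derQ theta != 0 := fun x : Qu =>
  evalQ theta \n_(repr x) / evalQ theta \d_(repr x).

Lemma substQ_frac n d : d != 0 ->
  substQ dtheta (tf n / tf d) = evalQ theta n / evalQ theta d.
Proof.
move=> d0; rewrite /substQ; set x := tf n / tf d.
set A := \n_(repr x); set B := \d_(repr x).
have B0 : B != 0 by exact: denom_ratioP.
have ex : tf A / tf B = tf n / tf d := frac_numden x.
have /frac_eq e := ex; have {}e := e B0 d0.
by apply/eqP; rewrite eqr_div ?evalQ_eq0 // -!evalQM e.
Qed.

Lemma substQ_tf P : substQ dtheta (tf P) = evalQ theta P.
Proof.
have := @substQ_frac P 1 (oner_neq0 _); rewrite tofrac1 divr1 => ->.
by rewrite -[1]/(1%:P) evalQC rmorph1 divr1.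
Qed.

Lemma substQ_is_zmod : zmod_morphism (substQ dtheta).
Proof.
move=> x y.
have [n [d [d0 ->]]] := frac_repr x; have [A [B [B0 ->]]] := frac_repr y.
rewrite -mulNr addf_div ?tf_eq0 // -tofracN -!tofracM -tofracD !substQ_frac ?mulf_neq0 //.
rewrite -[in RHS]mulNr addf_div ?evalQ_eq0 // !evalQM mulNr evalQB !evalQM mulNr.
by [].
Qed.

Lemma substQ_is_monoid : monoid_morphism (substQ dtheta).
Proof.
split=> [|x y]; first by rewrite -tofrac1 substQ_tf -[1]/(1%:P) evalQC rmorph1.
have [n [d [d0 ->]]] := frac_repr x; have [A [B [B0 ->]]] := frac_repr y.
by rewrite mulf_div -!tofracM !substQ_frac ?mulf_neq0 // !evalQM mulf_div.
Qed.

HB.instance Definition _ := GRing.isZmodMorphism.Build Qu Qu (substQ dtheta) substQ_is_zmod.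
HB.instance Definition _ := GRing.isMonoidMorphism.Build Qu Qu (substQ dtheta) substQ_is_monoid.

Lemma substQ_u : substQ dtheta uQ = theta.
Proof. by rewrite /uQ substQ_tf evalQX. Qed.

Lemma substQ_cst c : substQ dtheta (cst c) = cst c.
Proof. by rewrite /cst substQ_tf evalQC. Qed.

Lemma derQ_subst x : derQ (substQ dtheta x) = substQ dtheta (derQ x) * derQ theta.
Proof.
have [n [d [d0 ->]]] := frac_repr x.
have e0 : evalQ theta d != 0 by rewrite evalQ_eq0.
rewrite derQ_frac // !substQ_frac ?expf_neq0 //.
rewrite (der_div derQM _ e0) !derQ_eval /wronskian evalQB expr2 !evalQM.
exact: chain_identity.
Qed.

End Substitution.

Section PointMap.
Variables (K : fieldType) (f : {rmorphism K -> K}).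

Definition mappt (p : ecpoint K) : ecpoint K :=
  if p is Some (x, y) then Some (f x, f y) else None.

Lemma mappt_neg p : mappt (ecneg p) = ecneg (mappt p).
Proof. by case: p => [[x y]|] //=; rewrite rmorphN. Qed.

Lemma mappt_tadd a D p q :
  mappt (tadd a D p q) = tadd (f a) (f D) (mappt p) (mappt q).
Proof.
case: p q => [[x1 y1]|] [[x2 y2]|] //=.
rewrite (inj_eq (fmorph_inj f)) -rmorphD fmorph_eq0.
have X2 x y z : f (x * y ^+ 2 - z) = f x * f y ^+ 2 - f z.
  by rewrite rmorphB (rmorphM f x) rmorphXn.
case: eqP => _; first case: eqP => //= _.
  set m := (_ / _ : K); set m' := (_ / _ : K).
  have em : f m = m'.
    rewrite /m fmorph_div rmorphD (rmorphM f 3) rmorphXn (rmorphM f (2 * D)).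
    by rewrite (rmorphM f 2) !rmorph_nat.
  have ex : f (D * m ^+ 2 - 2 * x1) = f D * m' ^+ 2 - 2 * f x1.
    by rewrite X2 em (rmorphM f 2) rmorph_nat.
  congr (Some (_, _)); first exact: ex.
  by rewrite rmorphB (rmorphM f m) rmorphB ex em.
rewrite /=; set m := (_ / _ : K); set m' := (_ / _ : K).
have em : f m = m' by rewrite /m fmorph_div !rmorphB.
have ex : f (D * m ^+ 2 - x1 - x2) = f D * m' ^+ 2 - f x1 - f x2.
  by rewrite rmorphB X2 em.
congr (Some (_, _)); first exact: ex.
by rewrite rmorphB (rmorphM f m) rmorphB ex em.
Qed.

Lemma mappt_ton a b D p : ton a b D p -> ton (f a) (f b) (f D) (mappt p).
Proof.
case: p => [[x y]|] //= /(congr1 f); rewrite rmorphM rmorphXn => ->.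
by rewrite /cubic !rmorphD rmorphM rmorphXn.
Qed.

End PointMap.

(** * Descent along a quadratic extension of rational function fields *)

Section QuadraticDescent.
Variables (theta : Qu) (dtheta : derQ theta != 0) (f : {rmorphism Qu -> Qu}) (w kappa : Qu).
Local Notation psi := (substQ dtheta).
Hypotheses (f_cst : forall c, f (cst c) = cst c) (f_theta : f theta = theta).
Hypotheses (w0 : w != 0) (fw : f w = - w) (w2 : w ^+ 2 = psi kappa).
Hypothesis u_span : exists P Q, uQ = psi P + w * psi Q.

Lemma f_psi x : f (psi x) = psi x.
Proof.
have fev P : f (evalQ theta P) = evalQ theta P.
  elim/poly_ind: P => [|P c IH]; first by rewrite -[0]/(0%:P) evalQC f_cst.
  by rewrite evalQD evalQM evalQX evalQC rmorphD rmorphM IH f_theta f_cst.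
have [n [d [d0 ->]]] := frac_repr x.
by rewrite substQ_frac // fmorph_div !fev.
Qed.

(** The set of such elements contains the constants and [u] and is closed under the field
    operations; for inverses, [y] times its conjugate [f y] is a norm, hence in the image of
    [psi]. *)
Lemma quad_span x : exists P Q, x = psi P + w * psi Q.
Proof.
pose S x := exists P Q, x = psi P + w * psi Q.
have Spsi P : S (psi P) by exists P, 0; rewrite rmorph0 mulr0 addr0.
have SD y z : S y -> S z -> S (y + z).
  move=> [P [Q ->]] [P' [Q' ->]]; exists (P + P'), (Q + Q').
  by rewrite !rmorphD mulrDr addrACA.
have SM y z : S y -> S z -> S (y * z).
  move=> [P [Q ->]] [P' [Q' ->]]; exists (P * P' + kappa * (Q * Q')), (P * Q' + Q * P').
  rewrite quad_mul w2 -!(rmorphM psi) -!(rmorphD psi).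
  by [].
have SV y : y != 0 -> S y -> S y^-1.
  move=> y0 [P [Q ey]].
  have fy : f y = psi P - w * psi Q by rewrite ey rmorphD rmorphM fw !f_psi mulNr.
  have fy0 : f y != 0 by rewrite fmorph_eq0.
  have nE : y * f y = psi (P ^+ 2 - kappa * Q ^+ 2).
    by rewrite fy ey quad_norm w2 -!(rmorphXn psi) -(rmorphM psi) -(rmorphB psi).
  have -> : y^-1 = psi (P ^+ 2 - kappa * Q ^+ 2)^-1 * f y.
    by rewrite (fmorphV psi) /= -nE invfM -mulrA mulVf ?mulr1.
  apply: SM => //; rewrite fy -mulrN -rmorphN; exists P, (- Q).
  by [].
have Stf P : S (tf P).
  elim/poly_ind: P => [|P c IH]; first by rewrite tofrac0 -(rmorph0 psi); exact: (Spsi _).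
  rewrite tofracD tofracM -/uQ; apply: (SD _ _); first by apply: (SM _ _ IH); exact: u_span.
  by rewrite -/(cst c) -(substQ_cst dtheta); exact: (Spsi _).
have [n [d [d0 ->]]] := frac_repr x.
apply: (SM _ _ (Stf n)); apply: (SV _ _ (Stf d)); by rewrite tf_eq0.
Qed.

Lemma fixed_descends x : f x = x -> exists P, x = psi P.
Proof.
have [P [Q ->]] := quad_span x; rewrite rmorphD rmorphM fw !f_psi => e.
exists P; have : (2 * w) * psi Q = 0.
  by move/eqP: e; rewrite -subr_eq0 quad_diff oppr_eq0 => /eqP.
move/eqP; rewrite mulf_eq0 => /orP[|/eqP->]; last by rewrite mulr0 addr0.
by rewrite mulf_eq0 pnatr_eq0_Qu (negPf w0).
Qed.

Lemma antifixed_descends x : f x = - x -> exists Q, x = w * psi Q.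
Proof.
move=> fx; have [|P eP] := @fixed_descends (x / w).
  by rewrite fmorph_div fx fw mulrNN_inv.
by exists P; rewrite -eP mulrC divfK.
Qed.

End QuadraticDescent.

Section FieldIdentities.
Variable K : fieldType.

Lemma point_clear_left (D n d B : K) : d != 0 ->
  D * (n / d) ^+ 2 * (B ^+ 4 * d ^+ 2) = D * (n * B ^+ 2) ^+ 2.
Proof. by move=> d0; field. Qed.

Lemma point_clear_right (a b A B d : K) : B != 0 ->
  cubic a b (A / B) * (B ^+ 4 * d ^+ 2) =
  (A ^+ 3 * B + a * A * B ^+ 3 + b * B ^+ 4) * d ^+ 2.
Proof. by move=> B0; rewrite /cubic; field. Qed.

Lemma tau_identity (v : K) : v + 1 != 0 ->
  (- 1 - - v / (v + 1) * 1) / (v + 1) = - (v + 1) ^- 2.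
Proof. by move=> v0; field. Qed.

Lemma tau_z_identity (v : K) : v + 1 != 0 -> - v / (v + 1) + 1 = (v + 1)^-1.
Proof. by move=> v0; field. Qed.

Lemma tau_invol_identity (v : K) : v + 1 != 0 ->
  - (- v / (v + 1)) / (- v / (v + 1) + 1) = v.
Proof. by move=> v0; rewrite tau_z_identity // invrK !mulNr opprK divfK. Qed.

Lemma theta_identity (z : K) : z != 0 ->
  1 + - 1 / z ^+ 2 - 0 = (z ^+ 2 - 1) / z ^+ 2.
Proof. by move=> z0; field. Qed.

Lemma subr_sqr_1 (z : K) : z ^+ 2 - 1 = (z - 1) * (z + 1).
Proof. ring. Qed.

Lemma psi_s_identity (a b s : K) : a != 0 -> b != 0 ->
  1 - a / b * (- (b / a) * (s - 1)) = s.
Proof. by move=> a0 b0; field; rewrite a0 b0. Qed.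

Lemma w_sqr_identity (z : K) : z != 0 -> (z - z^-1) ^+ 2 = (z + z^-1) ^+ 2 - 4.
Proof. by move=> z0; field. Qed.

Lemma kappa_identity (a b u : K) : b != 0 ->
  (1 - a / b * u) ^+ 2 - 4 = (a * u - 3 * b) * (a * u + b) / b ^+ 2.
Proof. by move=> b0; field. Qed.

Lemma twist_scale_identity (c p q y b : K) : b != 0 ->
  c * (p * q) * (y / b) ^+ 2 = c * (p * q / b ^+ 2 * y ^+ 2).
Proof. by move=> b0; field. Qed.

Lemma two_lam_identity (x y : K) : 2 * x = x + y + (x + - y).
Proof. ring. Qed.

Lemma G_identity (a b u : K) : a != 0 -> u + 1 != 0 ->
  - a * b * (u + 1) *
    (b ^+ 2 * (u ^+ 2 + u + 1) ^+ 3 + a ^+ 3 * u ^+ 2 * (u + 1) ^+ 2) =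
  cubic a b (- (b / a) * ((u + 1) + (u + 1)^-1 - 1)) * (a ^+ 2 * (u + 1) ^+ 2) ^+ 2.
Proof. by move=> a0 u0; rewrite /cubic; field; rewrite a0 u0. Qed.

Lemma half_identity (c t : K) : 2 != 0 :> K -> c * t = 2 * (c / 2 * t).
Proof. by move=> two0; field. Qed.

Lemma scale_div (s x y : K) : s != 0 -> x / y = s * (x / (s * y)).
Proof. by move=> s0; rewrite invfM mulrCA [s * _]mulrA mulfV // mul1r. Qed.

Lemma span_identity (z z' : K) : 2 != 0 :> K ->
  z - 1 = (z + z') / 2 - 1 + (z - z') * (1 / 2).
Proof. by move=> two0; field. Qed.

End FieldIdentities.

Lemma rmorph_Qu_ext (f g : {rmorphism Qu -> Qu}) :
  (forall c, f (cst c) = g (cst c)) -> f uQ = g uQ -> forall x, f x = g x.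
Proof.
move=> fc fu x.
have ftf P : f (tf P) = g (tf P).
  elim/poly_ind: P => [|P c IH]; first by rewrite tofrac0 !rmorph0.
  by rewrite tofracD tofracM -/uQ -/(cst c) !rmorphD !rmorphM IH fu fc.
by have [n [d [d0 ->]]] := frac_repr x; rewrite !fmorph_div !ftf.
Qed.

Lemma cubic_disc_cst (a b : rat) : cubic_disc (cst a) (cst b) = cst (cubic_disc a b).
Proof.
by rewrite /cubic_disc rmorphD (rmorphM cst 4) (rmorphM cst 27) !rmorphXn !rmorph_nat.
Qed.

Section PolynomialPoints.
Variables (a b : rat) (D : {poly rat}).
Hypothesis sfD : coprimep D D^`().

(** Once [x = A/B] is in lowest terms, squarefreeness of [D] forces the denominator of [y] to divide
    [B^2]. *)
Lemma point_poly x y : ton (cst a) (cst b) (tf D) (Some (x, y)) ->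
  exists A B W, [/\ coprimep A B, B != 0, x = tf A / tf B, y = tf W / tf (B ^+ 2) &
    quartic a b A B = D * W ^+ 2].
Proof.
have [A [B [cAB B0 ->]]] := frac_repr_coprime x.
have [n [d [d0 ->]]] := frac_repr y.
have tB0 : tf B != 0 by rewrite tf_eq0.
have td0 : tf d != 0 by rewrite tf_eq0.
rewrite /= => e.
have e1 : D * (n * B ^+ 2) ^+ 2 = quartic a b A B * d ^+ 2.
  apply: tf_inj; have := congr1 (fun z => z * (tf B ^+ 4 * tf d ^+ 2)) e.
  rewrite /quartic /cst.
  have -> : tf D * (tf n / tf d) ^+ 2 * (tf B ^+ 4 * tf d ^+ 2) =
     tf D * (tf n * tf B ^+ 2) ^+ 2 by exact: point_clear_left.
  have -> : cubic (tf a%:P) (tf b%:P) (tf A / tf B) * (tf B ^+ 4 * tf d ^+ 2) =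
     (tf A ^+ 3 * tf B + tf a%:P * tf A * tf B ^+ 3 + tf b%:P * tf B ^+ 4) * tf d ^+ 2.
    exact: point_clear_right.
  by rewrite -!tofracXn -!tofracM -!tofracD -!tofracXn -!tofracM.
have /dvdpP[W eW] : d %| n * B ^+ 2.
  by apply: (squarefree_sqr_dvd sfD); rewrite e1 dvdp_mull.
exists A, B, W; split=> //.
  by apply/frac_eq; rewrite ?expf_neq0 // mulrC mulrC.
by apply: (mulIf (expf_neq0 2 d0)); rewrite -e1 eW; ring.
Qed.

Lemma lam_poly A B W : B != 0 -> W != 0 ->
  lam derQ (Some (tf A / tf B, tf W / tf (B ^+ 2))) = tf (wronskian A B) / tf W.
Proof.
move=> B0 W0; rewrite /= derQ_frac // invf_div mulf_div.
have B20 : tf (B ^+ 2) != 0 by rewrite tf_eq0 expf_neq0.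
by rewrite [tf (B ^+ 2) * _]mulrC -mulf_div divff ?mulr1.
Qed.

End PolynomialPoints.

Lemma tf_cubicX (a b : rat) : tf (cubicX a b) = cubic (cst a) (cst b) uQ.
Proof.
by rewrite /cubicX /cubic /cst /uQ -mul_polyC !tofracD (tofracM a%:P) tofracXn.
Qed.

Lemma tf_twistX (a b : rat) : tf (twistX a b) =
  cubic (cst a) (cst b) uQ *
    ((cst a * uQ - 3 * cst b) * (cst a * uQ + cst b)).
Proof.
rewrite /twistX tofracM tf_cubicX; congr (_ * _).
rewrite tofracM tofracB tofracD -!mul_polyC !tofracM /cst /uQ.
by rewrite rmorphM tofracM /= polyC_natr rmorph_nat.
Qed.

(** The curve [w^2 = f(X)] has genus 1, so its holomorphic differentials are the constant multiples
    of [dX/w]. *)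
Lemma lam_cubic_const (a b : rat) p : cubic_disc a b != 0 ->
  ton (cst a) (cst b) (tf (cubicX a b)) p -> exists c, lam derQ p = cst c.
Proof.
move=> disc0; case: p => [[x y]|] hp; last by exists 0; rewrite rmorph0.
have [A [B [W [cAB B0 -> -> eq]]]] := point_poly (cubicX_separable disc0) hp.
have [->|W0] := eqVneq W 0.
  by exists 0; rewrite /= tofrac0 mul0r invr0 mulr0 rmorph0.
have /dvdpP[L eL] := quartic_dvd_wronskian (isT : 2 != 0 :> rat) disc0 cAB eq.
have sL : (size L <= 1)%N.
  by apply: (size_wronskian_quotient disc0 eq W0 _ eL); rewrite size_cubicX.
exists L`_0; rewrite lam_poly // eL tofracM mulfK ?tf_eq0 //.
by rewrite {1}(size1_polyC sL).
Qed.

Definition no_twist_points (a b : rat) : Prop := forall A B W : {poly rat},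
  coprimep A B -> quartic a b A B = twistX a b * W ^+ 2 -> W = 0.

(** * The quotient by z -> 1/z *)

Section QuotientCurve.
Variables (a b : rat).
Hypotheses (a0 : a != 0) (b0 : b != 0) (disc0 : cubic_disc a b != 0).
Hypothesis ntp : no_twist_points a b.
Let aQ := cst a.
Let bQ := cst b.
Let aQ0 : aQ != 0. Proof. by rewrite fmorph_eq0. Qed.
Let bQ0 : bQ != 0. Proof. by rewrite fmorph_eq0. Qed.
Let two0 : 2 != 0 :> Qu. Proof. by rewrite pnatr_eq0_Qu. Qed.
Let discQ0 : cubic_disc aQ bQ != 0.
Proof. by rewrite cubic_disc_cst fmorph_eq0. Qed.

Lemma twist_point_y x y : ton aQ bQ (tf (twistX a b)) (Some (x, y)) -> y = 0.
Proof.
move=> hp.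
have [A [B [W [cAB B0 _ -> eq]]]] := point_poly (twistX_separable (isT : 2 != 0 :> rat) a0 b0 disc0) hp.
by rewrite (ntp cAB eq) tofrac0 mul0r.
Qed.

Lemma uQ_neq0 : uQ != 0. Proof. by rewrite tf_eq0 polyX_eq0. Qed.

Lemma uQX_neq0 n c : (0 < n)%N -> uQ ^+ n + cst c != 0.
Proof.
move=> n0; rewrite -tofracXn -tofracD tf_eq0 -[c]opprK rmorphN -size_poly_eq0.
by rewrite size_XnsubC.
Qed.

Lemma u1_neq0 : uQ + 1 != 0.
Proof. by have := @uQX_neq0 1 1 isT; rewrite rmorph1 expr1. Qed.

(** In this section [uQ] plays the part of [v], the square of the variable of the theorem; [phi]
    makes the substitution later. *)
Let z : Qu := uQ + 1.
Let zN0 : z != 0 := u1_neq0.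

Lemma derQ_tau : derQ (- uQ / (uQ + 1)) != 0.
Proof.
have h : derQ (uQ + 1) = 1 by rewrite derQD derQ_u -[1]/(1%:R) (der_nat derQD derQM) addr0.
rewrite (der_div derQM _ u1_neq0) h (derN derQD) derQ_u.
rewrite (_ : _ / _ = - (uQ + 1) ^- 2); last exact: tau_identity u1_neq0.
by rewrite oppr_eq0 invr_eq0 expf_neq0 // u1_neq0.
Qed.

Definition tau : {rmorphism Qu -> Qu} := substQ derQ_tau.

Lemma tau_u : tau uQ = - uQ / (uQ + 1). Proof. exact: substQ_u. Qed.

Lemma tau_z : tau z = z^-1.
Proof. rewrite /z rmorphD rmorph1 tau_u; exact: tau_z_identity u1_neq0. Qed.

Lemma tau_cst c : tau (cst c) = cst c. Proof. exact: substQ_cst. Qed.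

Lemma tauK x : tau (tau x) = x.
Proof.
apply: (@rmorph_Qu_ext (tau \o tau) idfun) => [c|] /=.
  by rewrite !tau_cst.
rewrite tau_u (fmorph_div tau) (rmorphN tau) (rmorphD tau) (rmorph1 tau) tau_u.
exact: tau_invol_identity u1_neq0.
Qed.

(** The abscissa of P as a function of [v]: [(v^2 + v + 1)/(v + 1)] is [z + 1/z - 1], visibly
    invariant under [tau]. *)
Definition theta1 : Qu := - (bQ / aQ) * (z + z^-1 - 1).

Lemma derQ_z : derQ z = 1.
Proof. by rewrite /z derQD derQ_u -[1]/(1%:R) (der_nat derQD derQM) addr0. Qed.

Lemma derQ_theta1 : derQ theta1 = - (bQ / aQ) * ((z ^+ 2 - 1) / z ^+ 2).
Proof.
have -> : theta1 = cst (- (b / a)) * (z + z^-1 - 1).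
  by rewrite /theta1 rmorphN fmorph_div.
rewrite derQM derQ_cst mul0r add0r rmorphN fmorph_div; congr (_ * _).
rewrite (derB derQD) derQD (derV derQM zN0) derQ_z -[1]/(1%:R) (der_nat derQD derQM).
exact: (theta_identity zN0).
Qed.

Lemma z_subr1 : z - 1 != 0.
Proof. by have -> : z - 1 = uQ by [exact: addrK]; exact: uQ_neq0. Qed.

Lemma z_addr1 : z + 1 != 0.
Proof.
have -> : z + 1 = uQ ^+ 1 + cst 2 by rewrite expr1 (rmorph_nat cst 2) mulr2n addrA.
exact: uQX_neq0.
Qed.

Lemma dtheta1 : derQ theta1 != 0.
Proof.
rewrite derQ_theta1; apply: mulf_neq0.
  by rewrite oppr_eq0; apply: (mulf_neq0 bQ0 (invr_neq0 aQ0)).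
apply: mulf_neq0; last exact: (invr_neq0 (expf_neq0 2 zN0)).
by rewrite subr_sqr_1; exact: (mulf_neq0 z_subr1 z_addr1).
Qed.

Local Notation psi := (substQ dtheta1).
(** The generator of the quadratic extension on which [tau] acts by -1; its square [(z + 1/z)^2 - 4]
    is where the extra factor of [twistX] comes from. *)
Definition w1 : Qu := z - z^-1.
Definition kappa1 : Qu := (1 - aQ / bQ * uQ) ^+ 2 - 4.

Lemma psi_s : psi (1 - aQ / bQ * uQ) = z + z^-1.
Proof.
rewrite (rmorphB psi) (rmorph1 psi) (rmorphM psi) (fmorph_div psi) /=.
rewrite (substQ_cst dtheta1 a) (substQ_cst dtheta1 b) (substQ_u dtheta1).
exact: (psi_s_identity _ aQ0 bQ0).
Qed.

Lemma tau_theta1 : tau theta1 = theta1.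
Proof.
rewrite /theta1 rmorphM rmorphN fmorph_div !tau_cst rmorphB rmorphD rmorph1.
by rewrite fmorphV tau_z invrK [z^-1 + _]addrC.
Qed.

Lemma tau_w1 : tau w1 = - w1.
Proof. by rewrite /w1 rmorphB fmorphV tau_z invrK opprB. Qed.

Lemma w1_sqr : w1 ^+ 2 = psi kappa1.
Proof.
rewrite /kappa1 (rmorphB psi) (rmorphXn psi) /= psi_s (rmorph_nat psi) /w1; exact: (w_sqr_identity zN0).
Qed.

Lemma w1_neq0 : w1 != 0.
Proof.
have h : w1 * z = (z - 1) * (z + 1).
  by rewrite /w1 mulrBl (mulVf zN0) -expr2 subr_sqr_1.
apply/eqP => w10; have /eqP := mulf_neq0 z_subr1 z_addr1; apply.
by rewrite -h w10 mul0r.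
Qed.

Lemma u_span1 : exists P Q, uQ = psi P + w1 * psi Q.
Proof.
exists ((1 - aQ / bQ * uQ) / 2 - 1), (1 / 2).
rewrite (rmorphB psi) (rmorph1 psi) !(fmorph_div psi) /= psi_s (rmorph1 psi) (rmorph_nat psi) /w1.
by rewrite -(span_identity z z^-1 two0) /z addrK.
Qed.

Definition D1 : Qu := cubic aQ bQ theta1.

Lemma psi_cubic x : psi (cubic aQ bQ x) = cubic aQ bQ (psi x).
Proof.
rewrite /cubic !(rmorphD psi) (rmorphM psi) (rmorphXn psi) /=.
by rewrite (substQ_cst dtheta1 a) (substQ_cst dtheta1 b).
Qed.

Lemma D1_psi : D1 = psi (tf (cubicX a b)).
Proof. by rewrite tf_cubicX psi_cubic substQ_u. Qed.

Lemma tau_cubic x : tau (cubic aQ bQ x) = cubic aQ bQ (tau x).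
Proof.
rewrite /cubic !(rmorphD tau) (rmorphM tau) (rmorphXn tau) /=.
by rewrite (tau_cst a) (tau_cst b).
Qed.

Lemma tau_D1 : tau D1 = D1.
Proof. by rewrite /D1 tau_cubic tau_theta1. Qed.

Lemma D1_neq0 : D1 != 0.
Proof.
rewrite D1_psi fmorph_eq0 tf_eq0 -size_poly_eq0 size_cubicX; exact: isT.
Qed.

Let tau_pt := mappt tau.

Lemma tau_ptK p : tau_pt (tau_pt p) = p.
Proof. by case: p => [[x y]|] //=; rewrite !tauK. Qed.

Lemma tau_pt_on p : ton aQ bQ D1 p -> ton aQ bQ D1 (tau_pt p).
Proof. by move/(mappt_ton tau); rewrite tau_D1 (tau_cst a) (tau_cst b). Qed.

Lemma tau_pt_add p q : tau_pt (tadd aQ D1 p q) = tadd aQ D1 (tau_pt p) (tau_pt q).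
Proof. by rewrite /tau_pt mappt_tadd tau_D1 (tau_cst a). Qed.

Lemma psi_inj : injective psi. Proof. exact: fmorph_inj. Qed.

(** An invariant point comes from the twist of E by [f(X)] over Q(X), where lambda is constant; the
    chain rule contributes the factor [derQ theta1]. *)
Lemma lam_fixed1 s : ton aQ bQ D1 s -> tau_pt s = s ->
  exists c, lam derQ s = cst c * derQ theta1.
Proof.
case: s => [[x y]|] hs /=; last by exists 0; rewrite rmorph0 mul0r.
case=> tx ty.
have [X eX] := fixed_descends tau_cst tau_theta1 w1_neq0 tau_w1 w1_sqr u_span1 tx.
have [Y eY] := fixed_descends tau_cst tau_theta1 w1_neq0 tau_w1 w1_sqr u_span1 ty.
have hS : ton aQ bQ (tf (cubicX a b)) (Some (X, Y)).
  apply: psi_inj; rewrite (rmorphM psi) (rmorphXn psi) /= -eY psi_cubic -eX -D1_psi.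
  exact: hs.
have [c ec] := lam_cubic_const disc0 hS.
exists c; rewrite eX eY derQ_subst mulrAC -(fmorph_div psi) /=.
by move: ec; rewrite /= => ->; rewrite substQ_cst.
Qed.

Lemma kappa1E : kappa1 = (aQ * uQ - 3 * bQ) * (aQ * uQ + bQ) / bQ ^+ 2.
Proof. exact: (kappa_identity _ _ bQ0). Qed.

(** Here [y] is [w1] times an invariant, so the point comes from the twist by [f kappa1], which is
    [twistX] up to the square [b^2]. That twist has only points with [y = 0]. *)
Lemma lam_antifixed1 s : ton aQ bQ D1 s -> tau_pt s = ecneg s -> lam derQ s = 0.
Proof.
case: s => [[x y]|] hs //=; case=> tx ty.
have [X eX] := fixed_descends tau_cst tau_theta1 w1_neq0 tau_w1 w1_sqr u_span1 tx.
have [Y eY] := antifixed_descends tau_cst tau_theta1 w1_neq0 tau_w1 w1_sqr u_span1 ty.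
have hS : ton aQ bQ (tf (twistX a b)) (Some (X, Y / bQ)).
  rewrite tf_twistX /=.
  have -> : cubic (cst a) (cst b) uQ * ((cst a * uQ - 3 * cst b) * (cst a * uQ + cst b)) *
      (Y / bQ) ^+ 2 = tf (cubicX a b) * (kappa1 * Y ^+ 2).
    by rewrite tf_cubicX kappa1E; exact: (twist_scale_identity _ _ _ _ bQ0).
  apply: psi_inj; rewrite (rmorphM psi) (rmorphM psi kappa1) /= -D1_psi -w1_sqr (rmorphXn psi) /= psi_cubic -eX.
  by rewrite -exprMn -eY.
have := twist_point_y hS => /eqP; rewrite mulf_eq0 => /orP[/eqP Y0|].
  by rewrite eY Y0 (rmorph0 psi) mulr0 invr0 mulr0.
by rewrite invr_eq0 (negPf bQ0).
Qed.

(** Twice lambda of [p] is the sum of its values at [p + tau p], which is invariant, and at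
    [p - tau p], which is anti-invariant. *)
Lemma lam_D1 p : ton aQ bQ D1 p -> exists c, lam derQ p = cst c * derQ theta1.
Proof.
move=> hp; have hq := tau_pt_on hp; have hnq := tneg_on hq.
have hs := tadd_on two0 D1_neq0 hp hq.
have ht := tadd_on two0 D1_neq0 hp hnq.
have fs : tau_pt (tadd aQ D1 p (tau_pt p)) = tadd aQ D1 p (tau_pt p).
  by rewrite tau_pt_add tau_ptK (taddC D1_neq0 hq hp).
have ft : tau_pt (tadd aQ D1 p (ecneg (tau_pt p))) = ecneg (tadd aQ D1 p (ecneg (tau_pt p))).
  rewrite tau_pt_add {2}/tau_pt mappt_neg -/tau_pt tau_ptK -(tadd_neg aQ D1).
  have -> : ecneg (ecneg (tau_pt p)) = tau_pt p by case: (tau_pt p) => [[x y]|] //=; rewrite opprK.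
  by rewrite (taddC D1_neq0 (tneg_on hp) hq).
have [c ec] := lam_fixed1 hs fs; have et := lam_antifixed1 ht ft.
have lD := lamD two0 D1_neq0 discQ0 derQD derQM (derQ_cst a) (derQ_cst b).
exists (c / 2).
have : 2 * lam derQ p = cst c * derQ theta1.
  rewrite -ec -[RHS]addr0 -et (lD _ _ hp hq) (lD _ _ hp hnq) lamN.
  exact: two_lam_identity.
move=> e; apply: (mulfI two0); rewrite e fmorph_div (rmorph_nat cst 2).
exact: (half_identity _ _ two0).
Qed.

(** The polynomial g in the variable [v]. It differs from [D1] by a square, so rescaling [y]
    identifies the two twists. *)
Definition G1 : Qu := - aQ * bQ * z *
  (bQ ^+ 2 * (uQ ^+ 2 + uQ + 1) ^+ 3 + aQ ^+ 3 * uQ ^+ 2 * z ^+ 2).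

Lemma G1E : G1 = D1 * (aQ ^+ 2 * z ^+ 2) ^+ 2.
Proof. exact: (G_identity _ aQ0 zN0). Qed.

Lemma lam_G1 p : ton aQ bQ G1 p ->
  exists c, lam derQ p = cst c * (aQ ^+ 2 * z ^+ 2 * derQ theta1).
Proof.
have az0 : aQ ^+ 2 * z ^+ 2 != 0 := mulf_neq0 (expf_neq0 2 aQ0) (expf_neq0 2 zN0).
case: p => [[x y]|] hp; last by exists 0; rewrite /= rmorph0 mul0r.
have hp' : ton aQ bQ D1 (Some (x, aQ ^+ 2 * z ^+ 2 * y)).
  by rewrite /= (exprMn _ (aQ ^+ 2 * z ^+ 2) y) mulrA -G1E; exact: hp.
have [c ec] := lam_D1 hp'; exists c.
rewrite mulrCA -ec; exact: (scale_div _ _ az0).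
Qed.

End QuotientCurve.

(** * The twist by g and the involutions u -> -u and u -> 1/u *)

Section FieldIdentities.
Variable K : fieldType.

Lemma rho_lam_identity (x y u : K) : u != 0 ->
  x * (- u ^- 2) / (y / u ^+ 7) = - u ^+ 5 * (x / y).
Proof.
move=> u0; rewrite invf_div.
transitivity (- (u ^- 2 * u ^+ 7) * (x * y^-1)); first by ring.
by congr (- _ * _); field.
Qed.

Lemma rho_solve (u l r : K) : u != 0 -> - u^-1 ^+ 5 * l = r -> l = - u ^+ 5 * r.
Proof. by move=> u0 <-; field. Qed.

Lemma rho_g_identity (a b u : K) : u != 0 ->
  - a * b * (u^-1 ^+ 2 + 1) *
    (b ^+ 2 * (u^-1 ^+ 4 + u^-1 ^+ 2 + 1) ^+ 3 + a ^+ 3 * u^-1 ^+ 4 * (u^-1 ^+ 2 + 1) ^+ 2) =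
  - a * b * (u ^+ 2 + 1) *
    (b ^+ 2 * (u ^+ 4 + u ^+ 2 + 1) ^+ 3 + a ^+ 3 * u ^+ 4 * (u ^+ 2 + 1) ^+ 2) / u ^+ 14.
Proof. by move=> u0; field. Qed.

Lemma g_even_identity (a b u : K) :
  - a * b * ((u ^+ 2) + 1) *
    (b ^+ 2 * ((u ^+ 2) ^+ 2 + u ^+ 2 + 1) ^+ 3 + a ^+ 3 * (u ^+ 2) ^+ 2 * (u ^+ 2 + 1) ^+ 2) =
  - a * b * (u ^+ 2 + 1) *
    (b ^+ 2 * (u ^+ 4 + u ^+ 2 + 1) ^+ 3 + a ^+ 3 * u ^+ 4 * (u ^+ 2 + 1) ^+ 2).
Proof. ring. Qed.

Lemma twist14_identity (g y u : K) : u != 0 -> g * (y / u ^+ 7) ^+ 2 = g / u ^+ 14 * y ^+ 2.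
Proof. by move=> u0; field. Qed.

Lemma indep_identity (x y : K) : 2 * y = x + y + (- x + y).
Proof. ring. Qed.

Lemma oppr_div_expr7 (y u : K) : - y / (- u) ^+ 7 = y / u ^+ 7.
Proof. by have -> : (- u) ^+ 7 = - u ^+ 7 by [ring]; rewrite invrN mulrNN. Qed.

Lemma div_exprN7 (y u : K) : y / (- u) ^+ 7 = - (y / u ^+ 7).
Proof. by have -> : (- u) ^+ 7 = - u ^+ 7 by [ring]; rewrite invrN mulrN. Qed.

Lemma mulr_exprN5 (l u : K) : - (- u) ^+ 5 * - l = - u ^+ 5 * l.
Proof. ring. Qed.

Lemma sum_half_identity (l s t : K) : 2 != 0 :> K -> 2 * l = s + t -> l = s / 2 + t / 2.
Proof. by move=> two0 e; apply: (mulfI two0); rewrite e; field. Qed.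

End FieldIdentities.

Lemma derQ_sigma : derQ (- uQ) != 0.
Proof. by rewrite (derN derQD) derQ_u oppr_eq0; exact: oner_neq0. Qed.
Lemma derQ_rho : derQ uQ^-1 != 0.
Proof.
rewrite (derV derQM uQ_neq0) derQ_u; apply: mulf_neq0.
  by rewrite oppr_eq0; exact: oner_neq0.
exact: (invr_neq0 (expf_neq0 2 uQ_neq0)).
Qed.
Lemma derQ_sq : derQ (uQ ^+ 2) != 0.
Proof.
rewrite (derX2 derQM) derQ_u mulr1; apply: (mulf_neq0 _ uQ_neq0).
by rewrite pnatr_eq0_Qu.
Qed.

Definition sigma : {rmorphism Qu -> Qu} := substQ derQ_sigma.
Definition rho : {rmorphism Qu -> Qu} := substQ derQ_rho.
Definition phi : {rmorphism Qu -> Qu} := substQ derQ_sq.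

Lemma sigma_u : sigma uQ = - uQ. Proof. exact: substQ_u. Qed.
Lemma rho_u : rho uQ = uQ^-1. Proof. exact: substQ_u. Qed.
Lemma phi_u : phi uQ = uQ ^+ 2. Proof. exact: substQ_u. Qed.
Lemma sigma_cst c : sigma (cst c) = cst c. Proof. exact: substQ_cst. Qed.
Lemma rho_cst c : rho (cst c) = cst c. Proof. exact: substQ_cst. Qed.
Lemma phi_cst c : phi (cst c) = cst c. Proof. exact: substQ_cst. Qed.

Lemma rhoK x : rho (rho x) = x.
Proof.
apply: (@rmorph_Qu_ext (rho \o rho) idfun) => [c|].
  by change (rho (rho (cst c)) = cst c); rewrite !rho_cst.
by change (rho (rho uQ) = uQ); rewrite rho_u (fmorphV rho) rho_u invrK.
Qed.

Lemma sigmaK x : sigma (sigma x) = x.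
Proof.
apply: (@rmorph_Qu_ext (sigma \o sigma) idfun) => [c|].
  by change (sigma (sigma (cst c)) = cst c); rewrite !sigma_cst.
by change (sigma (sigma uQ) = uQ); rewrite sigma_u (rmorphN sigma) sigma_u opprK.
Qed.

Lemma sigma_rho x : sigma (rho x) = rho (sigma x).
Proof.
apply: (@rmorph_Qu_ext (sigma \o rho) (rho \o sigma)) => [c|].
  by change (sigma (rho (cst c)) = rho (sigma (cst c))); rewrite rho_cst sigma_cst rho_cst.
change (sigma (rho uQ) = rho (sigma uQ)).
by rewrite rho_u sigma_u (fmorphV sigma) sigma_u (rmorphN rho) rho_u invrN.
Qed.

Lemma sigma_phi x : sigma (phi x) = phi x.
Proof.
apply: (@rmorph_Qu_ext (sigma \o phi) phi) => [c|].
  by change (sigma (phi (cst c)) = phi (cst c)); rewrite phi_cst sigma_cst.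
by change (sigma (phi uQ) = phi uQ); rewrite phi_u (rmorphXn sigma) sigma_u sqrrN.
Qed.

Section LambdaLattice.
Variables (a b : rat).
Hypotheses (a0 : a != 0) (b0 : b != 0) (disc0 : cubic_disc a b != 0).
Hypothesis ntp : no_twist_points a b.
Let aQ := cst a.
Let bQ := cst b.
Let two0 : 2 != 0 :> Qu. Proof. by rewrite pnatr_eq0_Qu. Qed.
Let aQ0 : aQ != 0. Proof. by rewrite fmorph_eq0. Qed.
Let bQ0 : bQ != 0. Proof. by rewrite fmorph_eq0. Qed.
Let discQ0 : cubic_disc aQ bQ != 0.
Proof. by rewrite cubic_disc_cst fmorph_eq0. Qed.

Definition gT : Qu := - aQ * bQ * (uQ ^+ 2 + 1) *
  (bQ ^+ 2 * (uQ ^+ 4 + uQ ^+ 2 + 1) ^+ 3 + aQ ^+ 3 * uQ ^+ 4 * (uQ ^+ 2 + 1) ^+ 2).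

Lemma map_gpoly (f : {rmorphism Qu -> Qu}) (v1 v2 v3 v4 : Qu) :
  (forall c, f (cst c) = cst c) ->
  f (- aQ * bQ * (v1 + 1) * (bQ ^+ 2 * (v4 + v1 + 1) ^+ 3 + aQ ^+ 3 * v2 * v3 ^+ 2)) =
  - aQ * bQ * (f v1 + 1) * (bQ ^+ 2 * (f v4 + f v1 + 1) ^+ 3 + aQ ^+ 3 * f v2 * f v3 ^+ 2).
Proof.
move=> fc; have fa : f aQ = aQ := fc a; have fb : f bQ = bQ := fc b.
rewrite (rmorphM f) (rmorphM f (- aQ * bQ)) (rmorphM f (- aQ)) (rmorphN f) (rmorphD f v1) (rmorph1 f).
rewrite (rmorphD f (bQ ^+ 2 * _)) (rmorphM f (bQ ^+ 2)) (rmorphM f (aQ ^+ 3 * v2)).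
rewrite (rmorphM f (aQ ^+ 3)) !(rmorphXn f) (rmorphD f (v4 + v1)) (rmorphD f v4) (rmorph1 f).
by rewrite fa fb.
Qed.

Lemma gT_phi : gT = phi (G1 a b).
Proof.
rewrite /G1 /gT; have := @map_gpoly phi uQ (uQ ^+ 2) (uQ + 1) (uQ ^+ 2) phi_cst => ->.
rewrite (rmorphXn phi) (rmorphD phi) (rmorph1 phi) phi_u; exact: (esym (g_even_identity _ _ _)).
Qed.

Lemma sigma_gT : sigma gT = gT.
Proof. by rewrite gT_phi sigma_phi. Qed.

Lemma rho_gT : rho gT = gT / uQ ^+ 14.
Proof.
rewrite /gT; have := @map_gpoly rho (uQ ^+ 2) (uQ ^+ 4) (uQ ^+ 2 + 1) (uQ ^+ 4) rho_cst => ->.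
rewrite (rmorphXn rho 4) (rmorphD rho) (rmorph1 rho) (rmorphXn rho 2) rho_u.
exact: (rho_g_identity _ _ uQ_neq0).
Qed.

(** [lP] and [lQ] are the values of lambda at P and Q. The first is odd and the second even under
    [sigma]. *)
Definition lP : Qu := phi (aQ ^+ 2 * (uQ + 1) ^+ 2 * derQ (theta1 a b)) * derQ (uQ ^+ 2).
Definition lQ : Qu := - uQ ^+ 5 * rho lP.

Lemma sq_span : exists P Q, uQ = phi P + uQ * phi Q.
Proof. by exists 0, 1; rewrite (rmorph0 phi) (rmorph1 phi) mulr1 add0r. Qed.

Let sigma_pt := mappt sigma.

Lemma phi_cubic x : phi (cubic aQ bQ x) = cubic aQ bQ (phi x).
Proof.
rewrite /cubic !(rmorphD phi) (rmorphM phi) (rmorphXn phi) /=.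
by rewrite (phi_cst a) (phi_cst b).
Qed.

Lemma lam_fixed0 s : ton aQ bQ gT s -> sigma_pt s = s ->
  exists c, lam derQ s = cst c * lP.
Proof.
case: s => [[x y]|] hs /=; last by exists 0; rewrite rmorph0 mul0r.
case=> tx ty.
have st : sigma (uQ ^+ 2) = uQ ^+ 2 by rewrite -phi_u sigma_phi.
have w2 : uQ ^+ 2 = substQ derQ_sq uQ by rewrite substQ_u.
have [X eX] := fixed_descends sigma_cst st uQ_neq0 sigma_u w2 sq_span tx.
have [Y eY] := fixed_descends sigma_cst st uQ_neq0 sigma_u w2 sq_span ty.
have hS : ton aQ bQ (G1 a b) (Some (X, Y)).
  apply: (fmorph_inj phi); rewrite (rmorphM phi) (rmorphXn phi) -gT_phi phi_cubic.
  by move: hs; rewrite /= eX eY.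
have [c ec] := lam_G1 a0 b0 disc0 ntp hS.
exists c; rewrite eX eY derQ_subst mulrAC.
have -> : substQ derQ_sq (derQ X) / substQ derQ_sq Y = phi (lam derQ (Some (X, Y))).
  exact: (esym (fmorph_div phi _ _)).
rewrite ec (rmorphM phi (cst c)) phi_cst; exact: (esym (mulrA _ _ _)).
Qed.

(** Since [g(1/u) = g(u)/u^14], the substitution [u -> 1/u] acts on points once [y] is divided by
    [u^7]. The exponent being odd, this exchanges points fixed by [sigma] with points negated by
    it. *)
Definition rho_pt (p : ecpoint Qu) : ecpoint Qu :=
  if p is Some (x, y) then Some (rho x, rho y / uQ ^+ 7) else None.

Lemma rho_pt_on p : ton aQ bQ gT p -> ton aQ bQ gT (rho_pt p).
Proof.
case: p => [[x y]|] //= /(congr1 rho); rewrite (rmorphM rho) (rmorphXn rho) rho_gT.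
rewrite (twist14_identity _ _ uQ_neq0) => ->.
rewrite /cubic !(rmorphD rho) (rmorphM rho aQ) (rmorphXn rho).
by rewrite (rho_cst a) (rho_cst b).
Qed.

Lemma lam_rho_pt p : lam derQ (rho_pt p) = - uQ ^+ 5 * rho (lam derQ p).
Proof.
case: p => [[x y]|] /=; last by rewrite (rmorph0 rho) mulr0.
change (derQ (rho x) / (rho y / uQ ^+ 7) = - uQ ^+ 5 * rho (derQ x / y)).
have -> : derQ (rho x) = rho (derQ x) * - uQ ^- 2.
  by rewrite derQ_subst (derV derQM uQ_neq0) derQ_u mulN1r.
rewrite (fmorph_div rho (derQ x)); exact: (rho_lam_identity _ _ uQ_neq0).
Qed.

(** [rho_pt] turns [s] into a point fixed by [sigma], so the anti-invariant case is transported from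
    the invariant one. *)
Lemma lam_antifixed0 s : ton aQ bQ gT s -> sigma_pt s = ecneg s ->
  exists c, lam derQ s = cst c * lQ.
Proof.
move=> hs fs.
have fs' : sigma_pt (rho_pt s) = rho_pt s.
  case: s fs {hs} => [[x y]|] fs; last by [].
  have [tx ty] : sigma x = x /\ sigma y = - y by case: fs.
  change (Some (sigma (rho x), sigma (rho y / uQ ^+ 7)) = Some (rho x, rho y / uQ ^+ 7)).
  congr (Some (_, _)); first by rewrite sigma_rho tx.
  rewrite (fmorph_div sigma) (rmorphXn sigma) sigma_u sigma_rho ty (rmorphN rho).
  exact: oppr_div_expr7.
have [c ec] := lam_fixed0 (rho_pt_on hs) fs'.
exists c; move: ec; rewrite lam_rho_pt => /(congr1 rho).
rewrite (rmorphM rho (- uQ ^+ 5)) (rmorphN rho) (rmorphXn rho) rho_u rhoK (rmorphM rho (cst c)) rho_cst.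
by move/(rho_solve uQ_neq0) => ->; rewrite mulrCA.
Qed.

Lemma gT_neq0 : gT != 0.
Proof.
rewrite gT_phi fmorph_eq0 (G1E b a0).
apply: mulf_neq0; first exact: D1_neq0.
exact: (expf_neq0 2 (mulf_neq0 (expf_neq0 2 aQ0) (expf_neq0 2 u1_neq0))).
Qed.

Lemma sigma_pt_on p : ton aQ bQ gT p -> ton aQ bQ gT (sigma_pt p).
Proof. by move/(mappt_ton sigma); rewrite sigma_gT (sigma_cst a) (sigma_cst b). Qed.

Lemma sigma_pt_add p q : sigma_pt (tadd aQ gT p q) = tadd aQ gT (sigma_pt p) (sigma_pt q).
Proof. by rewrite /sigma_pt mappt_tadd sigma_gT (sigma_cst a). Qed.

Lemma sigma_ptK p : sigma_pt (sigma_pt p) = p.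
Proof. by case: p => [[x y]|] //=; rewrite !sigmaK. Qed.

Lemma lam_gT p : ton aQ bQ gT p -> exists c1 c2, lam derQ p = cst c1 * lP + cst c2 * lQ.
Proof.
move=> hp; have hq := sigma_pt_on hp; have hnq := tneg_on hq.
have hs := tadd_on two0 gT_neq0 hp hq.
have ht := tadd_on two0 gT_neq0 hp hnq.
have fs : sigma_pt (tadd aQ gT p (sigma_pt p)) = tadd aQ gT p (sigma_pt p).
  by rewrite sigma_pt_add sigma_ptK (taddC gT_neq0 hq hp).
have ft : sigma_pt (tadd aQ gT p (ecneg (sigma_pt p))) = ecneg (tadd aQ gT p (ecneg (sigma_pt p))).
  rewrite sigma_pt_add {2}/sigma_pt mappt_neg -/sigma_pt sigma_ptK -(tadd_neg aQ gT).
  have -> : ecneg (ecneg (sigma_pt p)) = sigma_pt p by case: (sigma_pt p) => [[x y]|] //=; rewrite opprK.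
  by rewrite (taddC gT_neq0 (tneg_on hp) hq).
have [c1 e1] := lam_fixed0 hs fs; have [c2 e2] := lam_antifixed0 ht ft.
have lD := lamD two0 gT_neq0 discQ0 derQD derQM (derQ_cst a) (derQ_cst b).
exists (c1 / 2), (c2 / 2).
have : 2 * lam derQ p = cst c1 * lP + cst c2 * lQ.
  rewrite -e1 -e2 (lD _ _ hp hq) (lD _ _ hp hnq) lamN; exact: two_lam_identity.
move/(sum_half_identity two0) => ->; rewrite !(fmorph_div cst) (rmorph_nat cst 2).
by congr (_ + _); rewrite mulrAC.
Qed.

(** The tautological point: for this abscissa [x], g is [f(x)] times the square of
    [a^2 (u^2 + 1)^2], whose inverse is therefore an ordinate. *)
Definition PT : ecpoint Qu := Some (phi (theta1 a b), (aQ ^+ 2 * (uQ ^+ 2 + 1) ^+ 2)^-1).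
Definition QT : ecpoint Qu := rho_pt PT.

Lemma phi_z : phi (uQ + 1) = uQ ^+ 2 + 1.
Proof. by rewrite (rmorphD phi) (rmorph1 phi) phi_u. Qed.

Lemma u21_neq0 : uQ ^+ 2 + 1 != 0.
Proof. rewrite -phi_z fmorph_eq0; exact: u1_neq0. Qed.

Lemma lam_PT : lam derQ PT = lP.
Proof.
rewrite /lam /PT invrK derQ_subst /lP (rmorphM phi) (rmorphM phi) !(rmorphXn phi) phi_z.
by rewrite (phi_cst a) mulrC mulrA.
Qed.

Lemma lam_QT : lam derQ QT = lQ.
Proof. by rewrite /QT lam_rho_pt lam_PT. Qed.

Lemma PT_on : ton aQ bQ gT PT.
Proof.
have s0 : aQ ^+ 2 * (uQ ^+ 2 + 1) ^+ 2 != 0.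
  exact: (mulf_neq0 (expf_neq0 2 aQ0) (expf_neq0 2 u21_neq0)).
rewrite /PT /ton -phi_cubic gT_phi (G1E b a0) (rmorphM phi) (rmorphXn phi) (rmorphM phi (cst a ^+ 2)).
rewrite (rmorphXn phi) (rmorphXn phi) phi_z (phi_cst a) exprVn.
exact: (mulfK (expf_neq0 2 s0)).
Qed.

Lemma QT_on : ton aQ bQ gT QT.
Proof. exact: (rho_pt_on PT_on). Qed.

Lemma sigma_PT : sigma_pt PT = PT.
Proof.
congr (Some (_, _)); first exact: sigma_phi.
rewrite (fmorphV sigma) (rmorphM sigma) !(rmorphXn sigma) (sigma_cst a).
by rewrite -phi_z sigma_phi.
Qed.

Lemma sigma_QT : sigma_pt QT = ecneg QT.
Proof.
have [ex ey] : sigma (phi (theta1 a b)) = phi (theta1 a b) /\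
  sigma (aQ ^+ 2 * (uQ ^+ 2 + 1) ^+ 2)^-1 = (aQ ^+ 2 * (uQ ^+ 2 + 1) ^+ 2)^-1.
  by case: sigma_PT.
rewrite /QT /PT; set x := phi _ in ex *; set y := (_ ^-1 : Qu) in ey *.
change (Some (sigma (rho x), sigma (rho y / uQ ^+ 7)) = Some (rho x, - (rho y / uQ ^+ 7))).
congr (Some (_, _)); first by rewrite sigma_rho ex.
rewrite (fmorph_div sigma) (rmorphXn sigma) sigma_u sigma_rho ey.
exact: div_exprN7.
Qed.

Lemma lP_neq0 : lP != 0.
Proof.
apply: (mulf_neq0 _ derQ_sq); rewrite fmorph_eq0; apply: mulf_neq0; last exact: dtheta1.
exact: (mulf_neq0 (expf_neq0 2 aQ0) (expf_neq0 2 u1_neq0)).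
Qed.

Lemma lQ_neq0 : lQ != 0.
Proof.
apply: mulf_neq0; first by rewrite oppr_eq0; exact: (expf_neq0 5 uQ_neq0).
rewrite fmorph_eq0; exact: lP_neq0.
Qed.

Lemma sigma_lP : sigma lP = - lP.
Proof.
rewrite /lP (rmorphM sigma) sigma_phi (derX2 derQM) derQ_u mulr1.
by rewrite (rmorphM sigma 2) (rmorph_nat sigma) sigma_u !mulrN.
Qed.

Lemma sigma_lQ : sigma lQ = lQ.
Proof.
rewrite /lQ (rmorphM sigma) (rmorphN sigma) (rmorphXn sigma) sigma_u sigma_rho sigma_lP.
rewrite (rmorphN rho); exact: mulr_exprN5.
Qed.

(** [lP] and [lQ] are nonzero eigenvectors of [sigma] for the distinct eigenvalues -1 and 1. *)
Lemma lPQ_indep c1 c2 : cst c1 * lP + cst c2 * lQ = 0 -> c1 = 0 /\ c2 = 0.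
Proof.
move=> e; have := congr1 sigma e.
rewrite (rmorph0 sigma) (rmorphD sigma) (rmorphM sigma (cst c1)) (rmorphM sigma (cst c2)).
rewrite !sigma_cst sigma_lP sigma_lQ.
rewrite mulrN => e'.
have e2 : cst c2 * lQ = 0.
  apply: (mulfI two0); rewrite mulr0; transitivity ((cst c1 * lP + cst c2 * lQ) + (- (cst c1 * lP) + cst c2 * lQ)).
    exact: indep_identity.
  by rewrite e e' addr0.
have e1 : cst c1 * lP = 0 by move: e; rewrite e2 addr0.
split.
  by move/eqP: e1; rewrite mulf_eq0 (negPf lP_neq0) orbF fmorph_eq0 => /eqP.
by move/eqP: e2; rewrite mulf_eq0 (negPf lQ_neq0) orbF fmorph_eq0 => /eqP.
Qed.

End LambdaLattice.

(** * The degree of x under addition and doubling *)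

Section DoublingBezout.
Variables (R : comNzRingType) (a b A B : R).
Let N := (A * A - a * (B * B)) * (A * A - a * (B * B)) - (8 * b) * ((A * B) * (B * B)).
Let M := 4 * ((A * A) * (A * B) + (a * ((A * B) * (B * B)) + b * ((B * B) * (B * B)))).

(** [N/M] is the abscissa of the double of a point with abscissa [A/B]. The two identities play the
    part of resultants: a common factor of [N] and [M] would divide both [A^7] and [B^7] when the
    constant is invertible. *)
Lemma dbl_bezout1 :
  (12 * A ^+ 2 * B + 16 * a * B ^+ 3) * N
  - (3 * A ^+ 3 - 5 * a * A * B ^+ 2 - 27 * b * B ^+ 3) * M
  = 4 * (4 * a ^+ 3 + 27 * b ^+ 2) * B ^+ 7.
Proof. rewrite /N /M; ring. Qed.

Lemma dbl_bezout2 :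
  (4 * (4 * a ^+ 3 + 27 * b ^+ 2) * A ^+ 3 - 4 * a ^+ 2 * b * A ^+ 2 * B
    + 4 * a * (3 * a ^+ 3 + 22 * b ^+ 2) * A * B ^+ 2
    + 12 * b * (a ^+ 3 + 8 * b ^+ 2) * B ^+ 3) * N
  + (a ^+ 2 * b * A ^+ 3 + a * (5 * a ^+ 3 + 32 * b ^+ 2) * A ^+ 2 * B
    + 2 * b * (13 * a ^+ 3 + 96 * b ^+ 2) * A * B ^+ 2
    - 3 * a ^+ 2 * (a ^+ 3 + 8 * b ^+ 2) * B ^+ 3) * M
  = 4 * (4 * a ^+ 3 + 27 * b ^+ 2) * A ^+ 7.
Proof. rewrite /N /M; ring. Qed.
End DoublingBezout.

Section DegreeInequalities.
Variable F : fieldType.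
Implicit Types (A B C E P Q : {poly F}) (a b : F).

Definition pdeg A B : nat := (maxn (size A) (size B)).-1.

Lemma pdeg_size_le A B : (size A <= (pdeg A B).+1)%N /\ (size B <= (pdeg A B).+1)%N.
Proof.
have h : (maxn (size A) (size B) <= (pdeg A B).+1)%N by exact: leqSpred.
by split; apply: leq_trans h; rewrite ?leq_maxl ?leq_maxr.
Qed.

Lemma pdeg_le A B n : (size A <= n.+1)%N -> (size B <= n.+1)%N -> (pdeg A B <= n)%N.
Proof.
move=> hA hB; have : (maxn (size A) (size B) <= n.+1)%N by rewrite geq_max hA.
by rewrite /pdeg; case: (maxn _ _).
Qed.

Lemma size_mul_deg P Q n m : (size P <= n.+1)%N -> (size Q <= m.+1)%N ->
  (size (P * Q)%R <= (n + m).+1)%N.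
Proof.
move=> hP hQ; apply: leq_trans (size_mul_leq _ _) _.
by move: (leq_add hP hQ); rewrite addSn addnS; case: (_ + _)%N.
Qed.

Lemma size_add_deg P Q n : (size P <= n)%N -> (size Q <= n)%N -> (size (P + Q)%R <= n)%N.
Proof. by move=> hP hQ; apply: leq_trans (size_polyD _ _) _; rewrite geq_max hP. Qed.

Lemma size_scale_deg a P n : (size P <= n)%N -> (size (a%:P * P)%R <= n)%N.
Proof. by move=> h; rewrite mul_polyC; apply: leq_trans (size_scale_le _ _) h. Qed.

Lemma size_opp_deg P n : (size P <= n)%N -> (size (- P)%R <= n)%N.
Proof. by rewrite size_polyN. Qed.

(** Up to sign the three polynomials are the coefficients of [(B3 T - A3)(B4 T - A4)], a product of
    two primitive polynomials in [T], hence primitive. *)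
Lemma coprime_triple A3 B3 A4 B4 : coprimep A3 B3 -> coprimep A4 B4 ->
  coprimep (B3 * B4) (gcdp (A3 * B4 + A4 * B3) (A3 * A4)).
Proof.
move=> c3 c4; set t1 := _ + _; set t2 := _ * A4.
rewrite coprimep_def; set q := gcdp _ _.
have q0 : q %| B3 * B4 by exact: dvdp_gcdl.
have q1 : q %| t1 by apply: dvdp_trans (dvdp_gcdr _ _) (dvdp_gcdl _ _).
have q2 : q %| t2 by apply: dvdp_trans (dvdp_gcdr _ _) (dvdp_gcdr _ _).
have main A B A' B' : coprimep A B -> coprimep A' B' ->
    q %| A * A' -> q %| A * B' + A' * B -> coprimep q B.
  move=> c c' d2 d1; rewrite coprimep_def; set r := gcdp q B.
  have rB : r %| B by exact: dvdp_gcdr.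
  have rq : r %| q by exact: dvdp_gcdl.
  have cA : coprimep r A by apply: coprimep_dvdr rB _; rewrite coprimep_sym.
  have rA' : r %| A' by rewrite -(Gauss_dvdpr _ cA); exact: dvdp_trans rq d2.
  have cB' : coprimep r B' by exact: coprimep_dvdr rA' c'.
  have : r %| A * B'.
    have := dvdp_trans rq d1; rewrite dvdp_addl //.
    exact: dvdp_mulr.
  by rewrite (Gauss_dvdpr _ cA) => rB'; rewrite -dvdp1 -(Gauss_dvdpr 1 cB') mulr1.
have cq3 : coprimep q B3 by exact: (main A3 B3 A4 B4).
have cq4 : coprimep q B4.
  by apply: (main A4 B4 A3 B3) => //; [rewrite mulrC | rewrite addrC].
by rewrite -dvdp1 -(Gauss_dvdpr 1 cq4) mulr1 -(Gauss_dvdpr _ cq3).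
Qed.

(** The same product at the place at infinity: the largest degree among its coefficients is the sum
    of those of the two factors. *)
Lemma triple_deg A3 B3 A4 B4 n : B3 != 0 -> B4 != 0 ->
  (size (B3 * B4)%R <= n.+1)%N -> (size (A3 * B4 + A4 * B3)%R <= n.+1)%N ->
  (size (A3 * A4)%R <= n.+1)%N -> (pdeg A3 B3 + pdeg A4 B4 <= n)%N.
Proof.
move=> B30 B40 h0 h1 h2.
have p3 : (0 < size B3)%N by rewrite size_poly_gt0.
have p4 : (0 < size B4)%N by rewrite size_poly_gt0.
have sB : size (B3 * B4)%R = (size B3 + size B4).-1 by exact: size_mul_neq0.
have sM P Q : P != 0 -> Q != 0 -> size (P * Q)%R = (size P + size Q).-1.
  exact: size_mul_neq0.
rewrite /pdeg; have [l3|l3] := leqP (size A3) (size B3); have [l4|l4] := leqP (size A4) (size B4).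
- by rewrite sB in h0; move: p3 p4 h0; clear; lia.
- have A40 : A4 != 0 by rewrite -size_poly_gt0; apply: leq_ltn_trans l4.
  have s1 : size (A3 * B4 + A4 * B3)%R = (size A4 + size B3).-1.
    rewrite addrC size_polyDl (sM A4 B3) //; apply: leq_ltn_trans (size_mul_leq _ _) _.
    by move: p3 p4 l3 l4; clear; lia.
  rewrite s1 in h1.
  by move: p3 p4 l4 h1; clear; lia.
- have A30 : A3 != 0 by rewrite -size_poly_gt0; apply: leq_ltn_trans l3.
  have s1 : size (A3 * B4 + A4 * B3)%R = (size A3 + size B4).-1.
    rewrite size_polyDl (sM A3 B4) //; apply: leq_ltn_trans (size_mul_leq _ _) _.
    by move: p3 p4 l3 l4; clear; lia.
  rewrite s1 in h1.
  by move: p3 p4 l3 h1; clear; lia.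
have A30 : A3 != 0 by rewrite -size_poly_gt0; apply: leq_ltn_trans l3.
have A40 : A4 != 0 by rewrite -size_poly_gt0; apply: leq_ltn_trans l4.
rewrite (sM A3 A4) // in h2.
by move: p3 p4 l3 l4 h2; clear; lia.
Qed.

Definition sum_num a b A1 B1 A2 B2 : {poly F} :=
  2%:P * ((A1 * A2 + a%:P * (B1 * B2)) * (A1 * B2 + A2 * B1) + (2 * b)%:P * ((B1 * B2) * (B1 * B2))).
Definition prod_num a b A1 B1 A2 B2 : {poly F} :=
  (A1 * A2 - a%:P * (B1 * B2)) * (A1 * A2 - a%:P * (B1 * B2))
  - (4 * b)%:P * ((B1 * B2) * (A1 * B2 + A2 * B1)).
Definition diff_num A1 B1 A2 B2 : {poly F} :=
  (A1 * B2 - A2 * B1) * (A1 * B2 - A2 * B1).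

(** The sum and product of the abscissae of [p + q] and [p - q] give two proportional triples [t]
    and [w]. As [t] is primitive, [w = c t] for a polynomial [c], so [t] has at most the degrees of
    [w], whose entries are of degree 2 in each of the two points. *)
Lemma sum_prod_pdeg a b A1 B1 A2 B2 A3 B3 A4 B4 :
  coprimep A3 B3 -> coprimep A4 B4 -> B3 != 0 -> B4 != 0 ->
  diff_num A1 B1 A2 B2 != 0 ->
  (A3 * B4 + A4 * B3) * diff_num A1 B1 A2 B2 = sum_num a b A1 B1 A2 B2 * (B3 * B4) ->
  (A3 * A4) * diff_num A1 B1 A2 B2 = prod_num a b A1 B1 A2 B2 * (B3 * B4) ->
  (pdeg A3 B3 + pdeg A4 B4 <= 2 * pdeg A1 B1 + 2 * pdeg A2 B2)%N.
Proof.
move=> c3 c4 B30 B40 w00 e1 e2.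
set w0 := diff_num A1 B1 A2 B2 in w00 e1 e2; set w1 := sum_num _ _ _ _ _ _ in e1.
set w2 := prod_num _ _ _ _ _ _ in e2.
set t0 := B3 * B4 in e1 e2; set t1 := _ + A4 * B3 in e1; set t2 := A3 * A4 in e2.
have t00 : t0 != 0 by rewrite mulf_neq0.
have /dvdpP[c ec] : t0 %| w0.
  have cop := coprime_triple c3 c4; rewrite -/t0 -/t1 -/t2 in cop.
  rewrite -(Gauss_dvdpr _ cop); have [[u v] /= uv] := Bezoutp t1 t2.
  rewrite -(eqp_dvdr _ (eqp_mulr w0 uv)) mulrDl -(mulrA u) -(mulrA v) e1 e2.
  by rewrite dvdp_add // mulrA dvdp_mull.
have e1' : w1 = c * t1.
  by apply: (mulIf t00); rewrite -e1 ec; ring.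
have e2' : w2 = c * t2.
  by apply: (mulIf t00); rewrite -e2 ec; ring.
have c0 : c != 0 by apply: contraNneq w00 => c0; rewrite ec c0 mul0r.
have dv P w : w = c * P -> (size P <= size w)%N \/ P = 0.
  move=> ->; have [|P0] := eqVneq P 0; [by right | left].
  by apply: dvdp_leq; [rewrite mulf_neq0 | rewrite dvdp_mull].
have le P w n : w = c * P -> (size w <= n)%N -> (size P <= n)%N.
  by move=> /dv [h1 h2|-> _]; [exact: leq_trans h1 h2 | rewrite size_poly0].
have [sA1 sB1] := pdeg_size_le A1 B1; have [sA2 sB2] := pdeg_size_le A2 B2.
set d1 := pdeg A1 B1 in sA1 sB1 *; set d2 := pdeg A2 B2 in sA2 sB2 *.
have sq n : (2 * d1 + 2 * d2 = n)%N -> (d1 + d2 + (d1 + d2) = n)%N by lia.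
have AA := size_mul_deg sA1 sA2; have BB := size_mul_deg sB1 sB2.
have AB : (size (A1 * B2)%R <= (d1 + d2).+1)%N := size_mul_deg sA1 sB2.
have BA : (size (A2 * B1)%R <= (d1 + d2).+1)%N.
  by rewrite mulrC; exact: size_mul_deg.
have -> : (2 * d1 + 2 * d2 = d1 + d2 + (d1 + d2))%N by clear; lia.
apply: triple_deg => //.
- apply: (le _ w0) => //; apply: size_mul_deg; apply: size_add_deg => //; exact: size_opp_deg.
- apply: (le _ w1) => //; apply: size_scale_deg; apply: size_add_deg.
    by apply: size_mul_deg; apply: size_add_deg => //; exact: size_scale_deg.
  by apply: size_scale_deg; exact: size_mul_deg.
- apply: (le _ w2) => //; apply: size_add_deg.
    by apply: size_mul_deg; apply: size_add_deg => //; apply: size_opp_deg; exact: size_scale_deg.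
  apply: size_opp_deg; apply: size_scale_deg; apply: size_mul_deg => //.
  exact: size_add_deg.
Qed.

Definition dbl_num a b A B : {poly F} :=
  (A * A - a%:P * (B * B)) * (A * A - a%:P * (B * B)) - (8 * b)%:P * ((A * B) * (B * B)).
Definition dbl_den a b A B : {poly F} :=
  4%:P * ((A * A) * (A * B) + (a%:P * ((A * B) * (B * B)) + b%:P * ((B * B) * (B * B)))).

Lemma dbl_size a b A B : (size (dbl_num a b A B) <= (4 * pdeg A B).+1)%N /\
  (size (dbl_den a b A B) <= (4 * pdeg A B).+1)%N.
Proof.
have [sA sB] := pdeg_size_le A B; set d := pdeg A B in sA sB *.
have -> : (4 * d = d + d + (d + d))%N by clear; lia.
have AA := size_mul_deg sA sA; have AB := size_mul_deg sA sB; have BB := size_mul_deg sB sB.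
split.
  apply: size_add_deg.
    by apply: size_mul_deg; apply: size_add_deg => //; apply: size_opp_deg; exact: size_scale_deg.
  by apply: size_opp_deg; apply: size_scale_deg; exact: size_mul_deg.
apply: size_scale_deg; apply: size_add_deg; first exact: size_mul_deg.
by apply: size_add_deg; apply: size_scale_deg; exact: size_mul_deg.
Qed.

Lemma dbl_pdeg_le a b A B C E : coprimep C E -> E != 0 -> dbl_den a b A B != 0 ->
  C * dbl_den a b A B = dbl_num a b A B * E -> (pdeg C E <= 4 * pdeg A B)%N.
Proof.
move=> cCE E0 M0 e; have [sN sM] := dbl_size a b A B.
have /dvdpP[c ec] : E %| dbl_den a b A B.
  by rewrite -(Gauss_dvdpr _ (_ : coprimep E C)) 1?coprimep_sym // e dvdp_mull.
have c0 : c != 0 by apply: contraNneq M0 => c0; rewrite ec c0 mul0r.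
have eN : dbl_num a b A B = c * C.
  by apply: (mulIf E0); rewrite -e ec; ring.
apply: pdeg_le.
  have [->|C0] := eqVneq C 0; first by rewrite size_poly0.
  apply: leq_trans sN; apply: dvdp_leq; rewrite eN; last exact: dvdp_mull.
  by rewrite mulf_neq0.
by apply: leq_trans sM; apply: dvdp_leq => //; rewrite ec dvdp_mull.
Qed.

Definition form3 (c3 c2 c1 c0 : F) A B : {poly F} :=
  c3%:P * ((A * A) * A) + c2%:P * ((A * A) * B) + c1%:P * ((A * B) * B) + c0%:P * ((B * B) * B).

Lemma size_form3 c3 c2 c1 c0 A B :
  (size (form3 c3 c2 c1 c0 A B) <= (3 * pdeg A B).+1)%N.
Proof.
have [sA sB] := pdeg_size_le A B; set d := pdeg A B in sA sB *.
have -> : (3 * d = d + d + d)%N by clear; lia.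
have AA := size_mul_deg sA sA; have AB := size_mul_deg sA sB; have BB := size_mul_deg sB sB.
by do !apply: size_add_deg; apply: size_scale_deg; exact: size_mul_deg.
Qed.

Lemma dbl_bezout_form1 a b A B :
  form3 0 12 0 (16 * a) A B * dbl_num a b A B
  + form3 (- 3) 0 (5 * a) (27 * b) A B * dbl_den a b A B
  = (4 * cubic_disc a b)%:P * B ^+ 7.
Proof.
have -> : (4 * cubic_disc a b)%:P = 4 * (4 * a%:P ^+ 3 + 27 * b%:P ^+ 2).
  by rewrite /cubic_disc !(rmorphD, rmorphM, rmorphXn, rmorph_nat).
rewrite -(dbl_bezout1 a%:P b%:P A B) /form3 /dbl_num /dbl_den.
rewrite !(rmorph0, rmorphN, rmorphM, rmorph_nat) /=.
by move: (a%:P) (b%:P) => a' b'; ring.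
Qed.

Lemma dbl_bezout_form2 a b A B :
  form3 (4 * (4 * a ^+ 3 + 27 * b ^+ 2)) (- 4 * a ^+ 2 * b)
    (4 * a * (3 * a ^+ 3 + 22 * b ^+ 2)) (12 * b * (a ^+ 3 + 8 * b ^+ 2)) A B * dbl_num a b A B
  + form3 (a ^+ 2 * b) (a * (5 * a ^+ 3 + 32 * b ^+ 2))
    (2 * b * (13 * a ^+ 3 + 96 * b ^+ 2)) (- 3 * a ^+ 2 * (a ^+ 3 + 8 * b ^+ 2)) A B * dbl_den a b A B
  = (4 * cubic_disc a b)%:P * A ^+ 7.
Proof.
have -> : (4 * cubic_disc a b)%:P = 4 * (4 * a%:P ^+ 3 + 27 * b%:P ^+ 2).
  by rewrite /cubic_disc !(rmorphD, rmorphM, rmorphXn, rmorph_nat).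
rewrite -(dbl_bezout2 a%:P b%:P A B) /form3 /dbl_num /dbl_den.
rewrite !(rmorphD, rmorphN, rmorphM, rmorphXn, rmorph_nat) /=.
by move: (a%:P) (b%:P) => a' b'; ring.
Qed.

(** By the Bezout identities [M] and [N] are coprime, so nothing cancels in [x(2p)]. The same
    identities bound degrees: with [d] the degree of [A/B] and [q] that of [C/E] they give
    [7d <= 3d + q]. *)
Lemma dbl_pdeg_ge a b A B C E : 2 != 0 :> F -> cubic_disc a b != 0 ->
  coprimep A B -> coprimep C E -> dbl_den a b A B != 0 ->
  C * dbl_den a b A B = dbl_num a b A B * E -> (4 * pdeg A B <= pdeg C E)%N.
Proof.
move=> two0 disc0 cAB cCE M0 e.
have k0 : 4 * cubic_disc a b != 0.
  by rewrite mulf_neq0 // (_ : 4 = 2 * 2 :> F) ?mulf_neq0 //; ring.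
have bz1 := dbl_bezout_form1 a b A B; have bz2 := dbl_bezout_form2 a b A B.
set M := dbl_den a b A B in M0 e bz1 bz2; set N := dbl_num a b A B in e bz1 bz2.
have cNM : coprimep N M.
  rewrite coprimep_def; set r := gcdp N M.
  have rN : r %| N by exact: dvdp_gcdl.
  have rM : r %| M by exact: dvdp_gcdr.
  have rB : r %| B ^+ 7 by rewrite -(dvdpZr _ _ k0) -mul_polyC -bz1 dvdp_add // dvdp_mull.
  have rA : r %| A ^+ 7 by rewrite -(dvdpZr _ _ k0) -mul_polyC -bz2 dvdp_add // dvdp_mull.
  have c7 : coprimep (A ^+ 7) (B ^+ 7) by rewrite coprimep_expl // coprimep_expr.
  have [[u v] /= uv] := Bezout_eq1_coprimepP _ _ c7.
  by rewrite -dvdp1 -uv dvdp_add // dvdp_mull.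
have E0 : E != 0.
  apply: contraTneq cCE => E0; move/eqP: e; rewrite E0 mulr0 mulf_eq0 (negPf M0) orbF.
  by move/eqP->; rewrite coprimep0 -size_poly_eq1 size_poly0.
have ME : M %| E.
  by rewrite -(Gauss_dvdpr _ (_ : coprimep M N)) 1?coprimep_sym // -e dvdp_mull.
have NC : N %| C by rewrite -(Gauss_dvdpl _ cNM) e dvdp_mulr.
have [sC sE] := pdeg_size_le C E.
set d := pdeg A B; set q := pdeg C E in sC sE *.
have sM : (size M <= q.+1)%N by apply: leq_trans sE; exact: dvdp_leq.
have sN : (size N <= q.+1)%N.
  have [C0|C0] := eqVneq C 0; last by apply: leq_trans sC; exact: dvdp_leq.
  have N0 : N = 0.
    by move/eqP: e; rewrite C0 mul0r eq_sym mulf_eq0 (negPf E0) orbF => /eqP.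
  by rewrite N0 size_poly0.
have s7 P : (size ((4 * cubic_disc a b)%:P * P ^+ 7)%R <= (3 * d + q).+1)%N ->
    (7 * (size P).-1 <= 3 * d + q)%N.
  have [->|P0] := eqVneq P 0; first by rewrite size_poly0.
  by rewrite mul_polyC size_scale // size_exp_neq0 // ltnS mulnC.
have hB : (7 * (size B).-1 <= 3 * d + q)%N.
  by apply: s7; rewrite -bz1; apply: size_add_deg; apply: size_mul_deg => //; exact: size_form3.
have hA : (7 * (size A).-1 <= 3 * d + q)%N.
  by apply: s7; rewrite -bz2; apply: size_add_deg; apply: size_mul_deg => //; exact: size_form3.
have : d = (size A).-1 \/ d = (size B).-1.
  by rewrite /d /pdeg; case: leqP; [right | left].
by move: hA hB; clear; move: (size A).-1 (size B).-1 => x y; lia.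
Qed.

End DegreeInequalities.

Section AdditionFormulas.
Variables (K : fieldType) (a b D : K).
Hypotheses (two0 : 2 != 0 :> K) (D0 : D != 0).

Lemma add_sub_x x1 y1 x2 y2 : x1 != x2 ->
  D * y1 ^+ 2 = cubic a b x1 -> D * y2 ^+ 2 = cubic a b x2 ->
  exists x3 y3 x4 y4,
    [/\ tadd a D (Some (x1, y1)) (Some (x2, y2)) = Some (x3, y3),
        tadd a D (Some (x1, y1)) (Some (x2, - y2)) = Some (x4, y4),
        (x3 + x4) * (x1 - x2) ^+ 2 = 2 * ((x1 * x2 + a) * (x1 + x2) + 2 * b) &
        x3 * x4 * (x1 - x2) ^+ 2 = (x1 * x2 - a) ^+ 2 - 4 * b * (x1 + x2)].
Proof.
move=> x12 h1 h2; rewrite /tadd (negPf x12).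
have x21 : x2 - x1 != 0 by rewrite subr_eq0 eq_sym.
do 4!eexists; split; [reflexivity | reflexivity | |];
by rewrite (curve_b h1) (curve_a x12 h1 h2); field.
Qed.

Lemma dbl_x x y : y != 0 -> D * y ^+ 2 = cubic a b x ->
  exists x3 y3, tadd a D (Some (x, y)) (Some (x, y)) = Some (x3, y3) /\
    x3 * (4 * cubic a b x) = (x ^+ 2 - a) ^+ 2 - 8 * b * x.
Proof.
move=> y0 h; rewrite /tadd eqxx.
have yy : (y + y == 0) = false by apply/negbTE; rewrite -mulr2n -mulr_natl mulf_neq0.
rewrite yy; do 2!eexists; split; first reflexivity.
rewrite -h (curve_b h); by field; rewrite ?y0 ?D0 ?two0.
Qed.

Lemma clear_sum (x1 x2 x3 x4 B1 B2 B3 B4 : K) :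
  (x3 + x4) * (x1 - x2) ^+ 2 = 2 * ((x1 * x2 + a) * (x1 + x2) + 2 * b) ->
  ((x3 * B3) * B4 + (x4 * B4) * B3) *
    (((x1 * B1) * B2 - (x2 * B2) * B1) * ((x1 * B1) * B2 - (x2 * B2) * B1)) =
  2 * (((x1 * B1) * (x2 * B2) + a * (B1 * B2)) * ((x1 * B1) * B2 + (x2 * B2) * B1)
     + 2 * b * ((B1 * B2) * (B1 * B2))) * (B3 * B4).
Proof.
move=> e; transitivity ((x3 + x4) * (x1 - x2) ^+ 2 * (B1 * B2 * (B1 * B2) * (B3 * B4))).
  by ring.
by rewrite e; ring.
Qed.

Lemma clear_prod (x1 x2 x3 x4 B1 B2 B3 B4 : K) :
  x3 * x4 * (x1 - x2) ^+ 2 = (x1 * x2 - a) ^+ 2 - 4 * b * (x1 + x2) ->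
  ((x3 * B3) * (x4 * B4)) *
    (((x1 * B1) * B2 - (x2 * B2) * B1) * ((x1 * B1) * B2 - (x2 * B2) * B1)) =
  (((x1 * B1) * (x2 * B2) - a * (B1 * B2)) * ((x1 * B1) * (x2 * B2) - a * (B1 * B2))
   - 4 * b * ((B1 * B2) * ((x1 * B1) * B2 + (x2 * B2) * B1))) * (B3 * B4).
Proof.
move=> e; transitivity (x3 * x4 * (x1 - x2) ^+ 2 * (B1 * B2 * (B1 * B2) * (B3 * B4))).
  by ring.
by rewrite e; ring.
Qed.

Lemma clear_dbl (x x3 B E : K) :
  x3 * (4 * cubic a b x) = (x ^+ 2 - a) ^+ 2 - 8 * b * x ->
  (x3 * E) * (4 * (((x * B) * (x * B)) * ((x * B) * B)
     + (a * (((x * B) * B) * (B * B)) + b * ((B * B) * (B * B))))) =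
  ((((x * B) * (x * B) - a * (B * B)) * ((x * B) * (x * B) - a * (B * B)))
     - 8 * b * (((x * B) * B) * (B * B))) * E.
Proof.
move=> e; transitivity (x3 * (4 * cubic a b x) * ((B * B) * (B * B) * E)).
  by rewrite /cubic; ring.
by rewrite e; ring.
Qed.

Lemma dbl_den_identity (x B : K) :
  4 * (((x * B) * (x * B)) * ((x * B) * B)
     + (a * (((x * B) * B) * (B * B)) + b * ((B * B) * (B * B)))) =
  (2 * 2) * cubic a b x * ((B * B) * (B * B)).
Proof. by rewrite /cubic; ring. Qed.

End AdditionFormulas.

Definition hgt (x : Qu) : nat :=
  let n := \n_(repr x) in let d := \d_(repr x) in
  pdeg (n %/ gcdp n d) (d %/ gcdp n d).

Lemma hgtE (A B : {poly rat}) : coprimep A B -> B != 0 -> hgt (tf A / tf B) = pdeg A B.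
Proof.
move=> cAB B0; rewrite /hgt; set x := tf A / tf B.
set n := \n_(repr x); set d := \d_(repr x).
have d0 : d != 0 by exact: denom_ratioP.
have ex : tf n / tf d = tf A / tf B := frac_numden x.
have /frac_eq e := ex; have {}e := e d0 B0.
set g := gcdp n d; have g0 : g != 0 by rewrite gcdp_eq0 negb_and d0 orbT.
have en : n = n %/ g * g by rewrite divpK ?dvdp_gcdl.
have ed : d = d %/ g * g by rewrite divpK ?dvdp_gcdr.
have c1 : coprimep (n %/ g) (d %/ g) by rewrite coprimep_div_gcd // d0 orbT.
set n1 := n %/ g in en c1 *; set d1 := d %/ g in ed c1 *.
have e1 : n1 * B = A * d1.
  by apply: (mulIf g0); rewrite mulrAC -en e ed mulrA.
have d10 : d1 != 0 by apply: contraNneq d0 => h; rewrite ed h mul0r.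
have s1 : size d1 = size B.
  apply/eqP; rewrite eqn_leq; apply/andP; split; apply: dvdp_leq => //.
    by rewrite -(Gauss_dvdpr _ (_ : coprimep d1 n1)) 1?coprimep_sym // e1 dvdp_mull.
  by rewrite -(Gauss_dvdpr _ (_ : coprimep B A)) 1?coprimep_sym // -e1 dvdp_mull.
have s2 : size n1 = size A.
  have [A0|A0] := eqVneq A 0.
    have : n1 * B == 0 by rewrite e1 A0 mul0r.
    by rewrite mulf_eq0 (negPf B0) orbF => /eqP->; rewrite A0.
  have n10 : n1 != 0.
    apply: contraNneq (mulf_neq0 A0 d10) => n10; by rewrite -e1 n10 mul0r.
  have := congr1 (fun P : {poly rat} => size P) e1.
  rewrite !size_mul_neq0 // s1; move: B0; rewrite -size_poly_gt0; clear.
  by case: (size B) => // k _; rewrite !addnS /= => /addIn.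
by rewrite /pdeg s1 s2.
Qed.

Lemma hgt_cst c : hgt (cst c) = 0%N.
Proof.
have -> : cst c = tf c%:P / tf 1 by rewrite tofrac1 divr1.
rewrite hgtE ?oner_neq0 ?coprimep1 //; apply/eqP; rewrite -leqn0.
by apply: pdeg_le; rewrite ?size_polyC_leq1 // size_poly1.
Qed.

Lemma hgt_le (A B : {poly rat}) : B != 0 -> (hgt (tf A / tf B) <= pdeg A B)%N.
Proof.
move=> B0; have [C [E [cCE E0 e]]] := frac_repr_coprime (tf A / tf B).
rewrite e hgtE //; move: e; move/frac_eq => /(_ B0 E0) e.
have EB : E %| B.
  by rewrite -(Gauss_dvdpr _ (_ : coprimep E C)) 1?coprimep_sym // -e dvdp_mull.
have [sA sB] := pdeg_size_le A B.
apply: pdeg_le; last by apply: leq_trans sB; exact: dvdp_leq.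
have [C0|C0] := eqVneq C 0; first by rewrite C0 size_poly0.
have A0 : A != 0.
  apply: contraNneq (mulf_neq0 C0 B0) => A0; by rewrite -e A0 mul0r.
apply: leq_trans sA; apply: dvdp_leq => //.
by rewrite -(Gauss_dvdpl _ cCE) e dvdp_mulr.
Qed.

Definition hpt (p : ecpoint Qu) : nat := if p is Some (x, _) then hgt x else 0%N.

Lemma hpt_neg p : hpt (ecneg p) = hpt p.
Proof. by case: p => [[x y]|]. Qed.

Lemma ecneg_Some (K : fieldType) (x y : K) : ecneg (Some (x, y)) = Some (x, - y).
Proof. by []. Qed.

Section HeightInequality.
Variables (a b : rat) (D : Qu).
Hypotheses (D0 : D != 0) (disc0 : cubic_disc a b != 0).
Let aQ := cst a.
Let bQ := cst b.
Let two0 : 2 != 0 :> Qu. Proof. by rewrite pnatr_eq0_Qu. Qed.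

Lemma tf_sum_num A1 B1 A2 B2 : tf (sum_num a b A1 B1 A2 B2) =
  2 * ((tf A1 * tf A2 + aQ * (tf B1 * tf B2)) * (tf A1 * tf B2 + tf A2 * tf B1)
     + 2 * bQ * ((tf B1 * tf B2) * (tf B1 * tf B2))).
Proof.
have t2 : tf 2%:P = 2 by rewrite polyC_natr rmorph_nat.
have t2b : tf (2 * b)%:P = 2 * bQ by rewrite rmorphM tofracM t2.
by rewrite /sum_num tofracM t2 tofracD tofracM (tofracM (2 * b)%:P) t2b !tofracD !tofracM.
Qed.

Lemma tf_diff_num A1 B1 A2 B2 : tf (diff_num A1 B1 A2 B2) =
  (tf A1 * tf B2 - tf A2 * tf B1) * (tf A1 * tf B2 - tf A2 * tf B1).
Proof. by rewrite /diff_num tofracM tofracB !tofracM. Qed.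

Lemma tf_prod_num A1 B1 A2 B2 : tf (prod_num a b A1 B1 A2 B2) =
  (tf A1 * tf A2 - aQ * (tf B1 * tf B2)) * (tf A1 * tf A2 - aQ * (tf B1 * tf B2))
   - 4 * bQ * ((tf B1 * tf B2) * (tf A1 * tf B2 + tf A2 * tf B1)).
Proof.
have t4 : tf 4%:P = 4 by rewrite polyC_natr rmorph_nat.
have t4b : tf (4 * b)%:P = 4 * bQ by rewrite rmorphM tofracM t4.
rewrite /prod_num tofracB tofracM (tofracM (4 * b)%:P) t4b tofracB.
by rewrite (tofracM (B1 * B2)) tofracD !tofracM.
Qed.

Lemma tf_dbl_num A B : tf (dbl_num a b A B) =
  (tf A * tf A - aQ * (tf B * tf B)) * (tf A * tf A - aQ * (tf B * tf B))
   - 8 * bQ * ((tf A * tf B) * (tf B * tf B)).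
Proof.
have t8 : tf 8%:P = 8 by rewrite polyC_natr rmorph_nat.
have t8b : tf (8 * b)%:P = 8 * bQ by rewrite rmorphM tofracM t8.
by rewrite /dbl_num tofracB tofracM (tofracM (8 * b)%:P) t8b tofracB !tofracM.
Qed.

Lemma tf_dbl_den A B : tf (dbl_den a b A B) =
  4 * ((tf A * tf A) * (tf A * tf B)
     + (aQ * ((tf A * tf B) * (tf B * tf B)) + bQ * ((tf B * tf B) * (tf B * tf B)))).
Proof.
have t4 : tf 4%:P = 4 by rewrite polyC_natr rmorph_nat.
by rewrite /dbl_den tofracM t4 !tofracD !tofracM.
Qed.

Lemma hpt_dbl p : ton aQ bQ D p ->
  (if p is Some (_, y) then is_true (y != 0) else True) -> hpt (tadd aQ D p p) = (4 * hpt p)%N.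
Proof.
case: p => [[x y]|] // h y0.
have [x3 [y3 [-> e]]] := dbl_x two0 D0 y0 h; rewrite /hpt.
have [A [B [cAB B0 eA]]] := frac_repr_coprime x.
have [C [E [cCE E0 eC]]] := frac_repr_coprime x3.
have tB0 : tf B != 0 by rewrite tf_eq0.
have tE0 : tf E != 0 by rewrite tf_eq0.
have xB : tf A = x * tf B by rewrite eA (divfK tB0).
have xE : tf C = x3 * tf E by rewrite eC (divfK tE0).
have e1 : C * dbl_den a b A B = dbl_num a b A B * E.
  apply: tf_inj; rewrite tofracM (tofracM _ E) tf_dbl_num tf_dbl_den xB xE.
  exact: (clear_dbl _ _ e).
have M0 : dbl_den a b A B != 0.
  rewrite -tf_eq0 tf_dbl_den xB.
  rewrite (_ : 4 * _ = (2 * 2) * (D * y ^+ 2) * ((tf B * tf B) * (tf B * tf B))); last first.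
    move: h; rewrite /ton => ->; exact: dbl_den_identity.
  apply: mulf_neq0.
    exact: (mulf_neq0 (mulf_neq0 two0 two0) (mulf_neq0 D0 (expf_neq0 2 y0))).
  exact: (mulf_neq0 (mulf_neq0 tB0 tB0) (mulf_neq0 tB0 tB0)).
rewrite eA eC !hgtE //; apply/eqP; rewrite eqn_leq.
have -> := dbl_pdeg_le cCE E0 M0 e1.
exact: (dbl_pdeg_ge (isT : 2 != 0 :> rat) disc0 cAB cCE M0 e1).
Qed.

Lemma hpt_add_sub p q : ton aQ bQ D p -> ton aQ bQ D q ->
  (hpt (tadd aQ D p q) + hpt (tadd aQ D p (ecneg q)) <= 2 * hpt p + 2 * hpt q)%N.
Proof.
case: p q => [[x1 y1]|] [[x2 y2]|] h1 h2; last 3 first.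
- by rewrite /= muln0 addn0 mul2n addnn.
- by rewrite /= muln0 add0n mul2n addnn.
- by [].
have [e12|x12] := eqVneq x1 x2.
  rewrite -e12 in h2 *; move=> {e12}.
  have : y2 = y1 \/ y2 = - y1.
    have : y2 ^+ 2 = y1 ^+ 2 by apply: (mulfI D0); rewrite [LHS]h2 [RHS]h1.
    by move/eqP; rewrite eqf_sqr => /orP[/eqP|/eqP]; [left | right].
  have neg0 y : tadd aQ D (Some (x1, y)) (Some (x1, - y)) = None.
    by rewrite /tadd eqxx subrr eqxx.
  have dbl y : ton aQ bQ D (Some (x1, y)) ->
    (hpt (tadd aQ D (Some (x1, y)) (Some (x1, y))) <= 4 * hgt x1)%N.
    move=> h; have [y0|y0] := eqVneq y 0.
      by rewrite y0 -{2}[0]oppr0 neg0.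
    by rewrite (hpt_dbl h y0).
  have e4 : (2 * hgt x1 + 2 * hgt x1 = 4 * hgt x1)%N by rewrite -mulnDl.
  case=> ->.
    rewrite ecneg_Some neg0 addn0 e4; exact: dbl.
  rewrite ecneg_Some opprK neg0 add0n e4; exact: dbl.
have [x3 [y3 [x4 [y4 [E3 E4 s p]]]]] := add_sub_x x12 h1 h2.
rewrite ecneg_Some E3 E4 /hpt.
have [A1 [B1 [c1 B10 e1]]] := frac_repr_coprime x1.
have [A2 [B2 [c2 B20 e2]]] := frac_repr_coprime x2.
have [A3 [B3 [c3 B30 e3]]] := frac_repr_coprime x3.
have [A4 [B4 [c4 B40 e4]]] := frac_repr_coprime x4.
have t0 B : B != 0 -> tf B != 0 by rewrite tf_eq0.
have xE x A B : B != 0 -> x = tf A / tf B -> tf A = x * tf B.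
  by move=> B0 ->; rewrite (divfK (t0 _ B0)).
have k1 := xE _ _ _ B10 e1; have k2 := xE _ _ _ B20 e2.
have k3 := xE _ _ _ B30 e3; have k4 := xE _ _ _ B40 e4.
rewrite e1 e2 e3 e4 !hgtE //.
apply: (@sum_prod_pdeg rat a b) => //.
- rewrite /diff_num mulf_eq0 orbb subr_eq0; apply: contraNN x12 => /eqP e.
  rewrite e1 e2; apply/eqP; apply/frac_eq => //.
- apply: tf_inj; rewrite tofracM (tofracM (sum_num _ _ _ _ _ _)) tf_sum_num tf_diff_num.
  rewrite tofracD !tofracM k1 k2 k3 k4; exact: clear_sum.
apply: tf_inj; rewrite tofracM (tofracM (prod_num _ _ _ _ _ _)) tf_prod_num tf_diff_num.
rewrite !tofracM k1 k2 k3 k4; exact: clear_prod.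
Qed.

End HeightInequality.

(** * Quadratic heights and rounding to a lattice *)

Lemma nearest_int (i : int) (N : nat) : (0 < N)%N ->
  exists m : int, (4 * (absz (i - m * N%:Z)%R * absz (i - m * N%:Z)%R) <= N * N)%N.
Proof.
move=> N0; pose r := (i %% N)%Z; pose q := (i %/ N)%Z.
have eq : i = q * N + r by exact: divz_eq.
have r0 : 0 <= r by apply: modz_ge0; lia.
have rN : r < N by apply: ltz_pmod; lia.
have sq (x : nat) : (2 * x <= N)%N -> (4 * (x * x) <= N * N)%N by nia.
have [le|lt] := lerP (2 * r) N; [exists q | exists (q + 1)]; apply: sq.
  by rewrite eq addrC addKr; lia.
have -> : i - (q + 1) * N%:Z = r - N%:Z by rewrite eq; ring.
lia.
Qed.

Section QuadraticHeight.
Variables (T : Type) (on : T -> Prop) (o : T) (add : T -> T -> T) (neg : T -> T).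
Variables (L : zmodType) (lam : T -> L) (h : T -> nat) (tors : T -> Prop).
Hypotheses (on_o : on o) (on_add : forall p q, on p -> on q -> on (add p q)).
Hypotheses (on_neg : forall p, on p -> on (neg p)).
Hypotheses (lamo : lam o = 0)
  (lamD : forall p q, on p -> on q -> lam (add p q) = lam p + lam q)
  (lamN : forall p, lam (neg p) = - lam p).
Hypotheses (h_o : h o = 0%N) (h_neg : forall p, h (neg p) = h p).
Hypothesis h_dbl : forall p, on p -> h (add p p) = (4 * h p)%N.
Hypothesis h_add_sub : forall p q, on p -> on q ->
  (h (add p q) + h (add p (neg q)) <= 2 * h p + 2 * h q)%N.
Hypothesis h_lam : forall p q, on p -> on q -> lam p = lam q -> h p = h q.
Hypothesis h_small : forall p, on p -> (h p < 4)%N -> tors p.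
Hypothesis cancel_tors : forall p q, on p -> on q -> tors (add (neg p) q) ->
  q = add p (add (neg p) q).

(** The inequality for [p], [q], the one for [p + q], [p - q] and exact doubling together give
    equality. The sum and difference of [p + q] and [p - q] are not shown to be [2p] and [2q]; they
    have the same [lam], hence the same height. *)
Lemma h_parallelogram p q : on p -> on q ->
  (h (add p q) + h (add p (neg q)) = 2 * h p + 2 * h q)%N.
Proof.
move=> hp hq; have hs := on_add hp hq; have hd := on_add hp (on_neg hq).
have e1 : h (add (add p q) (add p (neg q))) = h (add p p).
  apply: h_lam; [exact: on_add | exact: on_add |].
  by rewrite !lamD ?lamN //; [rewrite addrACA subrr addr0 | exact: on_neg].
have e2 : h (add (add p q) (neg (add p (neg q)))) = h (add q q).
  apply: h_lam; [exact: on_add (on_neg _) | exact: on_add |].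
  rewrite (lamD hs (on_neg hd)) lamN (lamD hp (on_neg hq)) lamN !lamD //.
  by rewrite opprB addrC addrA subrK.
have := h_add_sub hp hq; have := h_add_sub hs hd.
rewrite e1 e2 !h_dbl //; lia.
Qed.

Definition npt n p := iter n (add p) o.

Definition zpt (m : int) p := match m with Posz n => npt n p | Negz n => neg (npt n.+1 p) end.

Lemma nptS n p : npt n.+1 p = add p (npt n p). Proof. by []. Qed.

Lemma npt_on n p : on p -> on (npt n p).
Proof. by move=> hp; elim: n => //= n IH; exact: on_add. Qed.

Lemma lam_npt n p : on p -> lam (npt n p) = lam p *+ n.
Proof.
move=> hp; elim: n => [|n IH]; first by rewrite mulr0n.
by rewrite nptS lamD ?IH ?mulrS //; exact: npt_on.
Qed.

Lemma zpt_on m p : on p -> on (zpt m p).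
Proof. by move=> hp; case: m => n; [exact: npt_on | apply: on_neg; exact: npt_on]. Qed.

Lemma lam_zpt m p : on p -> lam (zpt m p) = lam p *~ m.
Proof.
move=> hp; case: m => n; first exact: lam_npt.
by rewrite /zpt lamN (lam_npt n.+1 hp) NegzE mulrNz.
Qed.

Lemma second_difference (f : nat -> nat) (c k : nat) :
  f 0%N = c -> f 1%N = (c + k)%N ->
  (forall n, (f n.+2 + f n = 2 * f n.+1 + 2 * k)%N) ->
  forall n, f n = (c + n * n * k)%N.
Proof.
move=> f0 f1 fS n.
suff : f n = (c + n * n * k)%N /\ f n.+1 = (c + n.+1 * n.+1 * k)%N by case.
elim: n => [|n [IH1 IH2]]; first by rewrite f0 f1; split; lia.
by split=> //; have := fS n; rewrite IH1 IH2; nia.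
Qed.

(** By the parallelogram law [h(p + n q)] has constant second difference [2 h q] in [n], and the
    hypothesis says that there is no linear term. *)
Lemma h_add_npt p q n : on p -> on q -> h (add p q) = (h p + h q)%N ->
  h (add p (npt n q)) = (h p + n * n * h q)%N.
Proof.
move=> hp hq hpq.
apply: (@second_difference (fun n => h (add p (npt n q)))) => [||k].
- by apply: h_lam => //; [exact: on_add | rewrite lamD // lamo addr0].
- rewrite -hpq; apply: h_lam; [exact: on_add _ (npt_on _ _) | exact: on_add |].
  by rewrite (lamD hp (npt_on 1 hq)) (lam_npt 1 hq) lamD.
have hk j : on (add p (npt j q)) by exact: on_add _ (npt_on _ _).
rewrite -(h_parallelogram (hk k.+1) hq); congr (_ + _)%N; apply: h_lam => //.
- exact: on_add.
- rewrite (lamD (hk _) hq) !(lamD hp (npt_on _ hq)) !(lam_npt _ hq).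
  by rewrite [in LHS]mulrSr addrA.
- by apply: on_add => //; exact: on_neg.
rewrite (lamD (hk _) (on_neg hq)) !(lamD hp (npt_on _ hq)) !(lam_npt _ hq).
by rewrite lamN [in RHS]mulrSr addrA addrK.
Qed.

Lemma h_npt p n : on p -> h (npt n p) = (n * n * h p)%N.
Proof.
move=> hp.
have ho : h (add o p) = (h o + h p)%N.
  by rewrite h_o; apply: h_lam; rewrite ?lamD ?lamo ?add0r //; exact: on_add.
have hn := npt_on n hp.
have <- : h (add o (npt n p)) = h (npt n p).
  by apply: h_lam; rewrite ?lamD ?lamo ?add0r //; exact: on_add.
by rewrite h_add_npt // h_o.
Qed.

Section Lattice.
Variables P Q : T.
Hypotheses (hP : on P) (hQ : on Q) (hPQ : h (add P Q) = h (add P (neg Q))).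

Lemma h_PQ : h (add P Q) = (h P + h Q)%N.
Proof. have := h_parallelogram hP hQ; rewrite -hPQ; lia. Qed.

Lemma h_npt_npt m n : h (add (npt m P) (npt n Q)) = (m * m * h P + n * n * h Q)%N.
Proof.
have comm p q : on p -> on q -> h (add p q) = h (add q p).
  by move=> hp hq; apply: h_lam; [exact: on_add | exact: on_add | rewrite !lamD // addrC].
have hm := npt_on m hP; have e : h (npt m P) = (m * m * h P)%N by exact: h_npt.
rewrite h_add_npt // e // comm // h_add_npt //; first by rewrite addnC.
by rewrite comm // h_PQ addnC.
Qed.

(** Only absolute values matter: the parallelogram law gives [mP + nQ] and [mP - nQ] the same
    height, and negation preserves heights. *)
Lemma h_lattice r (i j : int) : on r -> lam r = lam P *~ i + lam Q *~ j ->
  h r = (absz i * absz i * h P + absz j * absz j * h Q)%N.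
Proof.
move=> hr er; rewrite -h_npt_npt.
set m := absz i; set n := absz j.
have hm := npt_on m hP; have hn := npt_on n hQ.
have eN : h (add (npt m P) (neg (npt n Q))) = h (add (npt m P) (npt n Q)).
  have := h_parallelogram hm hn; rewrite h_npt_npt !h_npt //; lia.
have ei : i = m \/ i = - m%:Z by lia.
have ej : j = n \/ j = - n%:Z by lia.
have hs := on_add hm hn; have hd := on_add hm (on_neg hn).
have ls : lam (add (npt m P) (npt n Q)) = lam P *+ m + lam Q *+ n by rewrite lamD // !lam_npt.
have ld : lam (add (npt m P) (neg (npt n Q))) = lam P *+ m - lam Q *+ n.
  by rewrite lamD ?lamN ?lam_npt //; exact: on_neg.
case: ei ej er => -> [->|->]; rewrite ?mulrNz -?pmulrn => er.
- by apply: h_lam => //; rewrite ls.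
- by rewrite -eN; apply: h_lam => //; rewrite ld.
- rewrite -eN -h_neg; apply: h_lam => //; first exact: on_neg.
  by rewrite lamN ld er opprD opprK.
- rewrite -h_neg; apply: h_lam => //; first exact: on_neg.
  by rewrite lamN ls er opprD !opprK.
Qed.

Hypotheses (hP4 : (h P <= 4)%N) (hQ4 : (h Q <= 4)%N).

Lemma generators r (N : nat) (i j : int) : on r -> (0 < N)%N ->
  lam r *+ N = lam P *~ i + lam Q *~ j ->
  exists (m n : int) t, [/\ on t, tors t & r = add (add (zpt m P) (zpt n Q)) t].
Proof.
move=> hr N0 e.
have [m em] := nearest_int i N0; have [n en] := nearest_int j N0.
have hx : on (add (zpt m P) (zpt n Q)) by apply: on_add; exact: zpt_on.
set x := add _ _ in hx; set t := add (neg x) r.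
have ht : on t by apply: on_add => //; exact: on_neg.
exists m, n, t; suff : tors t by move=> tt; split=> //; exact: cancel_tors.
apply: h_small => //.
(* Heights are computed at [N t], whose [lam] has the integral coordinates [i - mN] and [j - nN].
   These are at most [N/2] in absolute value, so [N^2 h(t) <= 2 N^2]. *)
have : h (npt N t) = (absz (i - m * N%:Z)%R * absz (i - m * N%:Z)%R * h P
   + absz (j - n * N%:Z)%R * absz (j - n * N%:Z)%R * h Q)%N.
  apply: h_lattice; first exact: npt_on.
  rewrite lam_npt // /t lamD ?lamN //; last exact: on_neg.
  rewrite lamD ?lam_zpt //; try exact: zpt_on.
  rewrite mulrnDl e !mulrzBr mulNrn mulrnDl !mulrzA -!pmulrn opprD.
  by rewrite [LHS]addrC -!addrA; congr (_ + _); rewrite addrCA.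
rewrite h_npt //; move: em en hP4 hQ4 N0; clear.
set u := (absz _ * absz _)%N; set v := (absz _ * absz _)%N.
move: u v (h t) (h P) (h Q) => u v k y z hu hv hy hz N0 e.
have : (N * N * k <= N * N * 2)%N.
  rewrite e; have : (u * y <= u * 4)%N by rewrite leq_mul2l hy orbT.
  have : (v * z <= v * 4)%N by rewrite leq_mul2l hz orbT.
  lia.
rewrite leq_mul2l muln_eq0 orbb; case: N N0 {hu hv e} => //= _ _; lia.
Qed.

End Lattice.
End QuadraticHeight.

(** * Heights on the twist by g and its generators *)

Section GeneratorIdentities.
Variable K : fieldType.

Lemma PTx_identity (a b u : K) : a != 0 -> u ^+ 2 + 1 != 0 ->
  - (b / a) * ((u ^+ 2 + 1) + (u ^+ 2 + 1)^-1 - 1) =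
  - (b * (u ^+ 2 + u + 1) * (u ^+ 2 - u + 1)) / (a * (u ^+ 2 + 1)).
Proof. by move=> a0 u0; field; rewrite a0 u0. Qed.

Lemma invr_sqr_add1 (u : K) : u != 0 -> u^-1 ^+ 2 + 1 = (u ^+ 2 + 1) / u ^+ 2.
Proof. by move=> u0; field. Qed.

Lemma QTx_identity (a b u : K) : a != 0 -> u != 0 -> u ^+ 2 + 1 != 0 ->
  - (b * (u^-1 ^+ 2 + u^-1 + 1) * (u^-1 ^+ 2 - u^-1 + 1)) / (a * (u^-1 ^+ 2 + 1)) =
  - (b * (u ^+ 2 + u + 1) * (u ^+ 2 - u + 1)) / (a * u ^+ 2 * (u ^+ 2 + 1)).
Proof. by move=> a0 u0 u1; rewrite invr_sqr_add1 //; field; rewrite a0 u0 u1. Qed.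

Lemma QTy_identity (a u : K) : a != 0 -> u != 0 -> u ^+ 2 + 1 != 0 ->
  (a ^+ 2 * (u^-1 ^+ 2 + 1) ^+ 2)^-1 / u ^+ 7 = (a ^+ 2 * u ^+ 3 * (u ^+ 2 + 1) ^+ 2)^-1.
Proof. by move=> a0 u0 u1; rewrite invr_sqr_add1 //; field; rewrite a0 u0 u1. Qed.

Lemma gT_split_identity (a b u : K) :
  - a * b * (u ^+ 2 + 1) *
    (b ^+ 2 * (u ^+ 4 + u ^+ 2 + 1) ^+ 3 + a ^+ 3 * u ^+ 4 * (u ^+ 2 + 1) ^+ 2) =
  - a * b * ((u ^+ 2 + 1) *
    (b ^+ 2 * (u ^+ 4 + u ^+ 2 + 1) ^+ 3 + a ^+ 3 * (u ^+ 4 + u ^+ 2) ^+ 2)).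
Proof. ring. Qed.

End GeneratorIdentities.

Lemma evalQ_opp P : evalQ (- uQ) P = tf (P \Po (- 'X)).
Proof.
elim/poly_ind: P => [|P c IH]; first by rewrite -[0]/(0%:P) evalQC comp_polyC.
rewrite evalQD evalQM evalQX evalQC IH comp_polyD comp_polyM comp_polyX comp_polyC.
by rewrite tofracD tofracM tofracN.
Qed.

Lemma hgt_sigma x : (hgt (sigma x) <= hgt x)%N.
Proof.
have [A [B [cAB B0 ->]]] := frac_repr_coprime x.
rewrite hgtE // /sigma; have := substQ_frac derQ_sigma A B0.
change (substQ derQ_sigma) with (sigma : Qu -> Qu) => ->.
have s2 : size (- 'X : {poly rat}) = 2%N by rewrite size_polyN size_polyX.
rewrite !evalQ_opp; apply: leq_trans (hgt_le _ _) _.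
  by rewrite -size_poly_eq0 size_comp_poly2 // size_poly_eq0.
by rewrite /pdeg !size_comp_poly2.
Qed.

Lemma hpt_sigma p : hpt (mappt sigma p) = hpt p.
Proof.
case: p => [[x y]|] //; change (hgt (sigma x) = hgt x).
apply/eqP; rewrite eqn_leq hgt_sigma; have := hgt_sigma (sigma x).
by rewrite sigmaK.
Qed.

Section GPolynomial.
Variables (a b : rat).
Hypotheses (a0 : a != 0) (b0 : b != 0) (disc0 : cubic_disc a b != 0).

Lemma coprimep_rem (P Q S : {poly rat}) (c : rat) : c != 0 -> P = c%:P + S * Q -> coprimep P Q.
Proof.
move=> c0 ->; rewrite coprimep_sym addrC coprimep_addl_mul.
by rewrite -alg_polyC coprimepZr // coprimep1.
Qed.

(** The large factor of g as a cubic in [m = u^4 + u^2], using [u^4 (u^2 + 1)^2 = m^2]. *)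
Definition hpoly (m : {poly rat}) : {poly rat} := (b ^+ 2)%:P * (m + 1) ^+ 3 + (a ^+ 3)%:P * m ^+ 2.

Definition gpoly : {poly rat} :=
  (- (a * b))%:P * (('X^2 + 1) * hpoly ('X^4 + 'X^2)).

Lemma coprimep_h_m m : coprimep (hpoly m) m.
Proof.
apply: (@coprimep_rem _ _ ((b ^+ 2)%:P * (m ^+ 2 + 3 * m + 3) + (a ^+ 3)%:P * m) (b ^+ 2)).
  by rewrite expf_neq0.
by rewrite /hpoly; ring.
Qed.

Lemma coprimep_h_m2 m : coprimep (hpoly m) (m - 2).
Proof.
apply: (@coprimep_rem _ _ ((b ^+ 2)%:P * (m ^+ 2 + 5 * m + 13) + (a ^+ 3)%:P * (m + 2)) (cubic_disc a b)).
  by [].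
rewrite /hpoly /cubic_disc !(rmorphD, rmorphM) /= -!polyC_natr; ring.
Qed.

Lemma coprimep_h_t : coprimep (hpoly ('X^4 + 'X^2)) (2 * 'X^2 + 1).
Proof.
set t : {poly rat} := 2 * 'X^2 + 1.
have c64 : coprimep (64%:P * hpoly ('X^4 + 'X^2)) t.
  apply: (@coprimep_rem _ _ ((b ^+ 2)%:P * (t ^+ 5 + 9 * t ^+ 3 + 27 * t) + 4 * (a ^+ 3)%:P * (t ^+ 3 - 2 * t)) (cubic_disc a b)) => //.
  rewrite /hpoly /cubic_disc /t !(rmorphD, rmorphM) /= -!polyC_natr; ring.
by move: c64; rewrite coprimepMl => /andP[].
Qed.

Lemma deriv_hpoly m : (hpoly m)^`() =
  m^`() * ((b ^+ 2)%:P * (3 * (m + 1) ^+ 2) + (a ^+ 3)%:P * (2 * m)).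
Proof. rewrite /hpoly !exprS !expr0 !mulr1 !(derivD, derivM, derivC); ring. Qed.

(** A multiple root of [hpoly m] is a zero of [m'] or of the derivative in [m]. From
    [(m + 1) h'(m) = 3 h(m) - a^3 m (m - 2)] and [m' = 2u(2u^2 + 1)], it would have [m = 0], [m = 2]
    or [m = -1/4]; there [h] is [b^2], [disc] and [disc/64]. *)
Lemma gpoly_separable : coprimep gpoly gpoly^`().
Proof.
set m : {poly rat} := 'X^4 + 'X^2.
have dm : m^`() = 2 * ('X * (2 * 'X^2 + 1)).
  by rewrite /m derivD !derivXn /=; ring.
have cX (P : {poly rat}) : coprimep P m -> coprimep P 'X.
  by have -> : m = 'X * ('X * ('X^2 + 1)) by [rewrite /m; ring]; rewrite coprimepMr => /andP[].
have c1 (P : {poly rat}) : coprimep P m -> coprimep P ('X^2 + 1).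
  by have -> : m = ('X * 'X) * ('X^2 + 1) by [rewrite /m; ring]; rewrite coprimepMr => /andP[].
have c2 (P : {poly rat}) : coprimep P 2.
  by rewrite -polyC_natr -alg_polyC coprimepZr ?coprimep1.
have cH : coprimep (hpoly m) (hpoly m)^`().
  rewrite deriv_hpoly coprimepMr dm; apply/andP; split.
    rewrite coprimepMr c2 /= coprimepMr coprimep_h_t andbT.
    exact: cX (coprimep_h_m _).
  set d := (_ + _)%R.
  have : coprimep (hpoly m) ((m + 1) * d).
    have -> : (m + 1) * d = 3 * hpoly m + (- (a ^+ 3))%:P * (m * (m - 2)).
      by rewrite /d /hpoly rmorphN; ring.
    rewrite coprimep_addl_mul coprimepMr.
    rewrite coprimepMr coprimep_h_m coprimep_h_m2 -alg_polyC coprimepZr ?coprimep1 //.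
    by rewrite oppr_eq0 expf_neq0.
  by rewrite coprimepMr => /andP[].
have ab0 : - (a * b) != 0 by rewrite oppr_eq0 mulf_neq0.
rewrite /gpoly derivM derivC mul0r add0r -/m !mul_polyC.
rewrite coprimepZl // coprimepZr //.
apply: separableM => //.
  rewrite derivD derivXn derivC addr0 expr1 -mulr_natr coprimepMr; apply/andP; split.
    by apply: (@coprimep_rem _ _ 'X 1); rewrite ?oner_neq0 //; ring.
  exact: c2.
by rewrite coprimep_sym; apply: c1; exact: coprimep_h_m.
Qed.

Lemma gpoly_size : size gpoly = 15%N.
Proof.
have s2 : size ('X^2 + 1 : {poly rat}) = 3%N.
  by have := @size_XnsubC rat 2 (-1) isT; rewrite rmorphN opprK.
have n2 : ('X^2 + 1 : {poly rat}) != 0 by rewrite -size_poly_eq0 s2.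
have s4 : size ('X^4 + 'X^2 + 1 : {poly rat}) = 5%N.
  by rewrite -addrA size_polyDl size_polyXn // s2.
have n4 : ('X^4 + 'X^2 + 1 : {poly rat}) != 0 by rewrite -size_poly_eq0 s4.
have b20 : b ^+ 2 != 0 by rewrite expf_neq0.
have sh : size (hpoly ('X^4 + 'X^2)) = 13%N.
  have e1 : size ((b ^+ 2)%:P * ('X^4 + 'X^2 + 1) ^+ 3) = 13%N.
    by rewrite mul_polyC size_scale // size_exp_neq0 // s4.
  rewrite /hpoly size_polyDl e1 // mul_polyC ltnS; apply: leq_trans (size_scale_le _ _) _.
  have -> : ('X^4 + 'X^2 : {poly rat}) ^+ 2 = 'X^4 * ('X^2 + 1) ^+ 2 by ring.
  by rewrite size_mul_neq0 ?expf_neq0 ?polyX_eq0 // size_polyXn size_exp_neq0 // s2.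
have h0 : hpoly ('X^4 + 'X^2) != 0 by rewrite -size_poly_eq0 sh.
rewrite /gpoly mul_polyC size_scale ?oppr_eq0 ?mulf_neq0 //.
by rewrite size_mul_neq0 // s2 sh.
Qed.

End GPolynomial.

Section MordellWeil.
Variables (a b : rat).
Hypotheses (a0 : a != 0) (b0 : b != 0) (disc0 : cubic_disc a b != 0).
Hypothesis ntp : no_twist_points a b.
Let aQ := cst a.
Let bQ := cst b.
Local Notation g := (gT a b).
Local Notation P := (PT a b).
Local Notation Q := (QT a b).
Let two0 : 2 != 0 :> Qu. Proof. by rewrite pnatr_eq0_Qu. Qed.
Let aQ0 : aQ != 0. Proof. by rewrite fmorph_eq0. Qed.
Let g0 : g != 0. Proof. exact: gT_neq0. Qed.
Let discQ0 : cubic_disc aQ bQ != 0.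
Proof. by rewrite cubic_disc_cst fmorph_eq0. Qed.

Lemma gT_tf : g = tf (gpoly a b).
Proof.
have t1 : tf ('X^2 + 1) = uQ ^+ 2 + 1 by rewrite tofracD tofracXn tofrac1.
have tab : tf (- (a * b))%:P = - aQ * bQ by rewrite rmorphN tofracN rmorphM tofracM mulNr.
have tb : tf (b ^+ 2)%:P = bQ ^+ 2 by rewrite rmorphXn tofracXn.
have ta : tf (a ^+ 3)%:P = aQ ^+ 3 by rewrite rmorphXn tofracXn.
have tm : tf ('X^4 + 'X^2) = uQ ^+ 4 + uQ ^+ 2 by rewrite tofracD !tofracXn.
rewrite /gpoly tofracM tofracM t1 tab /hpoly tofracD tofracM (tofracM (a ^+ 3)%:P) tb ta.
rewrite (tofracXn 3) (tofracXn 2 ('X^4 + 'X^2)) (tofracD ('X^4 + 'X^2)) tm tofrac1.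
exact: gT_split_identity.
Qed.

Definition two_torsion (p : ecpoint Qu) : Prop :=
  if p is Some (_, y) then y = 0 else True.

(** If [A] and [B] have degree at most 3, the quartic form has degree at most 12, less than the
    degree 14 of g. *)
Lemma small_height p : ton aQ bQ g p -> (hpt p < 4)%N -> two_torsion p.
Proof.
case: p => [[x y]|] // hp; rewrite gT_tf in hp.
have [A [B [W [cAB B0 -> -> e]]]] := point_poly (gpoly_separable a0 b0 disc0) hp.
rewrite /hpt hgtE // /two_torsion => d.
have [->|W0] := eqVneq W 0; first by rewrite tofrac0 mul0r.
have sg := gpoly_size a0 b0.
have G0 : gpoly a b != 0 by rewrite -size_poly_eq0 sg.
have [sA sB] := pdeg_size_le A B.
have {}sA : (size A <= 3.+1)%N by apply: leq_trans sA _.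
have {}sB : (size B <= 3.+1)%N by apply: leq_trans sB _.
have sq : (size (quartic a b A B) <= 13)%N.
  have sAA := size_mul_deg sA sA; have sAB := size_mul_deg sA sB; have sBB := size_mul_deg sB sB.
  have -> : quartic a b A B = (A * A) * (A * B) + (a%:P * ((A * B) * (B * B)) + b%:P * ((B * B) * (B * B))).
    by rewrite /quartic; ring.
  apply: size_add_deg; first exact: (size_mul_deg sAA sAB).
  by apply: size_add_deg; apply: size_scale_deg; [exact: (size_mul_deg sAB sBB) | exact: (size_mul_deg sBB sBB)].
move: sq; rewrite e size_mul_neq0 ?expf_neq0 // sg.
by rewrite size_exp_neq0 // addnS.
Qed.

Lemma two_torsion_height p : ton aQ bQ g p -> two_torsion p -> hpt p = 0%N.
Proof.
case: p => [[x y]|] // h y0; rewrite /two_torsion in y0.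
have [] := isl_lam discQ0 derQD derQM (derQ_cst a) (derQ_cst b) h.
by rewrite y0 mulr0 => /derQ_eq0[c ->] _; exact: hgt_cst.
Qed.

Lemma lam0_two_torsion p : ton aQ bQ g p -> lam derQ p = 0 -> two_torsion p.
Proof.
move=> hp l0; apply: (small_height hp); case: p hp l0 => [[x y]|] hp // l0.
have [] := isl_lam discQ0 derQD derQM (derQ_cst a) (derQ_cst b) hp.
by rewrite l0 mul0r => /derQ_eq0[c ->] _; rewrite /hpt hgt_cst.
Qed.

Lemma two_torsion_neg p : two_torsion p -> ecneg p = p.
Proof. by case: p => [[x y]|] //= ->; rewrite oppr0. Qed.

Let lD p q : ton aQ bQ g p -> ton aQ bQ g q -> lam derQ (tadd aQ g p q) = lam derQ p + lam derQ q.
Proof. exact: (lamD two0 g0 discQ0 derQD derQM (derQ_cst a) (derQ_cst b)). Qed.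

(** The difference of the points has lambda 0, so it is a 2-torsion point [t]. As [q' + t] and
    [q' - t] coincide and [t] has height 0, the parallelogram inequality compares the two heights;
    symmetry does the rest. *)
Lemma hpt_lam p q : ton aQ bQ g p -> ton aQ bQ g q -> lam derQ p = lam derQ q -> hpt p = hpt q.
Proof.
suff le p' q' : ton aQ bQ g p' -> ton aQ bQ g q' -> lam derQ p' = lam derQ q' -> (hpt p' <= hpt q')%N.
  by move=> hp hq e; apply/eqP; rewrite eqn_leq !le.
move=> hp hq e; set t := tadd aQ g (ecneg q') p'.
have ht : ton aQ bQ g t by apply: tadd_on => //; exact: tneg_on.
have tt : two_torsion t.
  apply: (lam0_two_torsion ht); rewrite (lD (tneg_on hq) hp) lamN e; exact: addNr.
have ep : p' = tadd aQ g q' t := tadd_cancel g0 discQ0 hq hp (erefl t) tt.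
have := hpt_add_sub g0 disc0 hq ht.
rewrite (two_torsion_neg tt) -ep (two_torsion_height ht tt).
rewrite muln0 addn0 addnn -mul2n leq_pmul2l //.
Qed.

Lemma hpt_double p : ton aQ bQ g p -> hpt (tadd aQ g p p) = (4 * hpt p)%N.
Proof.
move=> hp; case: p hp => [[x y]|] // hp; have [y0|y0] := eqVneq y 0.
  rewrite (two_torsion_height hp y0) muln0.
  have -> : tadd aQ g (Some (x, y)) (Some (x, y)) = None; last by [].
  by rewrite /tadd eqxx y0 addr0 eqxx.
exact: (hpt_dbl g0 disc0 hp y0).
Qed.

Lemma PTx : phi (theta1 a b) =
  - (bQ * (uQ ^+ 2 + uQ + 1) * (uQ ^+ 2 - uQ + 1)) / (aQ * (uQ ^+ 2 + 1)).
Proof.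
rewrite /theta1 (rmorphM phi) (rmorphN phi) (fmorph_div phi) (phi_cst a) (phi_cst b).
rewrite (rmorphB phi) (rmorphD phi (uQ + 1)) (fmorphV phi) phi_z (rmorph1 phi).
exact: (PTx_identity _ aQ0 u21_neq0).
Qed.

Lemma QT_def : Q = Some
  (- (bQ * (uQ ^+ 2 + uQ + 1) * (uQ ^+ 2 - uQ + 1)) / (aQ * uQ ^+ 2 * (uQ ^+ 2 + 1)),
   (aQ ^+ 2 * uQ ^+ 3 * (uQ ^+ 2 + 1) ^+ 2)^-1).
Proof.
rewrite /QT /PT /rho_pt; congr (Some (_, _)).
  rewrite PTx (fmorph_div rho) (rmorphN rho) (rmorphM rho aQ) (rmorphM rho (bQ * _)) (rmorphM rho bQ).
  rewrite !(rmorphD rho) (rmorphN rho) !(rmorphXn rho) !(rmorph1 rho) rho_u (rho_cst a) (rho_cst b).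
  exact: (QTx_identity _ aQ0 uQ_neq0 u21_neq0).
rewrite (fmorphV rho) (rmorphM rho) !(rmorphXn rho) (rmorphD rho) (rmorph1 rho) (rmorphXn rho).
rewrite rho_u (rho_cst a); exact: (QTy_identity aQ0 uQ_neq0 u21_neq0).
Qed.

Let quadX (c : rat) : (size ('X^2 + c *: 'X + 1 : {poly rat})%R <= 3)%N.
Proof.
apply: size_add_deg; last by rewrite size_poly1.
apply: size_add_deg; first by rewrite size_polyXn.
by apply: leq_trans (size_scale_le _ _) _; rewrite size_polyX.
Qed.

Let numPQ : exists2 A : {poly rat}, (size A <= 5)%N &
  tf A = - (bQ * (uQ ^+ 2 + uQ + 1) * (uQ ^+ 2 - uQ + 1)).
Proof.
exists (- (b%:P * (('X^2 + 1 *: 'X + 1) * ('X^2 + (-1) *: 'X + 1)))).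
  apply: size_opp_deg; apply: size_scale_deg; exact: (size_mul_deg (quadX _) (quadX _)).
rewrite tofracN !tofracM scale1r scaleN1r !tofracD tofracN !tofracXn tofrac1; congr (- _); exact: mulrA.
Qed.

Lemma hpt_PT : (hpt P <= 4)%N.
Proof.
have [A sA eA] := numPQ.
have eB : tf (a%:P * ('X^2 + 1)) = aQ * (uQ ^+ 2 + 1) by rewrite tofracM tofracD tofracXn tofrac1.
have B0 : a%:P * ('X^2 + 1) != 0 :> {poly rat}.
  rewrite -tf_eq0 eB; exact: (mulf_neq0 aQ0 u21_neq0).
rewrite /PT /hpt PTx -eA -eB; apply: leq_trans (hgt_le _ B0) _.
apply: pdeg_le => //; apply: size_scale_deg.
by apply: size_add_deg; rewrite ?size_polyXn ?size_poly1.
Qed.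

Lemma hpt_QT : (hpt Q <= 4)%N.
Proof.
have [A sA eA] := numPQ.
have eB : tf (a%:P * 'X^2 * ('X^2 + 1)) = aQ * uQ ^+ 2 * (uQ ^+ 2 + 1).
  by rewrite tofracM tofracM tofracD tofracXn tofrac1.
have B0 : a%:P * 'X^2 * ('X^2 + 1) != 0 :> {poly rat}.
  rewrite -tf_eq0 eB; exact: (mulf_neq0 (mulf_neq0 aQ0 (expf_neq0 2 uQ_neq0)) u21_neq0).
rewrite QT_def /hpt -eA -eB; apply: leq_trans (hgt_le _ B0) _.
apply: pdeg_le => //; rewrite -mulrA; apply: size_scale_deg.
have s2 : (size ('X^2 + 1 : {poly rat})%R <= 3)%N.
  by apply: size_add_deg; rewrite ?size_polyXn ?size_poly1.
by apply: (@size_mul_deg _ _ _ 2 2) => //; rewrite size_polyXn.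
Qed.

Let onP : ton aQ bQ g P. Proof. exact: PT_on. Qed.
Let onQ : ton aQ bQ g Q. Proof. exact: QT_on. Qed.

(** The orthogonality of P and Q: [sigma] fixes P, negates Q and preserves degrees. *)
Lemma hpt_PQ_sub : hpt (tadd aQ g P Q) = hpt (tadd aQ g P (ecneg Q)).
Proof. by rewrite -hpt_sigma sigma_pt_add sigma_PT sigma_QT. Qed.

Lemma lam_lattice p : ton aQ bQ g p -> exists (N : nat) (i j : int),
  (0 < N)%N /\ lam derQ p *+ N = lam derQ P *~ i + lam derQ Q *~ j.
Proof.
move=> hp; have [c1 [c2 ->]] := lam_gT a0 b0 disc0 ntp hp.
rewrite (lam_PT a b) (lam_QT a b).
have [N [i [j [N0 e1 e2]]]] : exists (N : nat) (i j : int),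
    [/\ (0 < N)%N, c1 *+ N = i%:~R & c2 *+ N = j%:~R].
  exists (absz (denq c1 * denq c2)), (numq c1 * denq c2), (numq c2 * denq c1); split.
  - by rewrite absz_gt0 mulf_neq0 ?denq_neq0.
  - rewrite -mulr_natr natr_absz ger0_norm ?mulr_ge0 ?denq_ge0 // !intrM mulrA.
    by rewrite -numqE.
  - rewrite -mulr_natr natr_absz ger0_norm ?mulr_ge0 ?denq_ge0 // !intrM.
    by rewrite [_ * (denq c2)%:~R]mulrC mulrA -numqE.
have cN c k : c *+ N = k%:~R -> forall l : Qu, (cst c * l) *+ N = l *~ k.
  move=> e l; have {}e : cst c *+ N = k%:~R.
    by rewrite -cst_int -e; exact: (esym (rmorphMn cst N c)).
  by rewrite -mulrnAl e mulrzl.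
by exists N, i, j; split=> //; rewrite mulrnDl (cN _ _ e1) (cN _ _ e2).
Qed.

Theorem twist_generators r : ton aQ bQ g r ->
  exists (m n : int) t, [/\ ton aQ bQ g t, two_torsion t &
    r = tadd aQ g (tadd aQ g (zpt None (tadd aQ g) (@ecneg Qu) m P) (zpt None (tadd aQ g) (@ecneg Qu) n Q)) t].
Proof.
move=> hr; have [N [i [j [N0 e]]]] := lam_lattice hr.
apply: (@generators _ (ton aQ bQ g) None (tadd aQ g) (@ecneg Qu) Qu (lam derQ) hpt two_torsion) e => //.
- by move=> p q hp hq; exact: (tadd_on two0 g0 hp hq).
- by move=> p hp; exact: tneg_on.
- by move=> p; exact: lamN.
- exact: hpt_neg.
- exact: hpt_double.
- by move=> p q hp hq; exact: (hpt_add_sub g0 disc0 hp hq).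
- exact: hpt_lam.
- exact: small_height.
- by move=> p q hp hq tt; exact: (tadd_cancel g0 discQ0 hp hq (erefl _) tt).
- exact: hpt_PQ_sub.
- exact: hpt_PT.
- exact: hpt_QT.
Qed.

Theorem twist_independent m n :
  tadd aQ g (zpt None (tadd aQ g) (@ecneg Qu) m P) (zpt None (tadd aQ g) (@ecneg Qu) n Q) = None ->
  m = 0 /\ n = 0.
Proof.
have oA p q : ton aQ bQ g p -> ton aQ bQ g q -> ton aQ bQ g (tadd aQ g p q) by exact: tadd_on.
have oN p : ton aQ bQ g p -> ton aQ bQ g (ecneg p) by exact: tneg_on.
have zon k p : ton aQ bQ g p -> ton aQ bQ g (zpt None (tadd aQ g) (@ecneg Qu) k p).
  by move=> hp; apply: (zpt_on _ oA oN).
have lz k p : ton aQ bQ g p -> lam derQ (zpt None (tadd aQ g) (@ecneg Qu) k p) = lam derQ p *~ k.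
  by move=> hp; apply: (lam_zpt (on := ton aQ bQ g)) => //; exact: lamN.
move/(congr1 (lam derQ)); rewrite (lD (zon m _ onP) (zon n _ onQ)) (lz m _ onP) (lz n _ onQ).
rewrite (lam_PT a b) (lam_QT a b) -(mulrzl _ m) -(mulrzl _ n) -!cst_int.
by case/(lPQ_indep a0 b0) => /eqP + /eqP; rewrite !intr_eq0 => /eqP-> /eqP->.
Qed.

End MordellWeil.

(** * Transfer to the Weierstrass model *)

Section ScaledMultiples.
Variables (K : fieldType) (a D : K).
Hypotheses (two0 : 2 != 0 :> K) (D0 : D != 0).

Lemma ecmuln_scale n p :
  ecmuln (a * D ^+ 2) n (scalept D p) = scalept D (npt None (tadd a D) n p).
Proof.
elim: n => [|n IH] //=; rewrite IH (ecadd_scale a two0 D0).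
by [].
Qed.

Lemma ecmul_scale m p :
  ecmul (a * D ^+ 2) m (scalept D p) = scalept D (zpt None (tadd a D) (@ecneg K) m p).
Proof.
case: m => n; first exact: ecmuln_scale.
by rewrite /ecmul ecmuln_scale ecneg_scale.
Qed.

End ScaledMultiples.

Theorem free_generators_of_no_twist_points (a b : int) :
  a != 0 -> b != 0 -> cubic_disc a%:~R b%:~R != 0 :> rat ->
  no_twist_points a%:~R b%:~R ->
  ec_free_generators2 (EgA a b) (EgB a b) (Pg a b) (Qg a b).
Proof.
move=> a0' b0' disc0 ntp.
have a0 : a%:~R != 0 :> rat by rewrite intr_eq0.
have b0 : b%:~R != 0 :> rat by rewrite intr_eq0.
have two0 : 2 != 0 :> Qu by rewrite pnatr_eq0_Qu.
have eg : gQ a b = gT a%:~R b%:~R by rewrite /gQ /gT !cst_int.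
have g0 : gQ a b != 0 by rewrite eg; exact: gT_neq0.
have eA : EgA a b = cst a%:~R * gQ a b ^+ 2 by rewrite /EgA cst_int.
have eB : EgB a b = cst b%:~R * gQ a b ^+ 3 by rewrite /EgB cst_int.
have eP : Pg a b = scalept (gQ a b) (PT a%:~R b%:~R).
  rewrite /Pg /PT /scalept (PTx _ a0) !cst_int; congr (Some (_, _)).
  exact: mulrC.
have eQ : Qg a b = scalept (gQ a b) (QT a%:~R b%:~R).
  rewrite /Qg (QT_def _ a0) /scalept !cst_int; congr (Some (_, _)).
  exact: mulrC.
have onP := PT_on b%:~R a0; have onQ := QT_on b%:~R a0.
rewrite eA eB eP eQ eg in g0 *.
set g := gT _ _ in g0 onP onQ *.
split.
- by apply/(on_curve_scale _ _ g0).
- by apply/(on_curve_scale _ _ g0).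
- move=> m n; rewrite !(ecmul_scale _ two0 g0) (ecadd_scale _ two0 g0).
  move/(@scalept_inj _ _ g0 _ None); exact: (twist_independent a0 b0 disc0).
move=> R; have [r ->] := scalept_surj g0 R; move/(on_curve_scale _ _ g0) => hr.
have [m [n [t [ht tt er]]]] := twist_generators a0 b0 disc0 ntp hr.
exists m, n, (scalept g t); split; last first.
  by rewrite !(ecmul_scale _ two0 g0) !(ecadd_scale _ two0 g0) -er.
split; first by apply/(on_curve_scale _ _ g0).
exists 2%N; split=> //; rewrite (ecmuln_scale _ two0 g0).
case: t tt {ht er} => [[x y]|] // tt; rewrite /two_torsion in tt.
have -> : npt None (tadd (cst a%:~R) g) 2 (Some (x, y)) = None; last by [].
by rewrite /npt /= eqxx tt addr0 eqxx.
Qed.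

(** * Computing Hasse-Witt determinants on lists of integers *)

Section ListPolynomials.
Variable p : nat.

Fixpoint addl (s t : seq Z) : seq Z :=
  match s, t with
  | [::], _ => t
  | _, [::] => s
  | x :: s', y :: t' => Z.add x y :: addl s' t'
  end.

Definition scalel (c : Z) (s : seq Z) : seq Z := [seq Z.mul c x | x <- s].

Fixpoint mull (s t : seq Z) : seq Z :=
  if s is x :: s' then addl (scalel x t) (Z0 :: mull s' t) else [::].

Definition modl (s : seq Z) : seq Z := [seq Z.modulo x (Z.of_nat p) | x <- s].

(** Coefficients are reduced after every multiplication, which keeps the integers small during
    evaluation. *)
Definition expl (s : seq Z) n : seq Z :=
  iter n (fun t => modl (mull s t)) [:: Zpos 1%positive].

Definition cubicl (a b : Z) : seq Z := [:: b; a; Z0; Zpos 1%positive].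

Definition twistl (a b : Z) : seq Z :=
  modl (mull (cubicl a b) (mull [:: Z.mul (Zneg 3%positive) b; a] [:: b; a])).

Definition discZ (a b : Z) : Z := Z.add (Z.mul (Zpos 4%positive) (Z.mul a (Z.mul a a))) (Z.mul (Zpos 27%positive) (Z.mul b b)).

(** An integer representative of [hasse_witt_det], with coefficient lists starting at the constant
    term. *)
Definition detZ (a b : Z) : Z :=
  let h := nth Z0 (expl (cubicl a b) p./2) p.-1 in
  let H := expl (twistl a b) p./2 in
  Z.sub (Z.mul (Z.sub (nth Z0 H p.-1) h) (Z.sub (nth Z0 H p.*2.-2) h))
        (Z.mul (nth Z0 H p.-2) (nth Z0 H p.*2.-1)).

Definition nonzero_mod (z : Z) : bool := ~~ Z.eqb (Z.modulo z (Z.of_nat p)) Z0.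

(* Nested [if]s rather than [&&], whose arguments [vm_compute] evaluates eagerly. *)
Definition good_prime (a b : Z) : bool :=
  let a := Z.modulo a (Z.of_nat p) in let b := Z.modulo b (Z.of_nat p) in
  if nonzero_mod a then if nonzero_mod b then if nonzero_mod (discZ a b)
  then nonzero_mod (detZ a b) else false else false else false.

Hypothesis p_prime : prime p.

Definition zF (z : Z) : 'F_p := (int_of_Z z)%:~R.

Lemma zF0 : zF Z0 = 0. Proof. by []. Qed.
Lemma zF1 : zF (Zpos 1%positive) = 1. Proof. by []. Qed.

Lemma zFD x y : zF (Z.add x y) = zF x + zF y.
Proof. by rewrite /zF -rmorphD; congr (_%:~R); exact: (rmorphD int_of_Z). Qed.
Lemma zFM x y : zF (Z.mul x y) = zF x * zF y.
Proof. by rewrite /zF -rmorphM; congr (_%:~R); exact: (rmorphM int_of_Z). Qed.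
Lemma zFB x y : zF (Z.sub x y) = zF x - zF y.
Proof. by rewrite /zF -rmorphB; congr (_%:~R); exact: (rmorphB int_of_Z). Qed.

Lemma zFp : zF (Z.of_nat p) = 0.
Proof.
rewrite /zF (_ : int_of_Z _ = Posz p); last by lia.
exact: pchar_Fp_0.
Qed.

Lemma zF_mod z : zF (Z.modulo z (Z.of_nat p)) = zF z.
Proof.
have p0 : Z.of_nat p <> Z0 by have := prime_gt0 p_prime; lia.
by rewrite [in RHS](Z.div_mod z _ p0) zFD zFM zFp mul0r add0r.
Qed.

Lemma nonzero_modP z : nonzero_mod z -> zF z != 0.
Proof.
apply: contraNneq => /eqP; rewrite -zF_mod /zF intr_Fp_eq0 //.
have p0 : (0 < p)%N := prime_gt0 p_prime.
have [l0 lp] := Z.mod_pos_bound z (Z.of_nat p) ltac:(lia).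
move: (Z.modulo z (Z.of_nat p)) l0 lp => m l0 lp /dvdzP[q e].
have {}e : m = Z.mul (Z_of_int q) (Z.of_nat p) by lia.
apply/Z.eqb_spec; move: (Z_of_int q) e => k e.
have [] : (Z.le k (Zneg 1%positive)) \/ k = Z0 \/ Z.le (Zpos 1%positive) k by lia.
  by move=> hk; exfalso; nia.
by case=> hk; [rewrite e hk | exfalso; nia].
Qed.

Definition polyl (s : seq Z) : {poly 'F_p} := foldr (fun z P => (zF z)%:P + P * 'X) 0 s.

Lemma coef_polyl s i : (polyl s)`_i = zF (nth Z0 s i).
Proof.
elim: s i => [|x s IH] [|i]; rewrite /= ?coef0 ?coefD ?coefC ?coefMX //=.
  by rewrite addr0.
by rewrite add0r IH.
Qed.

Lemma polyl_add s t : polyl (addl s t) = polyl s + polyl t.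
Proof.
elim: s t => [|x s IH] [|y t] /=; rewrite ?add0r ?addr0 //.
by rewrite IH zFD rmorphD /=; ring.
Qed.

Lemma polyl_scale c s : polyl (scalel c s) = (zF c)%:P * polyl s.
Proof.
elim: s => [|x s IH] /=; first by rewrite mulr0.
by rewrite IH zFM rmorphM /=; ring.
Qed.

Lemma polyl_mul s t : polyl (mull s t) = polyl s * polyl t.
Proof.
elim: s => [|x s IH]; first by rewrite mul0r.
rewrite [mull _ _]/= polyl_add polyl_scale /= IH zF0; ring.
Qed.

Lemma polyl_mod s : polyl (modl s) = polyl s.
Proof. by elim: s => //= x s ->; rewrite zF_mod. Qed.

Lemma polyl_exp s n : polyl (expl s n) = polyl s ^+ n.
Proof.
elim: n => [|n IH]; first by rewrite /= zF1 mul0r addr0 expr0.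
by rewrite /expl iterS polyl_mod polyl_mul IH exprS.
Qed.

Lemma polyl_cubic a b : polyl (cubicl a b) = cubicX (zF a) (zF b).
Proof. by rewrite /= zF1 zF0 /cubicX -mul_polyC; ring. Qed.

Lemma polyl_twist a b : polyl (twistl a b) = twistX (zF a) (zF b).
Proof.
rewrite /twistl polyl_mod !polyl_mul polyl_cubic /twistX -!mul_polyC; congr (_ * _).
have : zF (Z.mul (Zneg 3%positive) b) = - (3 * zF b) by rewrite zFM mulNr.
move: (Z.mul _ b) => c /= ->; rewrite rmorphN; ring.
Qed.

Lemma good_primeP a b : good_prime a b ->
  [/\ zF a != 0, zF b != 0, cubic_disc (zF a) (zF b) != 0 &
      hasse_witt_det (zF a) (zF b) (twistX (zF a) (zF b)) != 0].
Proof.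
rewrite /good_prime -(zF_mod a) -(zF_mod b).
move: (Z.modulo a _) (Z.modulo b _) => {}a {}b.
case: ifP => // /nonzero_modP a0; case: ifP => // /nonzero_modP b0.
case: ifP => // /nonzero_modP d0 /nonzero_modP t0.
split=> //.
  move: d0; rewrite /discZ zFD !zFM /cubic_disc.
  by have [-> ->] : zF (Zpos 4%positive) = 4 /\ zF (Zpos 27%positive) = 27 by [].
by move: t0; rewrite /detZ !(zFB, zFM) -!coef_polyl !polyl_exp polyl_cubic polyl_twist.
Qed.
End ListPolynomials.

(** The primes are tried in increasing order and one success is enough; all are odd, as the
    reduction argument requires. *)
Definition good_primes : seq nat := [:: 3; 5; 7; 11; 13; 17; 19; 23; 29; 31; 37].

Definition has_good_prime (a b : Z) : bool := 
  foldr (fun p rest => if good_prime p a b then true else rest) false good_primes.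

Lemma free_generators_of_good_prime (a b : int) : has_good_prime (Z_of_int a) (Z_of_int b) ->
  ec_free_generators2 (EgA a b) (EgB a b) (Pg a b) (Qg a b).
Proof.
move=> good.
have [p p_in] : exists2 p, p \in good_primes & good_prime p (Z_of_int a) (Z_of_int b).
  move: good; rewrite /has_good_prime; elim: good_primes => //= p s IH.
  case: ifP => [gp _|_ /IH[q q_in gq]]; first by exists p; rewrite ?inE ?eqxx.
  by exists q; rewrite // inE q_in orbT.
have /andP[p_prime p_odd] : prime p && odd p.
  by move: p p_in; apply/allP.
case/(good_primeP p_prime); rewrite /zF !Z_of_intK => a0 b0 disc0 det0.
have nz (z : int) : z%:~R != 0 :> 'F_p -> z != 0 by apply: contraNneq => ->; rewrite rmorph0.
apply: free_generators_of_no_twist_points; [exact: nz | exact: nz | |].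
  by rewrite -intr_cubic_disc intr_eq0; apply: nz; rewrite intr_cubic_disc.
by move=> A B W; exact: (no_twist_point_rat p_prime p_odd a0 b0 disc0 det0).
Qed.

(** * Verification for the four families of coefficients *)

Lemma case_a_good a b : case_a a b -> has_good_prime (Z_of_int a) (Z_of_int b).
Proof.
pose aZ r s := Z.sub (Z.mul r s) (Z.mul (Z.add r s) (Z.add r s)).
pose bZ r s := Z.mul (Z.mul r s) (Z.add r s).
have chk : all (fun r => all (fun s => if (0 < r < s)%N then
    has_good_prime (aZ (Z.of_nat r) (Z.of_nat s)) (bZ (Z.of_nat r) (Z.of_nat s)) else true)
    (iota 0 16)) (iota 0 16).
  by vm_compute.
case=> r [s [r1 rs s15 -> ->]].
have [r' er] : exists r' : nat, r = r' by exists (absz r); lia.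
have [s' es] : exists s' : nat, s = s' by exists (absz s); lia.
have -> : Z_of_int (r * s - (r + s) ^+ 2) = aZ (Z.of_nat r') (Z.of_nat s').
  by rewrite er es /aZ; lia.
have -> : Z_of_int (r * s * (r + s)) = bZ (Z.of_nat r') (Z.of_nat s').
  by rewrite er es /bZ; lia.
have /allP/(_ r') := chk; rewrite mem_iota => h.
have /h/allP/(_ s') : (0 <= r' < 0 + 16)%N by lia.
rewrite mem_iota => k; have /k : (0 <= s' < 0 + 16)%N by lia.
by have -> : (0 < r' < s')%N by lia.
Qed.

Lemma case_b_good a b : case_b a b -> has_good_prime (Z_of_int a) (Z_of_int b).
Proof.
pose aZ r s d := Z.sub (Z.mul (Zneg 3%positive) (Z.mul r r)) (Z.mul d (Z.mul s s)).
pose bZ r s d := Z.mul (Z.mul (Zpos 2%positive) r) (Z.sub (Z.mul r r) (Z.mul d (Z.mul s s))).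
pose r123 : seq int := [:: 1; 2; 3].
(* The excluded parameters pass the test by default; for [d = -3] and [r = s], for instance, the
   coefficient [a] would be zero. *)
have chk : all (fun r => all (fun s => all (fun d =>
    if (d == -3) ==> (r != s) && ((r, s) != (1, 3)) then
    has_good_prime (aZ (Z_of_int r) (Z_of_int s) (Z_of_int d))
                   (bZ (Z_of_int r) (Z_of_int s) (Z_of_int d)) else true)
    dlist) r123) r123.
  by vm_compute.
case=> r [s [d [[r_in s_in d_in d3] [-> ->]]]].
have -> : Z_of_int (- 3 * r ^+ 2 - d * s ^+ 2) = aZ (Z_of_int r) (Z_of_int s) (Z_of_int d).
  by rewrite /aZ; lia.
have -> : Z_of_int (2 * r * (r ^+ 2 - d * s ^+ 2)) = bZ (Z_of_int r) (Z_of_int s) (Z_of_int d).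
  by rewrite /bZ; lia.
have /allP/(_ r r_in)/allP/(_ s s_in)/allP/(_ d d_in) := chk.
by have -> : (d == -3) ==> (r != s) && ((r, s) != (1, 3)) by apply/implyP => /eqP/d3[/eqP-> /eqP->].
Qed.

Lemma pP_Z p : pP p = int_of_Z (Zpos p).
Proof. rewrite /pP /=; congr Posz; lia. Qed.
Lemma nP_Z p : nP p = int_of_Z (Zneg p).
Proof. by rewrite /nP pP_Z; lia. Qed.

Definition pairs_good (l : seq (int * int)) : Prop :=
  forall a b, (a, b) \in l -> has_good_prime (Z_of_int a) (Z_of_int b).

Lemma pairs_good_nil : pairs_good [::]. Proof. by []. Qed.

(** The entries remain symbolic images of binary integers, so the test is evaluated on [Z] without
    ever computing a unary literal. *)
Lemma pairs_good_cons x y l : has_good_prime x y -> pairs_good l ->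
  pairs_good ((int_of_Z x, int_of_Z y) :: l).
Proof.
by move=> xy hl a b; rewrite in_cons => /orP[/eqP[-> ->]|/hl//]; rewrite !int_of_ZK.
Qed.

Lemma clist_good : pairs_good clist.
Proof.
rewrite /clist !pP_Z !nP_Z.
by do !(apply: pairs_good_cons; first by vm_compute); exact: pairs_good_nil.
Qed.

Lemma dlist_pairs_good : pairs_good dlist_pairs.
Proof.
rewrite /dlist_pairs !pP_Z.
by do !(apply: pairs_good_cons; first by vm_compute); exact: pairs_good_nil.
Qed.

Theorem theorem6p1 (a b : int) :
  admissible_ab a b ->
  ec_free_generators2 (EgA a b) (EgB a b) (Pg a b) (Qg a b).
Proof.
move=> h; apply: free_generators_of_good_prime.
by case: h => [/case_a_good | /case_b_good | /clist_good | /dlist_pairs_good].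
Qed.
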